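(* Suppose that $g\in C^\infty(\mathbb{R})$ satisfies $g(x)\ge0$, $g(0)=0$ and the decay condition $$\liminf_{x\to0}\left|x\ln\frac1{g(x)}\right|\ne0 .$$ Then for some $\varepsilon>0$, the operator $$\mathcal{L}\equiv\frac{\partial^2}{\partial x^2}+g(x)\frac{\partial^2}{\partial y^2}+\frac{\partial^2}{\partial t^2}$$ fails to be $W_A^{1,2}$-hypoelliptic in the open subset $(-1,1)\times\mathbb{R}\times(-\varepsilon,\varepsilon)$ of $\mathbb{R}^3$ containing the origin, where $\nabla_A\equiv\left(\frac{\partial}{\partial x},\sqrt{g(x)}\frac{\partial}{\partial y},\frac{\partial}{\partial t}\right)$ is the degenerate gradient associated with $\mathcal{L}$.
   Context: For an open set $V\subset\mathbb{R}^3$, $W_A^{1,2}(V)$ is the degenerate Sobolev space of $v\in L^2(V)$ with $\nabla_Av\in L^2(V)$, with norm $\left(\int_V|v|^2+|\nabla_Av|^2\right)^{1/2}$. A function $u$ (locally in $W_A^{1,2}$ on $V$) is a $W_A^{1,2}$-weak solution of $\mathcal{L}u=\phi$ in $V$ if $-\int\nabla_Aw\cdot\nabla_Au=\int\phi w$ for all Lipschitz $w$ with compact support in $V$. $\mathcal{L}$ is $W_A^{1,2}$-hypoelliptic in $V$ if, for all smooth $\phi$ in $V$, every $W_A^{1,2}$-weak solution $u$ of $\mathcal{L}u=\phi$ in $V$ is smooth in $V$ (after modification on a null set). The convention $\ln\frac10=+\infty$ is used, and the value $+\infty$ of the $\liminf$ is allowed. *)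

(* Defs.v *)
From HB Require Import structures.
From mathcomp Require Import all_boot all_order all_algebra.
From mathcomp Require Import all_classical all_reals all_analysis.

Set Implicit Arguments.
Unset Strict Implicit.
Unset Printing Implicit Defensive.

Import Order.TTheory GRing.Theory Num.Theory.
Import numFieldNormedType.Exports.

Local Open Scope classical_set_scope.
Local Open Scope ring_scope.

(* A point (x, y, t) of R^3 is ((x, y), t) : R * R * R, with its product
   topology, (sup) norm and Borel sigma-algebra. *)
Definition mu3 (R : realType) :
    {measure set (measurableTypeR R * measurableTypeR R * measurableTypeR R)
       -> \bar R} :=
  (@lebesgue_measure R \x @lebesgue_measure R \x @lebesgue_measure R)%E.

Definition basis3 (R : realType) (i : 'I_3) : R * R * R :=
  ((i == 0%N :> nat)%:R, (i == 1%N :> nat)%:R, (i == 2%N :> nat)%:R).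

Definition smooth1 (R : realType) (g : R -> R) : Prop :=
  forall (n : nat) (x : R), derivable (derive1n n g) x 1.

Definition iter_partial (R : realType) (s : seq 'I_3) (f : R * R * R -> R) :
    R * R * R -> R :=
  foldr (fun i h => 'D_(basis3 R i) h) f s.

Definition smooth_on (R : realType) (V : set (R * R * R))
    (f : R * R * R -> R) : Prop :=
  forall (s : seq 'I_3) (p : R * R * R), V p ->
    {for p, continuous (iter_partial s f)} /\
    forall i : 'I_3, derivable (iter_partial s f) p (basis3 R i).

Definition compactly_contained (R : realType) (K V : set (R * R * R)) : Prop :=
  compact (closure K) /\ closure K `<=` V.

Definition csupp_in (R : realType) (V : set (R * R * R))
    (f : R * R * R -> R) : Prop :=
  compactly_contained [set p | f p != 0] V.

(* The components of nabla_A = (d/dx, sqrt g(x) d/dy, d/dt) are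
   coefA g i * d/dx_i, with derivatives taken pointwise: everywhere if v is
   differentiable, almost everywhere (Rademacher) if v is Lipschitz. *)
Definition coefA (R : realType) (g : R -> R) (i : 'I_3) (p : R * R * R) : R :=
  if i == 1%N :> nat then Num.sqrt (g p.1.1) else 1.

Definition gradA (R : realType) (g : R -> R) (v : R * R * R -> R) (i : 'I_3)
    (p : R * R * R) : R :=
  coefA g i p * 'D_(basis3 R i) v p.

Definition L2_on (R : realType) (V : set (R * R * R))
    (v : R * R * R -> R) : Prop :=
  (v \_ V) \in Lfun (mu3 R) 2%:E.

(* D is nabla_A v on V in the sense of distributions.  As g depends on x only,
   each component X of nabla_A is divergence free, so its formal adjoint
   is - X. *)
Definition is_weak_gradA (R : realType) (g : R -> R) (V : set (R * R * R))
    (v : R * R * R -> R) (D : 'I_3 -> R * R * R -> R) : Prop :=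
  forall (i : 'I_3) (psi : R * R * R -> R),
    smooth_on setT psi -> csupp_in V psi ->
    \int[mu3 R]_(p in V) (D i p * psi p) =
      - (\int[mu3 R]_(p in V) (v p * gradA g psi i p)).

(* v belongs to W_A^{1,2}(V), with nabla_A v = D. *)
Definition W12A (R : realType) (g : R -> R) (V : set (R * R * R))
    (v : R * R * R -> R) (D : 'I_3 -> R * R * R -> R) : Prop :=
  [/\ L2_on V v, forall i : 'I_3, L2_on V (D i) & is_weak_gradA g V v D].

Definition W12A_loc (R : realType) (g : R -> R) (V : set (R * R * R))
    (v : R * R * R -> R) (D : 'I_3 -> R * R * R -> R) : Prop :=
  forall V' : set (R * R * R), open V' -> compactly_contained V' V ->
    W12A g V' v D.

(* u is a W_A^{1,2}-weak solution in V of L u = phi, where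
   L = d^2/dx^2 + g(x) d^2/dy^2 + d^2/dt^2; the field D, which is determined
   by u up to null sets, is nabla_A u. *)
Definition weak_solution (R : realType) (g : R -> R) (V : set (R * R * R))
    (phi u : R * R * R -> R) : Prop :=
  exists2 D : 'I_3 -> R * R * R -> R, W12A_loc g V u D &
    forall w : R * R * R -> R, lipschitz w -> csupp_in V w ->
      - (\int[mu3 R]_(p in V) (\sum_(i < 3) gradA g w i p * D i p)) =
        \int[mu3 R]_(p in V) (phi p * w p).

Definition W12A_hypoelliptic (R : realType) (g : R -> R)
    (V : set (R * R * R)) : Prop :=
  forall phi : R * R * R -> R, smooth_on V phi ->
  forall u : R * R * R -> R, weak_solution g V phi u ->
    exists2 v : R * R * R -> R, smooth_on V v &
      {ae mu3 R, forall p, V p -> u p = v p}.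

(* In \bar R the inverse of 0 is +oo and lne +oo = +oo, so ln (1 / 0) = +oo;
   lime_inf is the lower limit over punctured neighbourhoods. *)
Definition decay_liminf (R : realType) (g : R -> R) : \bar R :=
  lime_inf (fun x : R => `| x%:E * lne ((g x)%:E)^-1 |%E) 0.

Definition slab (R : realType) (eps : R) : set (R * R * R) :=
  [set p | (-1 < p.1.1 < 1) /\ (- eps < p.2 < eps)].

(* Main.v *)
(* The decay hypothesis gives g x <= exp (- c / |x|) near 0.  For lam = 2^j let
   U_lam (x, t) solve U_xx + U_tt = lam^2 g U - G in ]-1, 1[ x ]-pi/2, pi/2[ with
   zero boundary values, where G >= 0 is a hat function of t supported in
   |t| <= pi/6; expanding G in cosines of t reduces this to two-point boundary
   value problems in x.  For r = c / (2 ln lam) the potential lam^2 g is at most 1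
   on [-r, r], and comparison with explicit subsolutions on the strip |x| <= r
   gives U_lam (0, pi/3) >= del lam^-K.  Then
     u (x, y, t) = sum_j 32^-j U_{2^j} (x, t + pi/3) cos (2^j y)
   solves L u = 0 for |t| < pi/6, but u (0, y, 0) is a cosine series whose
   coefficients at the frequencies 2^j are nonnegative and decay only
   polynomially, so it cannot be smooth. *)
Require Import Defs.
From HB Require Import structures.
From mathcomp Require Import all_boot all_order all_algebra.
From mathcomp Require Import all_classical all_reals all_analysis.
From mathcomp Require Import measurable_realfun.
From mathcomp Require Import ring lra.

Set Implicit Arguments.
Unset Strict Implicit.
Unset Printing Implicit Defensive.

Import Order.TTheory GRing.Theory Num.Theory.
Import numFieldNormedType.Exports.

Local Open Scope classical_set_scope.
Local Open Scope ring_scope.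

(** * One-dimensional integration by parts for Lipschitz functions *)

(** On the strip |x| <= r the comparison functions behave like cos (pi x / (2 r)) exp (- k t) with k
    = 1 + pi / (2 r). As r is of order 1 / ln lam, the loss between the source and t = pi/3 is a
    power of lam; if r ln lam tended to 0, it would exceed every power. This is where the decay
    hypothesis acts. A source is needed because zero boundary values without one force U = 0. It
    sits away from the window around t = pi/3, and only that window is kept. A hat suits because its
    cosine coefficients are nonnegative and O(1/k^2): solving in x gains another factor 1/(2k+1)^2,
    so two t derivatives still converge absolutely. The weight 32^-j spends two powers of 2^j on the
    y derivatives, two on the growth of the bounds for U_lam, and leaves one for summability. The
    test functions of the weak equation are only Lipschitz, and their partial derivatives are
    pointwise limits with a default value where they do not exist. Instead of Rademacher's theorem
    in R^3, a fundamental theorem in one variable is applied on every line parallel to an axis,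
    followed by Fubini. *)

Lemma integrable_of_bounded (d : measure_display) (T : measurableType d) (R : realType)
    (mu : {measure set T -> \bar R}) (A : set T) (f : T -> R) (M : R) :
  measurable A -> (mu A < +oo)%E -> measurable_fun A f ->
  (forall x, A x -> `|f x| <= M) -> mu.-integrable A (EFin \o f).
Proof.
move=> mA muA mf fM; apply: measurable_bounded_integrable => //.
exists M; split; first exact: num_real.
by move=> N /ltW MN x Ax; exact: le_trans (fM _ Ax) MN.
Qed.

(* The Lebesgue-Stieltjes measure of f is dominated by Lebesgue measure; its
   Radon-Nikodym density is the a.e. derivative. *)
Lemma cumulative_density (R : realType) (f : R -> R) :
  (forall x y, x <= y -> 0 <= f y - f x <= y - x) ->
  forall a b : R, a <= b -> exists rho : R -> R,
   [/\ (@lebesgue_measure R).-integrable setT (EFin \o rho),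
    forall x, a <= x <= b -> (\int[lebesgue_measure]_(t in `]a, x]) (rho t)%:E = (f x - f a)%:E)%E
    & {ae lebesgue_measure, forall x, a < x < b -> is_derive x 1 f (rho x)}].
Proof.
move=> fP a b ab.
have cont (h : R -> R) : (forall x y, x <= y -> 0 <= h y - h x <= y - x) -> continuous h.
  move=> hP x; apply/cvgrPdist_le => e e0; near=> y.
  have : `|x - y| <= e by near: y; exact: (@cvgr_dist_le _ _ _ (nbhs x)).
  have [xy|yx] := leP x y.
    by have /andP[? ?] := hP _ _ xy; rewrite !ler_norml => /andP[? ?]; lra.
  by have /andP[? ?] := hP _ _ (ltW yx); rewrite !ler_norml => /andP[? ?]; lra.
have f'P x y : x <= y -> 0 <= (y - f y) - (x - f x) <= y - x.
  by move=> /fP /andP[? ?]; lra.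
have ndf : {homo f : x y / x <= y} by move=> x y /fP /andP[? _]; lra.
have ndf' : {homo (fun x => x - f x) : x y / x <= y}.
  by move=> x y /f'P /andP[? _]; lra.
pose F : cumulative R R := HB.pack f
  (isCumulative.Build R _ R f ndf (right_continuousW (cont _ fP))).
pose F' : cumulative R R := HB.pack (fun x => x - f x)
  (isCumulative.Build R _ R _ ndf' (right_continuousW (cont _ f'P))).
have LSoc (G : cumulative R R) (x y : R) : x <= y ->
    lebesgue_stieltjes_measure G `]x, y]%classic = (G y - G x)%:E.
  move=> xy; rewrite /lebesgue_stieltjes_measure /measure_extension.
  rewrite measurable_mu_extE/=; last exact: is_ocitv.
  by rewrite wlength_itv_bnd.
(* The Stieltjes measures of f and of x - f add up to Lebesgue measure, because they do so on
   half-open intervals. Hence the first one is at most Lebesgue measure on every measurable set. *)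
have le1 (A : set (measurableTypeR R)) : measurable A ->
    (lebesgue_stieltjes_measure F A <= lebesgue_measure A)%E.
  move=> mA; rewrite (@lebesgue_measure_unique _ (measure_add
    (lebesgue_stieltjes_measure F) (lebesgue_stieltjes_measure F')))//.
    by rewrite [leRHS]measure_addE leeDl.
  move=> X [[x y] _ <-] /=; rewrite [RHS]measure_addE.
  have [xy|yx] := leP x y.
    have E1 := LSoc F _ _ xy; have E2 := LSoc F' _ _ xy. have E3 := LSoc idfun _ _ xy. rewrite
      [LHS]E3. transitivity ((F y - F x)%:E + (F' y - F' x)%:E)%E; last by rewrite -E1 -E2.
    rewrite -EFinD /=; congr EFin; lra.
  rewrite set_itv_ge ?bnd_simp -?leNgt ?(ltW yx)//. by rewrite !measure0 adde0.
(* Restricting to ]a, b] makes the Stieltjes measure finite, so that its Radon-Nikodym density is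
   integrable on the whole line. *)
pose I : set (measurableTypeR R) := `]a, b]%classic.
have mI : measurable I by exact: measurable_itv.
have finI : (lebesgue_stieltjes_measure F I < +oo)%E.
  by rewrite [ltLHS](LSoc F)// ltry.
pose nu : {finite_measure set _ -> \bar R} := mfrestr mI finI.
have [|rho0 [rho0_ge0 rho0_fin int_rho0 nuE]] :=
    @radon_nikodym_sigma_finite _ _ _ lebesgue_measure nu.
  apply/null_content_dominatesP => A mA A0.
  apply/eqP; rewrite eq_le measure_ge0 andbT /nu /= /mfrestr /mrestr.
  rewrite -A0; apply: le_trans (le1 _ mA).
  by apply: le_measure; rewrite ?inE//; exact: measurableI.
pose rho x := fine (rho0 x).
have rhoE x : (rho x)%:E = rho0 x by rewrite fineK.
have rhoi : (@lebesgue_measure R).-integrable setT (EFin \o rho).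
  by rewrite (_ : EFin \o rho = rho0)//; apply/funext => x /=.
have intE x : a <= x <= b -> (\int[lebesgue_measure]_(t in `]a, x]) (rho t)%:E = (f x - f a)%:E)%E.
  move=> /andP[ax xb].
  under eq_integral do rewrite rhoE.
  rewrite -nuE; last exact: measurable_itv.
  rewrite /nu /= /mfrestr /mrestr (_ : _ `&` _ = `]a, x]%classic) ?LSoc//.
  apply/setIidPl => t; rewrite /I /= !in_itv/= => /andP[at_ tx].
  by rewrite at_ (le_trans tx).
exists rho; split => //.
have rhoiA (A : set R) : measurable A -> (@lebesgue_measure R).-integrable A (EFin \o rho).
  by move=> mA; apply: integrableS rhoi.
have := @FTC1 _ rho (BRight a) (fun y => rhoiA _ (measurable_itv _))
  (open_integrable_locally openT rhoi).
apply: filterS; first exact: (ae_filter_ringOfSetsType lebesgue_measure).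
move=> x /= + /andP[ax xb]; move=> /(_ ax)[dF F'E].
have dF' : is_derive x 1 (fun y => f y - f a) (rho x).
  apply: near_eq_is_derive; last by apply: (DeriveDef dF); rewrite -derive1E.
  near=> y; rewrite /Rintegral intE//.
  by apply/andP; split; apply: ltW; near: y; [exact: lt_nbhsr|exact: lt_nbhsl].
have -> : f = (fun y => f y - f a) + cst (f a).
  by apply/funext => y; rewrite /GRing.add/= subrK.
by rewrite -[rho x]addr0; apply: is_deriveD.
Unshelve. all: end_near. Qed.

(** Adding a multiple of x to h and rescaling gives slopes between 0 and 1, the setting of
    [cumulative_density]. Undoing this turns the density into the a.e. derivative of h, whose
    integral telescopes to a difference of two values of h outside [a, b]. *)
Lemma lipschitz_fundamental_theorem (R : realType) (h : R -> R) (K a b : R) :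
  (forall x y, `|h x - h y| <= K * `|x - y|) ->
  a <= b -> (forall x, ~~ (a <= x <= b) -> h x = 0) ->
  exists rho : R -> R,
   [/\ (@lebesgue_measure R).-integrable setT (EFin \o rho),
    (\int[lebesgue_measure]_t (rho t)%:E = 0)%E
    & {ae lebesgue_measure, forall x : R, is_derive x 1 h (rho x)}].
Proof.
move=> lip ab h0.
pose K' := `|K| + 1; have K'0 : 0 < K' by rewrite ltr_wpDl.
(* Normalised so that f and x - f are both nondecreasing. *)
pose f x := x / 2 + h x / (2 * K').
have fP x y : x <= y -> 0 <= f y - f x <= y - x.
  move=> xy; have lipyx := lip y x.
  rewrite (ger0_norm (_ : 0 <= y - x)) ?subr_ge0// in lipyx.
  have -> : f y - f x = (y - x) / 2 + (h y - h x) / (2 * K').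
    by rewrite /f; field; rewrite gt_eqF.
  have : `|(h y - h x) / (2 * K')| <= (y - x) / 2.
    rewrite normrM normfV (ger0_norm (_ : 0 <= 2 * K')); last first.
      by rewrite mulr_ge0// ltW.
    rewrite ler_pdivrMr ?mulr_gt0//; apply: (le_trans lipyx).
    rewrite [leRHS](_ : _ = K' * (y - x)); last by field.
    apply: ler_wpM2r; first by rewrite subr_ge0.
    by rewrite /K' (le_trans (ler_norm _))// lerDl.
  by set q := (h y - h x) / _; rewrite ler_norml => /andP[? ?]; apply/andP; split; lra.
(* The integral is computed between a - 1 and b + 1, where h vanishes. The density is taken up to b
   + 2 because its derivative property holds on an open interval, which has to contain the closed
   end b + 1. *)
have ab1 : a - 1 <= b + 1 by lra.
have ab2 : a - 1 <= b + 2 by lra.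
have [rho [rhoi intrho drho]] := cumulative_density fP ab2.
pose I : set (measurableTypeR R) := `]a - 1, b + 1]%classic.
have mI : measurable I by exact: measurable_itv.
pose r0 x := (2 * K') * rho x - K'.
have muI : lebesgue_measure I = (b + 1 - (a - 1))%:E.
  by rewrite lebesgue_measure_itv/= lte_fin (_ : a - 1 < b + 1) //; lra.
have finI : (lebesgue_measure I < +oo)%E by rewrite muI ltry.
have i1 : (@lebesgue_measure R).-integrable I (EFin \o (fun x => (2 * K') * rho x)).
  have rI := integrableS measurableT mI (@subsetT _ I) rhoi.
  exact: (integrableZl mI (2 * K') rI).
have i2 : (@lebesgue_measure R).-integrable I (EFin \o cst K').
  by apply: (@integrable_of_bounded _ _ _ _ _ _ K') => // x _; rewrite /= ger0_norm// ltW.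
have ir0 : (@lebesgue_measure R).-integrable I (EFin \o r0).
  exact: (integrableB mI i1 i2).
exists (r0 \_ I); split.
- by rewrite -restrict_EFin -integrable_mkcond.
- under eq_integral do rewrite -[_%:E]/((EFin \o _) _) -restrict_EFin.
  rewrite -integral_mkcond.
  under eq_integral do rewrite /= EFinB.
  rewrite integralB_EFin// integral_cst//.
  rewrite (_ : (\int[_]_(x in I) _ = ((2 * K') * (f (b + 1) - f (a - 1)))%:E)%E); last first.
    under eq_integral do rewrite EFinM.
    rewrite integralZl//; last exact: integrableS rhoi.
    by rewrite intrho//; lra.
  rewrite [X in (_ * X)%E]muI -EFinM -EFinB; congr EFin.
  rewrite /f (h0 (a - 1)) ?(h0 (b + 1)) ?mul0r; first by field; rewrite ?gt_eqF.
  by apply/negP; lra. by apply/negP; lra.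
- move: drho; apply: filterS; first exact: (ae_filter_ringOfSetsType lebesgue_measure).
  move=> x /= dx.
  have [xI|xI] := boolP (a - 1 < x <= b + 1).
    rewrite patchE mem_set; last by rewrite /I/= in_itv/=.
    have hE : h = (2 * K') *: f - K' *: id.
      apply/funext => y; transitivity ((2 * K') * f y - K' * y) => //.
      by rewrite /f; field; rewrite ?gt_eqF.
    have dfx : is_derive x 1 f (rho x) by apply: dx; lra.
    rewrite hE; apply: is_derive_eq.
    by rewrite /r0 /GRing.scale/= mulr1.
  have zero : forall y : R, ~~ (a <= y <= b) -> is_derive y 1 h 0.
    move=> y yab; apply: (@near_eq_is_derive _ _ _ (cst 0) h y 1 0 _ (is_derive_cst _ _ _)).
    have [ya|ya] := ltP y a.
      near=> z. rewrite /= h0//. rewrite negb_and -ltNge. apply/orP; left. near: z. exact: lt_nbhsl.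
    have yb : b < y by rewrite ltNge; apply: contraNN yab => ->; rewrite ya.
    near=> z. rewrite /= h0//. rewrite negb_and -!ltNge. apply/orP; right. near: z. exact: lt_nbhsr.
  rewrite patchE memNset//; last by rewrite /I /= in_itv/=; exact/negP.
  by apply: zero; apply: contraNN xI => ?; lra.
Unshelve. all: end_near. Qed.

(* By continuity in h, the Cauchy criterion may be tested on rational h only. *)
Lemma measurable_cvg_dnbhs0 (d : measure_display) (T : measurableType d) (R : realType)
    (q : T -> R -> R) :
  (forall h, h != 0 -> measurable_fun setT (q^~ h)) ->
  (forall p h, h != 0 -> {for h, continuous (q p)}) ->
  measurable [set p | cvg (q p h @[h --> 0^'])].
Proof.
move=> mq cq.
pose ok (m : nat) (a : rat) := (ratr a != 0 :> R) && (`|ratr a : R| < m.+1%:R^-1).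
have -> : [set p | cvg (q p h @[h --> 0^'])] =
  \bigcap_k \bigcup_m \bigcap_(a in [set a | ok m a]) \bigcap_(b in [set b | ok m b])
   [set p | `|q p (ratr a) - q p (ratr b)| <= k.+1%:R^-1].
  apply/seteqP; split => p /=.
    move=> /cvg_ex[/= l ql] k _.
    have k0 : 0 < (k.+1%:R^-1 / 2 : R) by rewrite divr_gt0// invr_gt0.
    move/cvgrPdist_le : ql => /(_ _ k0); rewrite /dnbhs /within /= => /nbhs_ballP[e /= e0 qe].
    have [m _ me] := near_infty_natSinv_lt (PosNum e0).
    have {}me : m.+1%:R^-1 < e by exact: (me m (leqnn m)).
    exists m => //= a /andP[a0 am] b /andP[b0 bm] /=.
    have qae : `|l - q p (ratr a)| <= k.+1%:R^-1 / 2.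
      by apply: qe => //; rewrite -ball_normE /= sub0r normrN (lt_trans am).
    have qbe : `|l - q p (ratr b)| <= k.+1%:R^-1 / 2.
      by apply: qe => //; rewrite -ball_normE /= sub0r normrN (lt_trans bm).
    have := ler_distD l (q p (ratr a)) (q p (ratr b)).
    rewrite (distrC _ l) => /le_trans; apply.
    by rewrite (splitr k.+1%:R^-1) lerD.
  move=> H; apply/cauchy_cvgP/cauchy_exP => e e0.
  have e20 : 0 < e / 2 by rewrite divr_gt0.
  have [k _ ke] := near_infty_natSinv_lt (PosNum e20).
  have [m _ Hm] := H k I.
  have m0 : 0 < m.+1%:R^-1 :> R by rewrite invr_gt0.
  have [a] := rat_in_itvoo m0; rewrite in_itv/= => /andP[a0 am].
  have oka : ok m a by rewrite /ok gt_eqF//= gtr0_norm.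
  exists (q p (ratr a)); rewrite /dnbhs /within /= -/(nbhs _ _).
  apply/nbhs_ballP; exists m.+1%:R^-1 => //= h. rewrite -ball_normE /= sub0r normrN => hm h0.
  have := cq p h h0 => /cvgrPdist_lt /(_ _ e20) qh.
  have bm : \forall b \near h, `|b| < m.+1%:R^-1.
    have : (fun b => `|b|) @ h --> `|h| by exact: norm_continuous.
    by move=> /cvgr_lt; apply.
  have b0 : \forall b \near h, b != 0.
    by have /cvgr_neq0 := @cvg_id _ (nbhs h); apply.
  have [/= r r0 rP] : \forall b \near h, [/\ `|q p h - q p b| < e / 2, `|b| < m.+1%:R^-1 & b != 0].
    by near=> b; split; near: b.
  have hr : h - r < h + r by move: r0 => /= r0; lra.
  have [b] := rat_in_itvoo hr.
  rewrite in_itv/= => /andP[hb bh]; have [|qb bm' b0'] := rP (ratr b).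
    by rewrite /= ltr_norml; apply/andP; split; lra.
  have okb : ok m b by rewrite /ok b0'.
  have := Hm a oka b okb; rewrite /= => qab.
  have {}ke : k.+1%:R^-1 < e / 2 by exact: (ke k (leqnn k)).
  have := ler_distD (q p (ratr b)) (q p (ratr a)) (q p h).
  rewrite (distrC (q p (ratr b)) (q p h)); move: ke qab qb; set c := k.+1%:R^-1; lra.
apply: bigcapT_measurable => k; apply: bigcupT_measurable => m.
have mrat (P : set rat) (F : rat -> set T) : (forall a, P a -> measurable (F a)) ->
    measurable (\bigcap_(a in P) F a).
  move=> mF; rewrite -[X in measurable X]setCK setC_bigcap; apply: measurableC.
  rewrite bigcup_mkcond; apply: bigcupT_measurable_rat => a.
  by case: ifPn => // aP; apply: measurableC; apply: mF; rewrite inE in aP.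
apply: (mrat _ _) => a /andP[a0 _]; apply: mrat => b /andP[b0 _].
have mf : measurable_fun setT (fun p => `|q p (ratr a) - q p (ratr b)|).
  by apply: measurableT_comp => //; apply: measurable_funB; exact: mq.
rewrite [X in measurable X](_ : _ = setT `&` (fun p =>
  `|q p (ratr a) - q p (ratr b)|) @^-1` `]-oo, k.+1%:R^-1]%classic).
  exact: mf.
by apply/seteqP; split => p /=; rewrite in_itv/=; [|move=> []].
Unshelve. all: end_near. Qed.

(** The sigma-algebra is the product one, so openness has to be turned into countable operations: A
    is the union of the cubes with rational centre and half-side 1/(n+1) that it contains. *)
Lemma open_measurable3 (R : realType) (A : set (R * R * R)) :
  open A ->
  measurable (A : set (measurableTypeR R * measurableTypeR R * measurableTypeR R)).
Proof.
move=> oA.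
pose box (a b c : rat) (n : nat) : set
  (measurableTypeR R * measurableTypeR R * measurableTypeR R) :=
  [set p | [/\ `|p.1.1 - ratr a| < n.+1%:R^-1, `|p.1.2 - ratr b| < n.+1%:R^-1
             & `|p.2 - ratr c| < n.+1%:R^-1]].
(* The condition does not depend on p: [F a b c n] is the whole cube if the cube lies in A, and
   empty otherwise. *)
pose F a b c n := [set p | box a b c n `<=` A /\ box a b c n p].
have -> : A = \bigcup_a \bigcup_b \bigcup_c \bigcup_n F a b c n.
  apply/seteqP; split => [p Ap|p [a _ [b _ [c _ [n _ [AF pF]]]]]]; last exact: AF.
  have [/= e e0 eA] := (nbhs_ballP _ _).1 (open_nbhs_nbhs (conj oA Ap)).
  have e20 : 0 < e / 2 by rewrite divr_gt0.
  have [n _ ne] := near_infty_natSinv_lt (PosNum e20).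
  have {}ne : n.+1%:R^-1 < e / 2 by exact: (ne n (leqnn n)).
  have n0 : 0 < n.+1%:R^-1 :> R by rewrite invr_gt0.
  have near_rat (x : R) : exists a, `|x - ratr a| < n.+1%:R^-1.
    have xn : x - n.+1%:R^-1 < x + n.+1%:R^-1 by move: n0; set r := n.+1%:R^-1; lra.
    have [a] := rat_in_itvoo xn; rewrite in_itv/= => xa; exists a.
    by move: xa; set r := n.+1%:R^-1 => /andP[? ?]; rewrite ltr_norml; apply/andP; split; lra.
  have [a pa] := near_rat p.1.1; have [b pb] := near_rat p.1.2; have [c pc] := near_rat p.2.
  exists a => //; exists b => //; exists c => //; exists n => //; split; last by split.
  move=> q [qa qb qc]; apply: eA.
  have tri (x y z : R) : `|x - z| < n.+1%:R^-1 -> `|y - z| < n.+1%:R^-1 -> `|x - y| < e.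
    move=> xz yz; rewrite (le_lt_trans (ler_distD z _ _))// (distrC z) (splitr e).
    by rewrite ltrD// (lt_trans _ ne).
  by split; [split|]; rewrite /ball /=; apply: tri; eassumption.
apply: bigcupT_measurable_rat => a; apply: bigcupT_measurable_rat => b.
apply: bigcupT_measurable_rat => c; apply: bigcupT_measurable => n.
rewrite /F; have [AF|AF] := pselect (box a b c n `<=` A); last first.
  by rewrite (_ : mkset _ = set0); [exact: measurable0|apply/seteqP; split => // p []].
have mball (f : measurableTypeR R * measurableTypeR R * measurableTypeR R ->
  measurableTypeR R) (x : R) :
    measurable_fun setT f -> measurable [set p | `|f p - x| < n.+1%:R^-1].
  move=> mf.
  have mg : measurable_fun setT (fun p => `|(f p : R) - x|).
    apply: measurableT_comp => //; apply: measurable_funB => //.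
  rewrite [X in measurable X](_ : _ = setT `&` (fun p =>
    `|(f p : R) - x|) @^-1` `]-oo, n.+1%:R^-1[%classic).
    exact: mg.
  by apply/seteqP; split => p /=; rewrite in_itv/=; [|move=> []].
rewrite (_ : mkset _ = [set p | `|p.1.1 - ratr a| < n.+1%:R^-1] `&`
  [set p | `|p.1.2 - ratr b| < n.+1%:R^-1] `&` [set p | `|p.2 - ratr c| < n.+1%:R^-1]); last first.
  by apply/seteqP; split => p /=; [move=> [_ [? ? ?]]|move=> [[? ?] ?]].
apply: measurableI; first apply: measurableI.
- apply: (mball (fst \o fst)); exact: measurableT_comp.
- apply: (mball (snd \o fst)); exact: measurableT_comp.
- exact: (mball snd).
Qed.

Lemma continuous_on_measurable3 (R : realType) (A : set (R * R * R)) (f : R * R * R -> R) :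
  open A -> {in A, continuous f} ->
  measurable_fun (A : set (measurableTypeR R * measurableTypeR R * measurableTypeR R)) f.
Proof.
move=> oA cf; apply: (measurability _ (RGenOpens.measurableE R)).
move=> _ [_ [a [b ->] <-]]; apply: open_measurable3.
rewrite openE => p [Ap fp]; apply: filterI; first exact: open_nbhs_nbhs.
have pA : p \in A by rewrite inE.
apply: (cf p pA); apply: open_nbhs_nbhs; split => //; exact: interval_open.
Qed.

(** On the measurable set where the limit exists it is the limit along h = 1/(n+1); elsewhere [lim]
    takes its default value, a constant. Partial derivatives are thus measurable as total
    functions. *)
Lemma measurable_lim_dnbhs0 (d : measure_display) (T : measurableType d) (R : realType)
    (q : T -> R -> R) :
  (forall h, h != 0 -> measurable_fun setT (q^~ h)) ->
  (forall p h, h != 0 -> {for h, continuous (q p)}) ->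
  measurable_fun setT (fun p => lim (q p h @[h --> 0^'])).
Proof.
move=> mq cq.
pose E := [set p | cvg (q p h @[h --> 0^'])].
have mE : measurable E by exact: measurable_cvg_dnbhs0.
rewrite -(setvU E); apply/measurable_funU => //; first exact: measurableC.
split; last first.
  apply: (@measurable_fun_cvg _ _ _ _ (fun n p => q p n.+1%:R^-1)).
    move=> n; apply: (measurable_funS measurableT (@subsetT _ _)); apply: mq.
    by rewrite gt_eqF// invr_gt0.
  move=> p /= Ep; apply: cvg_trans Ep => A /= qA.
  have := @cvg_harmonic R _ qA; move=> [N _ HN]; exists N => // n /HN /=; apply.
  by rewrite gt_eqF// invr_gt0.
apply: (@eq_measurable_fun _ _ _ _ _ (cst point)); last exact: measurable_cst.
by move=> p; rewrite inE => Ep; rewrite dvgP.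
Qed.

(** * Integration by parts on the slab *)

Definition set_coord (R : realType) (i : 'I_3) (p : R * R * R) (s : R) : R * R * R :=
  if i == 0%N :> nat then (s, p.1.2, p.2)
  else if i == 1%N :> nat then (p.1.1, s, p.2) else (p.1, s).

Lemma ord3P (i : 'I_3) : [\/ i = ord0, i = inord 1 | i = inord 2].
Proof.
case: i => [[|[|[|//]]] hi]; [apply: Or31|apply: Or32|apply: Or33]; apply: val_inj => //=;
  by rewrite inordK.
Qed.

Lemma set_coord_shift (R : realType) (i : 'I_3) (p : R * R * R) (s h : R) :
  h *: basis3 R i + set_coord i p s = set_coord i p (h + s).
Proof.
have comb (a b c x y z : R) :
  h *: ((a, b, c) : R * R * R) + (x, y, z) = (h * a + x, h * b + y, h * c + z) by [].
case: p => [[x y] t]; have [->|->|->] := ord3P i;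
  by rewrite /basis3 /set_coord /= ?inordK//= comb !(mulr0, mulr1, add0r).
Qed.

Lemma set_coord_id (R : realType) (i : 'I_3) (p : R * R * R) :
  exists s, set_coord i p s = p.
Proof.
case: p => [[x y] t]; have [->|->|->] := ord3P i; rewrite /set_coord /= ?inordK//=; by eexists.
Qed.

(** Both difference quotients are the same function of h, by [set_coord_shift]. Partial derivatives
    thereby become derivatives in one real variable. *)
Lemma is_derive_set_coord (R : realType) (i : 'I_3) (f : R * R * R -> R) (p : R * R * R) (s l : R) :
  is_derive (set_coord i p s) (basis3 R i) f l <-> is_derive s 1 (fun r => f (set_coord i p r)) l.
Proof.
have E : (fun h : R => h^-1 *: (f (h *: basis3 R i + set_coord i p s) - f (set_coord i p s))) =
  (fun h => h^-1 *: (f (set_coord i p (h *: (1 : R) + s)) - f (set_coord i p s))).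
  by apply/funext => h; rewrite set_coord_shift /GRing.scale/= mulr1.
split => -[d1 d2]; split.
- by rewrite /derivable -E.
- by rewrite /derive -E.
- by rewrite /derivable E.
- by rewrite /derive E.
Qed.

(* lebesgue_measure \x lebesgue_measure carries no sigma-finite instance, which
   Fubini on mu3 requires. *)
Definition mu2 (R : realType) : set (measurableTypeR R * measurableTypeR R) -> \bar R :=
  (@lebesgue_measure R \x @lebesgue_measure R)%E.

HB.instance Definition _ (R : realType) := Measure.on (@mu2 R).

Lemma mu2_sigma_finite (R : realType) : sigma_finite setT (@mu2 R).
Proof.
exists (fun n => `[- n%:R, n%:R]%classic `*` `[- n%:R, n%:R]%classic).
  apply/seteqP; split => // -[x y] _ /=.
  exists (maxn (Num.bound `|x|) (Num.bound `|y|)) => //=.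
  rewrite !in_itv/= -!ler_norml.
  have h (z : R) : `|z| <= (Num.bound `|z|)%:R :> R by rewrite ltW// archi_boundP.
  by split; rewrite (le_trans (h _))// ler_nat leq_max leqnn ?orbT.
move=> n; split; first by apply: measurableX; exact: measurable_itv.
rewrite /mu2 product_measure1E//.
pose I : set (measurableTypeR R) := `[- n%:R, n%:R]%classic.
have [r rE] : exists r : R, lebesgue_measure I = r%:E.
  by rewrite lebesgue_measure_itv/= lte_fin; case: ltP => _; eexists.
suff : (lebesgue_measure I * lebesgue_measure I < +oo)%E by [].
by rewrite rE ltry.
Qed.

HB.instance Definition _ (R : realType) :=
  @Measure_isSigmaFinite.Build _ _ _ (@mu2 R) (@mu2_sigma_finite R).

(** Fubini with direction i integrated innermost. For the first two directions the slice at fixed t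
    is known to be integrable only for almost every t, which is enough for the outer integral. *)
Lemma integral_lines0 (R : realType) (i : 'I_3) (G : R * R * R -> \bar R) :
  (mu3 R).-integrable setT G ->
  (forall p, (\int[lebesgue_measure]_s G (set_coord i p s) = 0)%E) ->
  (\int[mu3 R]_p G p = 0)%E.
Proof.
move=> Gi G0.
have {}Gi : (@mu2 R \x @lebesgue_measure R)%E.-integrable setT G by [].
rewrite (_ : \int[mu3 R]_p G p = \int[(@mu2 R \x @lebesgue_measure R)%E]_p G p)%E; last by [].
have [iE|iE|iE] := ord3P i.
- rewrite -(integral21_prod_meas1 Gi).
  transitivity (\int[@lebesgue_measure R]_x (cst 0%E x))%E; last exact: integral0.
  apply: ae_eq_integral => //; [exact: (measurable_fubini_G Gi)|].
  have := ae_integrable2 Gi.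
  apply: filterS.
  move=> t Gt _; rewrite /fubini_G -(integral21_prod_meas1 Gt)/=.
  transitivity (\int[@lebesgue_measure R]_x (cst 0%E x))%E; last exact: integral0.
  apply: eq_integral => y _ /=; rewrite -(G0 (0, y, t)); apply: eq_integral => x _.
  by rewrite /set_coord iE.
- rewrite -(integral21_prod_meas1 Gi).
  transitivity (\int[@lebesgue_measure R]_x (cst 0%E x))%E; last exact: integral0.
  apply: ae_eq_integral => //; [exact: (measurable_fubini_G Gi)|].
  have := ae_integrable2 Gi.
  apply: filterS.
  move=> t Gt _; rewrite /fubini_G -(integral12_prod_meas1 Gt)/=.
  transitivity (\int[@lebesgue_measure R]_x (cst 0%E x))%E; last exact: integral0.
  apply: eq_integral => x _ /=; rewrite -(G0 (x, 0, t)); apply: eq_integral => y _.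
  by rewrite /set_coord iE inordK.
- rewrite -(integral12_prod_meas1 Gi).
  transitivity (\int[@mu2 R]_x (cst 0%E x))%E; last exact: integral0.
  apply: eq_integral => x _ /=; rewrite -(G0 (x, 0)); apply: eq_integral => y _.
  by rewrite /set_coord iE inordK.
Qed.

Lemma bounded_derivative_lipschitz (R : realType) (f f' : R -> R) (a b C : R) :
  (forall x, a <= x <= b -> is_derive x 1 f (f' x)) ->
  (forall x, a <= x <= b -> `|f' x| <= C) ->
  forall x y, a <= x <= b -> a <= y <= b -> `|f x - f y| <= C * `|x - y|.
Proof.
move=> df bf.
suff H x y : a <= x <= b -> a <= y <= b -> x < y -> `|f y - f x| <= C * `|y - x|.
  move=> x y xab yab; have [xy|yx|->] := ltgtP x y.
  - by rewrite distrC (distrC x); exact: H.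
  - exact: H.
  - by rewrite !subrr normr0 mulr0.
move=> /andP[ax xb] /andP[ay yb] xy.
have dxy z : z \in `]x, y[ -> is_derive z 1 f (f' z).
  by rewrite in_itv/= => /andP[xz zy]; apply: df; lra.
have cf : {within `[x, y], continuous f}.
  apply: derivable_within_continuous => z; rewrite in_itv/= => /andP[xz zy].
  have zab : a <= z <= b by lra.
  by have [] := df z zab.
have [c] := MVT xy dxy cf; rewrite in_itv/= => /andP[xc cy] ->.
by rewrite normrM ler_wpM2r// bf//; lra.
Qed.

Lemma compact_continuous_bounded (R : realType) (T : topologicalType) (B : set T) (f : T -> R) :
  compact B -> (forall p, B p -> {for p, continuous f}) ->
  exists2 C, 0 <= C & forall p, B p -> `|f p| <= C.
Proof.
move=> cB cf.
have : compact (f @` B).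
  apply: continuous_compact => //; apply: continuous_in_subspaceT => p.
  by rewrite inE => /cf.
move=> /compact_bounded[M [_ MP]].
exists (`|M| + 1) => [|p Bp]; first by rewrite addr_ge0.
by apply: (MP (`|M| + 1)); [rewrite ltr_pwDr// ler_norm|exists p].
Qed.

(** The term [|point|] covers the case of no limit, where [lim] returns the default value. It yields
    a bound for the partial derivatives of a Lipschitz function at every point, differentiable or
    not. *)
Lemma lim_dnbhs0_bounded (R : realType) (q : R -> R) (K : R) :
  (forall h, `|q h| <= K) -> `|lim (q h @[h --> 0^'])| <= K + `|point : R|.
Proof.
move=> qK; have [cq|ncq] := pselect (cvg (q h @[h --> 0^'])); last first.
  by rewrite dvgP// lerDr (le_trans _ (qK 0)).
apply: (@le_trans _ _ K); last by rewrite lerDl.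
apply: (cvgr_to_le (cvg_norm cq)); near=> h; exact: qK.
Unshelve. all: end_near. Qed.

(** * Boxes and integration by parts on them *)

Definition coord (R : realType) (i : 'I_3) (p : R * R * R) : R :=
  if i == 0%N :> nat then p.1.1 else if i == 1%N :> nat then p.1.2 else p.2.

Definition box (R : realType) (a b : 'I_3 -> R) : set (R * R * R) :=
  [set p | forall i, a i <= coord i p <= b i].

Lemma boxE (R : realType) (a b : 'I_3 -> R) :
  box a b = `[a ord0, b ord0]%classic `*` `[a (inord 1), b (inord 1)]%classic `*`
    `[a (inord 2), b (inord 2)]%classic.
Proof.
apply/seteqP; split => [p pB|p [[]]] /=; rewrite ?in_itv/=.
  by split; [split|]; [have := pB ord0|have := pB (inord 1)|have := pB (inord 2)];
    rewrite /coord/= ?inordK.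
by move=> ? ? ? i; have [->|->|->] := ord3P i; rewrite /coord /= ?inordK.
Qed.

Lemma compact_box (R : realType) (a b : 'I_3 -> R) : compact (box a b).
Proof. by rewrite boxE; apply: compact_setX; [apply: compact_setX|]; exact: segment_compact. Qed.

Lemma measurable_box (R : realType) (a b : 'I_3 -> R) :
  measurable (box a b : set (measurableTypeR R * measurableTypeR R * measurableTypeR R)).
Proof. by rewrite boxE; apply: measurableX; [apply: measurableX|]; exact: measurable_itv. Qed.

Lemma mu3_boxE (R : realType) (a b : 'I_3 -> R) :
  let l i := lebesgue_measure (`[a i, b i]%classic : set (measurableTypeR R)) in
  mu3 R (box a b) = (l ord0 * l (inord 1) * l (inord 2))%E.
Proof.
pose I i : set (measurableTypeR R) := `[a i, b i]%classic.
have mI i : measurable (I i) by exact: measurable_itv.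
transitivity (@mu2 R (I ord0 `*` I (inord 1)) * lebesgue_measure (I (inord 2)))%E.
  rewrite boxE; apply: (@product_measure1E _ _ _ _ R (@mu2 R) (@lebesgue_measure R)) => //.
  exact: measurableX.
congr (_ * _)%E.
exact: (@product_measure1E _ _ _ _ R (@lebesgue_measure R) (@lebesgue_measure R)).
Qed.

Lemma mu3_box_fin (R : realType) (a b : 'I_3 -> R) : (mu3 R (box a b) < +oo)%E.
Proof.
have fin i : exists r : R, lebesgue_measure (`[a i, b i]%classic : set (measurableTypeR R)) = r%:E.
  by rewrite lebesgue_measure_itv/= lte_fin; case: ltP => _; eexists.
rewrite mu3_boxE; have [r1 ->] := fin ord0; have [r2 ->] := fin (inord 1).
by have [r3 ->] := fin (inord 2); rewrite ltry.
Qed.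

Lemma mu3_box_gt0 (R : realType) (a b : 'I_3 -> R) :
  (forall i, a i < b i) -> (0 < mu3 R (box a b))%E.
Proof.
move=> ab; have l i : (0 < lebesgue_measure (`[a i, b i]%classic : set (measurableTypeR R)))%E.
  by rewrite lebesgue_measure_itv/= lte_fin ab EFinN -EFinD lte_fin subr_gt0.
by rewrite mu3_boxE !mule_gt0.
Qed.

Lemma measurable_set_coord (R : realType) (i : 'I_3) (p : R * R * R) :
  measurable_fun [set: measurableTypeR R]
    (set_coord i p : measurableTypeR R ->
       measurableTypeR R * measurableTypeR R * measurableTypeR R).
Proof.
have [->|->|->] := ord3P i; rewrite /set_coord /= ?inordK//=.
- by apply: measurable_fun_pair => //; apply: measurable_fun_pair => //.
- by apply: measurable_fun_pair => //; apply: measurable_fun_pair => //.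
- by apply: measurable_fun_pair.
Qed.

Lemma set_coord_box (R : realType) (a b : 'I_3 -> R) (i : 'I_3) (p : R * R * R) :
  (forall s, ~ box a b (set_coord i p s)) \/
  (forall s, box a b (set_coord i p s) <-> a i <= s <= b i).
Proof.
have cE j s : coord j (set_coord i p s) = if i == j then s else coord j p.
  have [->|->|->] := ord3P i; have [->|->|->] := ord3P j;
    by rewrite -?val_eqE /coord /set_coord /= ?inordK.
have [H|H] := pselect (forall j, j != i -> a j <= coord j p <= b j).
  right=> s; split => [/(_ i)|si j]; rewrite cE; first by rewrite eqxx.
  by have [<-//|ij] := eqVneq; apply: H; rewrite eq_sym.
left=> s sB; apply: H => j ji; have := sB j; rewrite cE eq_sym.
by rewrite (negbTE ji).
Qed.

Lemma measurable_partial (R : realType) (i : 'I_3) (w : R * R * R -> R) :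
  continuous w ->
  measurable_fun [set: measurableTypeR R * measurableTypeR R * measurableTypeR R]
    ('D_(basis3 R i) w).
Proof.
move=> cw.
apply: (@measurable_lim_dnbhs0 _ (measurableTypeR R * measurableTypeR R * measurableTypeR R)%type R
  (fun p h => h^-1 *: (w (h *: basis3 R i + p) - w p))) => [h h0|p h h0].
  apply: continuous_on_measurable3; first exact: openT.
  move=> p _; apply: cvgZ; first exact: cvg_cst.
  apply: cvgB; last exact: cw.
  apply: (@continuous_comp _ _ _ (fun q => h *: basis3 R i + q) w); last exact: cw.
  by apply: cvgD; [exact: cvg_cst|exact: cvg_id].
apply: cvgZ; first exact: cvgV.
apply: cvgB; last exact: cvg_cst.
apply: (cvg_comp (fun h => h *: basis3 R i + p) w); last exact: cw.
apply: cvgD; last exact: cvg_cst.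
apply: cvgZ; [exact: cvg_id|exact: cvg_cst].
Qed.

(** Nothing is known about F outside [a, b]. The product stays Lipschitz across an endpoint because
    W vanishes on the far side, so that |W x| <= K |x - y| there. *)
Lemma lipschitz_cutoff (R : realType) (W F : R -> R) (a b K CW CF L : R) :
  0 <= K -> 0 <= CW -> 0 <= CF -> 0 <= L ->
  (forall s r, `|W s - W r| <= K * `|s - r|) ->
  (forall s, ~~ (a <= s <= b) -> W s = 0) ->
  (forall s, a <= s <= b -> `|W s| <= CW) ->
  (forall s, a <= s <= b -> `|F s| <= CF) ->
  (forall s r, a <= s <= b -> a <= r <= b -> `|F s - F r| <= L * `|s - r|) ->
  forall s r, `|(if a <= s <= b then W s * F s else 0) -
    (if a <= r <= b then W r * F r else 0)| <= (K * CF + CW * L) * `|s - r|.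
Proof.
move=> K0 CW0 CF0 L0 lW W0 bW bF lF s r.
have one x y : a <= x <= b -> ~~ (a <= y <= b) -> `|W x * F x| <= (K * CF + CW * L) * `|x - y|.
  move=> xab yab; have := lW x y; rewrite (W0 y yab) subr0 => Wx.
  rewrite normrM (le_trans (ler_pM _ _ Wx (bF _ xab)))// mulrDl mulrAC.
  by rewrite lerDl !mulr_ge0.
case: ifPn => sab; case: ifPn => rab.
- rewrite (_ : _ - _ = (W s - W r) * F s + W r * (F s - F r)); last by ring.
  rewrite [leRHS]mulrDl (le_trans (ler_normD _ _))// !normrM.
  rewrite -(mulrA CW) (mulrAC K) lerD//; first by apply: ler_pM => //; exact: bF.
  by apply: ler_pM => //; [exact: bW|exact: lF].
- by rewrite subr0; exact: one.
- by rewrite sub0r normrN distrC; exact: one.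
- by rewrite subrr normr0 !mulr_ge0// addr_ge0// mulr_ge0.
Qed.

Lemma ae_neq (R : realType) (a : R) : {ae @lebesgue_measure R, forall x, x != a}.
Proof.
exists [set a]; split => //; first exact: lebesgue_measure_set1.
by move=> x /= /negP; rewrite negbK => /eqP.
Qed.

(** The fundamental theorem applied to W F cut off outside [a, b]; the product rule identifies its
    a.e. derivative with the integrand. The function w stands for the pointwise partial derivative,
    so it is tied to W only where W is differentiable. *)
Lemma integral_line_by_parts (R : realType) (W w F F' : R -> R) (a b K CW CF L : R) :
  0 <= K -> 0 <= CW -> 0 <= CF -> 0 <= L -> a <= b ->
  (forall s r, `|W s - W r| <= K * `|s - r|) ->
  (forall s, ~~ (a <= s <= b) -> W s = 0) ->
  (forall s, a <= s <= b -> `|W s| <= CW) ->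
  (forall s, a <= s <= b -> `|F s| <= CF) ->
  (forall s, a <= s <= b -> `|F' s| <= L) ->
  (forall s : R, a <= s <= b -> is_derive s 1 F (F' s)) ->
  (forall s l : R, is_derive s 1 W l -> w s = l) ->
  let G := fun s => if a <= s <= b then w s * F s + W s * F' s else 0 in
  measurable_fun setT G ->
  (\int[@lebesgue_measure R]_s (G s)%:E = 0)%E.
Proof.
move=> K0 CW0 CF0 L0 ab lW W0 bW bF bF' dF dW G mG.
have lF := bounded_derivative_lipschitz dF bF'.
pose h s := if a <= s <= b then W s * F s else 0.
have h0 s : ~~ (a <= s <= b) -> h s = 0 by rewrite /h => /negbTE ->.
have [rho [rhoi rho0 drho]] := lipschitz_fundamental_theorem
  (lipschitz_cutoff K0 CW0 CF0 L0 lW W0 bW bF lF) ab h0.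
(* Only the a.e. differentiability of W is extracted here. *)
have [rW [_ _ drW]] := lipschitz_fundamental_theorem lW ab W0.
rewrite -rho0; apply: ae_eq_integral => //.
- exact/measurable_EFinP.
- exact: measurable_int rhoi.
(* The two endpoints are discarded as null sets: off them the cut-off function agrees, near the
   point, either with W F or with 0. *)
have na := ae_neq a; have nb := ae_neq b.
have FF := ae_filter_ringOfSetsType (@lebesgue_measure R).
apply: (@filterS _ _ FF _ _ _ (@filterI _ _ FF _ _ (@filterI _ _ FF _ _ drho drW)
  (@filterI _ _ FF _ _ na nb))) => s /= [[ds dWs] [sa sb]] _.
congr EFin.
have is_derive_uniq (f : R -> R) (l1 l2 : R) : is_derive s 1 f l1 -> is_derive s 1 f l2 -> l1 = l2.
  by move=> [_ <-] [_ <-].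
rewrite /G; case: ifPn => [sab|sab].
  have sab' : a < s < b by move: sab sa sb;
    rewrite !le_eqVlt (eq_sym a s) => /andP[/orP[->//|->]] /orP[->//|->].
  apply: (is_derive_uniq h) => //.
  apply: (@near_eq_is_derive _ _ _ (W * F)); last first.
    rewrite (dW _ _ dWs); have dFs := dF s sab; apply: is_derive_eq.
    by rewrite addrC; congr (_ + _); rewrite /GRing.scale/= mulrC.
  near=> r; rewrite /h ifT//; apply/andP; split; apply: ltW; near: r.
    by apply: lt_nbhsr; case/andP: sab'.
  by apply: lt_nbhsl; case/andP: sab'.
apply: (is_derive_uniq h) => //.
apply: (@near_eq_is_derive _ _ _ (cst 0) h s 1 0 _ (is_derive_cst _ _ _)).
move: sab; rewrite negb_and -!ltNge => /orP[sa'|sb'].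
  near=> r; rewrite h0// negb_and -!ltNge; apply/orP; left; near: r; exact: lt_nbhsl.
near=> r; rewrite h0// negb_and -!ltNge; apply/orP; right; near: r; exact: lt_nbhsr.
Unshelve. all: end_near. Qed.

Lemma partial_outside (R : realType) (i : 'I_3) (w : R * R * R -> R) (S : set (R * R * R)) :
  closed S -> (forall p, ~ S p -> w p = 0) -> forall p, ~ S p -> 'D_(basis3 R i) w p = 0.
Proof.
move=> cS w0 p Sp.
have -> : 'D_(basis3 R i) w p = 'D_(basis3 R i) (cst 0) p.
  apply: near_eq_derive; have : nbhs p (~` S) by apply: open_nbhs_nbhs; split => //;
    exact: closed_openC.
  by apply: filterS => q /w0.
by rewrite derive_cst.
Qed.

(** The sum of the two integrands is bounded and measurable on the box, and its integral over each
    line in direction i vanishes by the one-variable statement; Fubini concludes. *)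
Lemma box_by_parts (R : realType) (V : set (R * R * R)) (i : 'I_3) (a b : 'I_3 -> R)
    (w F F' : R * R * R -> R) (K : R) :
  open V -> box a b `<=` V -> continuous w -> 0 <= K ->
  (forall p s r, `|w (set_coord i p s) - w (set_coord i p r)| <= K * `|s - r|) ->
  (forall p, ~ box a b p -> w p = 0) ->
  (forall p, V p -> {for p, continuous F}) ->
  (forall p, V p -> is_derive p (basis3 R i) F (F' p)) ->
  (forall p, V p -> {for p, continuous F'}) ->
  let B := box a b in
  [/\ (mu3 R).-integrable B (EFin \o (fun p => 'D_(basis3 R i) w p * F p)),
      (mu3 R).-integrable B (EFin \o (fun p => w p * F' p)) &
      \int[mu3 R]_(p in B) ('D_(basis3 R i) w p * F p) =
      - (\int[mu3 R]_(p in B) (w p * F' p))].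
Proof.
move=> oV BV cw K0 lw w0 cF dF cF' B.
have mB : measurable (B : set (measurableTypeR R * measurableTypeR R * measurableTypeR R)).
  exact: measurable_box.
have finB : (mu3 R B < +oo)%E by exact: mu3_box_fin.
have cptB : compact B by exact: compact_box.
have [CW CW0 bW] := compact_continuous_bounded cptB (fun p _ => cw p).
have [CF CF0 bF] := compact_continuous_bounded cptB (fun p Bp => cF p (BV p Bp)).
have [L L0 bF'] := compact_continuous_bounded cptB (fun p Bp => cF' p (BV p Bp)).
have mV (f : R * R * R -> R) : (forall p, V p -> {for p, continuous f}) ->
    measurable_fun (B : set (measurableTypeR R * measurableTypeR R * measurableTypeR R)) f.
  move=> cf; apply: (@measurable_funS _ _ _ _ V) => //; first exact: open_measurable3.
  by apply: continuous_on_measurable3 => // p; rewrite inE => /cf.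
have mDw : measurable_fun (B : set (measurableTypeR R * measurableTypeR R * measurableTypeR R))
    ('D_(basis3 R i) w).
  by apply: measurable_funS (measurable_partial i cw).
have mw : measurable_fun (B : set (measurableTypeR R * measurableTypeR R * measurableTypeR R)) w.
  apply: (mV w) => p _; exact: cw.
(* This is the default value of a partial derivative that does not exist; it enters the bound on
   ['D_(basis3 R i) w]. *)
pose c := `|point : R|.
have bDw p : `|'D_(basis3 R i) w p| <= K + c.
  apply: lim_dnbhs0_bounded => h; have [s <-] := set_coord_id i p.
  rewrite /= set_coord_shift /GRing.scale/= normrM normfV.
  have [->|h0] := eqVneq h 0; first by rewrite normr0 invr0 mul0r.
  rewrite mulrC ler_pdivrMr ?normr_gt0// (le_trans (lw _ _ _))//.
  by rewrite addrK.
have i1 : (mu3 R).-integrable B (EFin \o (fun p => 'D_(basis3 R i) w p * F p)).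
  apply: (@integrable_of_bounded _ _ _ _ _ _ ((K + c) * CF)) => //.
    by apply: measurable_funM => //; exact: mV.
  by move=> p Bp; rewrite normrM; apply: ler_pM => //; exact: bF.
have i2 : (mu3 R).-integrable B (EFin \o (fun p => w p * F' p)).
  apply: (@integrable_of_bounded _ _ _ _ _ _ (CW * L)) => //.
    by apply: measurable_funM => //; exact: mV.
  by move=> p Bp; rewrite normrM; apply: ler_pM => //; [exact: bW|exact: bF'].
split => //.
(* The identity is recast as the vanishing of one integral, of a function extended by 0 outside the
   box, so that it can be tested on full lines. *)
apply/eqP; rewrite -subr_eq0 opprK -RintegralD//; apply/eqP.
rewrite Rintegral_mkcond /Rintegral.
set G := _ \_ B.
have Gi : (mu3 R).-integrable setT (EFin \o G).
  rewrite /G -restrict_EFin -integrable_mkcond//.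
  exact: (integrableD mB i1 i2).
rewrite (_ : integral _ _ _ = 0%E)//.
apply: (integral_lines0 (i := i) Gi) => p.
have mG : measurable_fun [set: measurableTypeR R] (fun s => G (set_coord i p s)).
  apply: measurableT_comp; last exact: measurable_set_coord.
  by apply/measurable_EFinP; exact: measurable_int Gi.
have [noB|onB] := set_coord_box a b i p.
  rewrite [X in integral _ _ X](_ : _ = cst 0%E) ?integral0//; apply/funext => s /=.
  by rewrite /G patchE memNset.
have [ab|ba] := leP (a i) (b i); last first.
  rewrite [X in integral _ _ X](_ : _ = cst 0%E) ?integral0//; apply/funext => s /=.
  rewrite /G patchE memNset// => /onB /andP[? ?]; lra.
have GE s : G (set_coord i p s) = if a i <= s <= b i then
   'D_(basis3 R i) w (set_coord i p s) * F (set_coord i p s) +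
   w (set_coord i p s) * F' (set_coord i p s) else 0.
  rewrite /G patchE; case: ifPn => [|/negP]; rewrite inE.
    by move=> /onB ->.
  by move=> nB; rewrite ifN//; apply/negP => /onB.
under eq_integral do rewrite /= GE.
apply: (@integral_line_by_parts _ (fun s => w (set_coord i p s)) (fun s =>
  'D_(basis3 R i) w (set_coord i p s))
  (fun s => F (set_coord i p s)) (fun s => F' (set_coord i p s)) (a i) (b i) K CW CF L) => //.
- by move=> s sab; apply: w0 => /onB; apply/negP.
- by move=> s /onB; exact: bW.
- by move=> s /onB; exact: bF.
- by move=> s /onB; exact: bF'.
- by move=> s /onB /BV Vs; apply/is_derive_set_coord; exact: dF.
- by move=> s l /is_derive_set_coord[].
- by apply: eq_measurable_fun mG => s _; rewrite GE.
Qed.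

(** The function [phi] blows up at the faces of the slab and as |y| grows. Its bound C on S keeps S
    at distance at least 1/(C+1) from the faces and in |y| <= C+1. *)
Lemma compact_slab_box (R : realType) (eps : R) (S : set (R * R * R)) :
  compact S -> S `<=` slab eps ->
  exists a b, S `<=` box a b /\ box a b `<=` slab eps.
Proof.
move=> cS Sslab.
pose phi (p : R * R * R) := (1 - `|p.1.1|)^-1 + (eps - `|p.2|)^-1 + `|p.1.2|.
have c1 (p : R * R * R) : (fun q : R * R * R => q.1.1) q @[q --> p] --> p.1.1.
  by apply: cvg_comp; exact: cvg_fst.
have c2 (p : R * R * R) : (fun q : R * R * R => q.1.2) q @[q --> p] --> p.1.2.
  by apply: cvg_comp; [exact: cvg_fst|exact: cvg_snd].
have c3 (p : R * R * R) : (fun q : R * R * R => q.2) q @[q --> p] --> p.2 by exact: cvg_snd.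
have slabP p : slab eps p -> 0 < 1 - `|p.1.1| /\ 0 < eps - `|p.2|.
  by move=> [? ?]; rewrite !subr_gt0 !ltr_norml.
have cphi p : S p -> {for p, continuous phi}.
  move=> /Sslab /slabP[p1 p2].
  apply: cvgD; [apply: cvgD|apply: cvg_norm; exact: c2].
    by apply: cvgV; [rewrite gt_eqF|apply: cvgB; [exact: cvg_cst|apply: cvg_norm; exact: c1]].
  by apply: cvgV; [rewrite gt_eqF|apply: cvgB; [exact: cvg_cst|apply: cvg_norm; exact: c3]].
have [C C0 bphi] := compact_continuous_bounded cS cphi.
pose C' := C + 1; have C'0 : 0 < C' by rewrite ltr_wpDl.
pose b (i : 'I_3) := if i == 0%N :> nat then 1 - C'^-1 else if i == 1%N :> nat then C' else eps -
  C'^-1.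
have inv (x : R) : 0 < x -> x^-1 <= C -> C'^-1 <= x.
  move=> x0 xC; rewrite -(invrK x) lef_pV2 ?posrE ?invr_gt0//.
  by rewrite (le_trans xC)// lerDl.
exists (fun i => - b i), b; split => p.
  move=> Sp; have [p1 p2] := slabP _ (Sslab _ Sp).
  have := le_trans (ler_norm _) (bphi p Sp); rewrite /phi => H i; rewrite -ler_norml.
  have q1 : 0 < (1 - `|p.1.1|)^-1 by rewrite invr_gt0.
  have q2 : 0 < (eps - `|p.2|)^-1 by rewrite invr_gt0.
  have q3 : 0 <= `|p.1.2| by [].
  have C'1 : 0 < C'^-1 by rewrite invr_gt0.
  have [->|->|->] := ord3P i; rewrite /coord /b /= ?inordK//=.
  - suff : C'^-1 <= 1 - `|p.1.1| by lra.
    by apply: inv => //; move: H q1 q2; set X := (1 - _)^-1; set Y := (eps - _)^-1; lra.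
  - by move: H q1 q2; set X := (1 - _)^-1; set Y := (eps - _)^-1; rewrite /C'; lra.
  - suff : C'^-1 <= eps - `|p.2| by lra.
    by apply: inv => //; move: H q1 q2; set X := (1 - _)^-1; set Y := (eps - _)^-1; lra.
move=> pB; have C'1 : 0 < C'^-1 by rewrite invr_gt0.
have := pB ord0; have := pB (inord 2); rewrite /coord /b /= !inordK//= => /andP[? ?] /andP[? ?].
by split; lra.
Qed.

Lemma open_slab (R : realType) (eps : R) : open (slab eps).
Proof.
rewrite (_ : slab eps = (fun q : R * R * R => q.1.1) @^-1` `]-1, 1[%classic `&`
   (fun q : R * R * R => q.2) @^-1` `](- eps), eps[%classic).
  apply: openI; apply: open_comp => //; try exact: interval_open.
    by move=> p _; apply: cvg_comp; exact: cvg_fst.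
  by move=> p _; exact: cvg_snd.
by apply/seteqP; split => p /=; rewrite !in_itv.
Qed.

(** Both integrands vanish off the closed support of w, which lies in D and in a box inside the
    slab, so the box can replace D. The set D is the slab itself for the weak equation, and a
    smaller open set for the local weak gradient. *)
Lemma slab_by_parts (R : realType) (eps : R) (i : 'I_3) (D : set (R * R * R))
    (w F F' : R * R * R -> R) (K : R) :
  open D -> D `<=` slab eps -> csupp_in D w -> continuous w -> 0 <= K ->
  (forall p s r, `|w (set_coord i p s) - w (set_coord i p r)| <= K * `|s - r|) ->
  (forall p, slab eps p -> {for p, continuous F}) ->
  (forall p, slab eps p -> is_derive p (basis3 R i) F (F' p)) ->
  (forall p, slab eps p -> {for p, continuous F'}) ->
  [/\ (mu3 R).-integrable D (EFin \o (fun p => 'D_(basis3 R i) w p * F p)),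
      (mu3 R).-integrable D (EFin \o (fun p => w p * F' p)) &
      \int[mu3 R]_(p in D) ('D_(basis3 R i) w p * F p) =
      - (\int[mu3 R]_(p in D) (w p * F' p))].
Proof.
move=> oD Dslab [cptS SD] cw K0 lw cF dF cF'.
set S := closure _ in cptS SD.
have [a [b [Sbox boxV]]] := compact_slab_box cptS (subset_trans SD Dslab).
have w0 p : ~ S p -> w p = 0.
  move=> Sp; apply/eqP; apply: contra_notT Sp => wp; exact: subset_closure.
have wb p : ~ box a b p -> w p = 0 by move=> pb; apply: w0 => /Sbox.
have dw0 := partial_outside i (@closed_closure _ _) w0.
have [i1 i2 eq12] := box_by_parts (@open_slab R eps) boxV cw K0 lw wb cF dF cF'.
have mB : measurable (box a b : set (measurableTypeR R * measurableTypeR R * measurableTypeR R)).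
  exact: measurable_box.
have mD := open_measurable3 oD.
have DB (f : R * R * R -> R) : (forall p, ~ S p -> f p = 0) -> f \_ D = f \_ (box a b).
  move=> f0; apply/funext => p; rewrite !patchE.
  have [pS|pS] := pselect (S p); last by rewrite f0// !if_same.
  by rewrite !mem_set//; [exact: Sbox|exact: SD].
have {}E1 : (fun p => 'D_(basis3 R i) w p * F p) \_ D = (fun p =>
  'D_(basis3 R i) w p * F p) \_ (box a b).
  by apply: DB => p pS; rewrite dw0// mul0r.
have E2 : (fun p => w p * F' p) \_ D = (fun p => w p * F' p) \_ (box a b).
  by apply: DB => p pS; rewrite w0// mul0r.
split.
- by apply/(integrable_mkcond _ mD); rewrite restrict_EFin E1 -restrict_EFin;
    apply/(integrable_mkcond _ mB).
- by apply/(integrable_mkcond _ mD); rewrite restrict_EFin E2 -restrict_EFin;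
    apply/(integrable_mkcond _ mB).
- by rewrite [LHS]Rintegral_mkcond E1 -Rintegral_mkcond eq12 [in RHS]Rintegral_mkcond E2
    -Rintegral_mkcond.
Qed.

(** * Classical solutions are weak solutions *)

Lemma sum3E (R : realType) (f : 'I_3 -> R) :
  \sum_(i < 3) f i = f ord0 + f (inord 1) + f (inord 2).
Proof.
rewrite !big_ord_recl big_ord0 addr0 addrA; congr (_ + f _ + f _); apply: val_inj => /=;
  by rewrite inordK.
Qed.

Lemma set_coordB (R : realType) (i : 'I_3) (p : R * R * R) (s r : R) :
  `|set_coord i p s - set_coord i p r| = `|s - r|.
Proof.
rewrite -[s in LHS](subrK r) -set_coord_shift addrK normrZ.
suff -> : `|basis3 R i| = 1 by rewrite mulr1.
have [->|->|->] := ord3P i; rewrite /basis3 !prod_normE /= ?inordK//= ?normr0 ?normr1;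
  by apply: le_anti; rewrite !ge_max !le_max !lexx !ler01 ?orbT.
Qed.

Lemma lipschitz_lines (R : realType) (w : R * R * R -> R) :
  lipschitz w ->
  continuous w /\ exists2 K, 0 <= K &
    forall i p s r, `|w (set_coord i p s) - w (set_coord i p r)| <= K * `|s - r|.
Proof.
move=> [M [_ MP]].
have [K K0 lw] : exists2 K, 0 < K & forall p q, `|w p - w q| <= K * `|p - q|.
  exists (`|M| + 1) => [|p q]; first by rewrite ltr_wpDl.
  have : M < `|M| + 1 by rewrite ltr_pwDr// ler_norm.
  by move=> /MP /(_ (p, q)); apply.
split; last first.
  exists K; first exact: ltW.
  by move=> i p s r; rewrite (le_trans (lw _ _))// set_coordB.
move=> p; apply/cvgrPdist_le => e e0; near=> q.
rewrite (le_trans (lw _ _))// mulrC -ler_pdivlMr//.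
near: q; apply: (@cvgr_dist_le _ _ _ (nbhs p)); [exact: cvg_id|exact: divr_gt0].
Unshelve. all: end_near. Qed.

(** Supplies for smooth test functions the data that [lipschitz_lines] supplies for Lipschitz ones,
    so that [slab_by_parts] serves both. The partial derivative is bounded because it is continuous
    on the compact support and zero off it. *)
Lemma smooth_lines (R : realType) (D : set (R * R * R)) (w : R * R * R -> R) :
  smooth_on setT w -> csupp_in D w ->
  continuous w /\ forall i, exists2 K, 0 <= K &
    forall p s r, `|w (set_coord i p s) - w (set_coord i p r)| <= K * `|s - r|.
Proof.
move=> sw [cptS _]; split => [p|i]; first by have [] := sw [::] p I.
set S := closure _ in cptS.
have w0 p : ~ S p -> w p = 0.
  move=> Sp; apply/eqP; apply: contra_notT Sp => wp; exact: subset_closure.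
have dw0 := partial_outside i (@closed_closure _ _) w0.
have [C C0 bdw] : exists2 C, 0 <= C & forall p, S p -> `|'D_(basis3 R i) w p| <= C.
  by apply: compact_continuous_bounded => // p _; have [] := sw [:: i] p I.
exists C => // p s r.
have bdw' q : `|'D_(basis3 R i) w q| <= C.
  by have [/bdw//|/dw0 ->] := pselect (S q); rewrite normr0.
apply: (@bounded_derivative_lipschitz _ (fun s => w (set_coord i p s))
  (fun s => 'D_(basis3 R i) w (set_coord i p s)) (Num.min s r) (Num.max s r)) => //.
- move=> x _; apply/is_derive_set_coord; apply: DeriveDef => //.
  by have [_] := sw [::] (set_coord i p x) I; apply.
- by rewrite ge_min le_max lexx.
- by rewrite ge_min le_max lexx !orbT.
Qed.

Lemma L2_on_continuous (R : realType) (V W : set (R * R * R)) (f : R * R * R -> R) :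
  open V -> open W -> compactly_contained W V ->
  (forall p, V p -> {for p, continuous f}) ->
  (mu3 R W < +oo)%E -> L2_on W f.
Proof.
move=> oV oW [cW WV] cf fin.
have [C C0 bf] := compact_continuous_bounded cW (fun p Wp => cf p (WV p Wp)).
have mW := open_measurable3 oW.
have mf : measurable_fun [set: measurableTypeR R * measurableTypeR R * measurableTypeR R] (f \_ W).
  apply/(measurable_restrictT _ mW).
  apply: (@measurable_funS _ _ _ _ V) => //; first exact: open_measurable3.
    by move=> p /subset_closure /WV.
  by apply: continuous_on_measurable3 => // p; rewrite inE => /cf.
rewrite /L2_on inE; apply/andP; split; rewrite inE //=.
rewrite /finite_norm unlock /= .
rewrite poweR_lty//.
have i2 : (mu3 R).-integrable setT (EFin \o (fun p => `|(f \_ W) p| `^ 2)).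
  have -> : EFin \o (fun p => `|(f \_ W) p| `^ 2) = (EFin \o (fun p => `|f p| `^ 2)) \_ W.
    apply/funext => p; rewrite /= !patchE; case: ifPn => // _.
    by rewrite normr0 powR0// pnatr_eq0.
  rewrite -integrable_mkcond//.
  apply: (@integrable_of_bounded _ _ _ _ _ _ (C `^ 2)) => //.
    apply: (measurableT_comp (measurable_powR 2)). apply: measurableT_comp => //;
      exact/(measurable_restrictT _ mW).
  move=> p Wp; rewrite ger0_norm ?powR_ge0// ge0_ler_powR ?nnegrE//.
  by apply: bf; exact: subset_closure.
exact: (integrable_lty _ i2).
Qed.

Lemma slab_compactly_contained_finite (R : realType) (eps : R) (W : set (R * R * R)) :
  open W -> compactly_contained W (slab eps) -> (mu3 R W < +oo)%E.
Proof.
move=> oW [cW WV]; have [a [b [Wb _]]] := compact_slab_box cW WV.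
apply: (le_lt_trans _ (mu3_box_fin a b)); apply: le_measure; rewrite ?inE.
- exact: open_measurable3.
- exact: measurable_box.
- exact: subset_trans (@subset_closure _ W) Wb.
Qed.

(** The factor sqrt g depends on x and multiplies only the y derivative, so it is never
    differentiated. Its continuity suffices, although sqrt g may fail to be differentiable where g
    vanishes. *)
Lemma coefA_set_coord (R : realType) (g : R -> R) (i : 'I_3) (p : R * R * R) (s : R) :
  coefA g i (set_coord i p s) = coefA g i p.
Proof. by have [->|->|->] := ord3P i; rewrite /coefA /set_coord /= ?inordK. Qed.

Lemma coefA_continuous (R : realType) (g : R -> R) (i : 'I_3) :
  continuous g -> continuous (coefA g i).
Proof.
move=> cg p; case i1 : (i == 1%N :> nat); last first.
  by rewrite (_ : coefA g i = cst 1); [exact: cvg_cst|apply/funext => q; rewrite /coefA i1].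
rewrite (_ : coefA g i = fun q => Num.sqrt (g q.1.1)); last first.
  by apply/funext => q; rewrite /coefA i1.
apply: (cvg_comp (fun q : R * R * R => g q.1.1) (@Num.sqrt R)); last exact: sqrt_continuous.
apply: (cvg_comp (fun q : R * R * R => q.1.1) g); last exact: cg.
by apply: cvg_comp; exact: cvg_fst.
Qed.

Lemma is_derive_coefM (R : realType) (c f : R * R * R -> R) (i : 'I_3) (p : R * R * R) (l : R) :
  (forall q s, c (set_coord i q s) = c q) ->
  is_derive p (basis3 R i) f l -> is_derive p (basis3 R i) (fun q => c q * f q) (c p * l).
Proof.
move=> cc; have [s sp] := set_coord_id i p; rewrite -sp.
move=> /is_derive_set_coord df; apply/is_derive_set_coord.
rewrite (_ : (fun r => c (set_coord i p r) * f (set_coord i p r)) = c p *: (fun r =>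
  f (set_coord i p r))); last first.
  by apply/funext => r; rewrite cc.
by rewrite cc; apply: is_deriveZ.
Qed.

(** Here [u1] and [u2] are the first and the pure second partial derivatives. Integrating by parts
    against [coefA * u] identifies the weak gradient, and against [coefA^2 * u1] it gives the weak
    equation. *)
Lemma classical_weak_solution (R : realType) (g : R -> R) (eps : R) (u : R * R * R -> R)
    (u1 u2 : 'I_3 -> R * R * R -> R) :
  continuous g -> (forall x, 0 <= g x) ->
  (forall p, slab eps p -> {for p, continuous u}) ->
  (forall i p, slab eps p -> is_derive p (basis3 R i) u (u1 i p)) ->
  (forall i p, slab eps p -> {for p, continuous (u1 i)}) ->
  (forall i p, slab eps p -> is_derive p (basis3 R i) (u1 i) (u2 i p)) ->
  (forall i p, slab eps p -> {for p, continuous (u2 i)}) ->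
  (forall p, slab eps p ->
     u2 ord0 p + g p.1.1 * u2 (inord 1) p + u2 (inord 2) p = 0) ->
  weak_solution g (slab eps) (cst 0) u.
Proof.
move=> cg g0 cu du cu1 du1 cu2 Lu.
have cc i := coefA_continuous (i := i) cg.
have cM (f h : R * R * R -> R) p : {for p, continuous f} -> {for p, continuous h} ->
   {for p, continuous (fun q => f q * h q)} by move=> ? ?; apply: cvgM.
exists (fun i p => coefA g i p * u1 i p).
  move=> W oW WV; have finW := slab_compactly_contained_finite oW WV.
  split.
  - exact: (L2_on_continuous (@open_slab R eps) oW WV).
  - move=> i; apply: (L2_on_continuous (@open_slab R eps) oW WV) => // p Vp.
    by apply: cM; [exact: cc|exact: cu1].
  move=> i psi spsi cpsi; have [cw /(_ i)[K K0 lw]] := smooth_lines spsi cpsi.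
  have Wslab : W `<=` slab eps by case: WV => _; exact: subset_trans (@subset_closure _ W).
  have [_ _ bp] := slab_by_parts (i := i) (F := fun p => coefA g i p * u p)
    (F' := fun p => coefA g i p * u1 i p) oW Wslab cpsi cw K0 lw
    (fun p Vp => cM _ _ _ (cc i p) (cu p Vp))
    (fun p Vp => is_derive_coefM (coefA_set_coord g i) (du i p Vp))
    (fun p Vp => cM _ _ _ (cc i p) (cu1 i p Vp)).
  rewrite (_ : (fun p => coefA g i p * u1 i p * psi p) = (fun p =>
    psi p * (coefA g i p * u1 i p))); last first.
    by apply/funext => p; rewrite mulrC.
  rewrite (_ : (fun p => u p * gradA g psi i p) = (fun p =>
    'D_(basis3 R i) psi p * (coefA g i p * u p))); last first.
    by apply/funext => p; rewrite /gradA mulrA [RHS]mulrC (mulrC (u p)).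
  by rewrite bp opprK.
move=> w lipw cw'; have [cw [K K0 lw]] := lipschitz_lines lipw.
(* The product of the two degenerate gradients carries the squared coefficients: g in the y
   direction, 1 in the other two. *)
pose c2 i p := coefA g i p * coefA g i p.
have c2E i q s : c2 i (set_coord i q s) = c2 i q by rewrite /c2 !coefA_set_coord.
have cc2 i p : {for p, continuous (c2 i)} by apply: cM; exact: cc.
have bp i := slab_by_parts (i := i) (F := fun p => c2 i p * u1 i p)
    (F' := fun p => c2 i p * u2 i p) (@open_slab R eps) (@subset_refl _ _) cw' cw K0 (lw i)
    (fun p Vp => cM _ _ _ (cc2 i p) (cu1 i p Vp))
    (fun p Vp => is_derive_coefM (c2E i) (du1 i p Vp))
    (fun p Vp => cM _ _ _ (cc2 i p) (cu2 i p Vp)).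
have mV := open_measurable3 (@open_slab R eps).
rewrite (_ : (fun p => \sum_(i < 3) gradA g w i p * (coefA g i p * u1 i p)) = (fun p =>
   'D_(basis3 R ord0) w p * (c2 ord0 p * u1 ord0 p) +
   'D_(basis3 R (inord 1)) w p * (c2 (inord 1) p * u1 (inord 1) p) +
   'D_(basis3 R (inord 2)) w p * (c2 (inord 2) p * u1 (inord 2) p))); last first.
  by apply/funext => p; rewrite sum3E /gradA /c2; ring.
have [a1 b1 e1] := bp ord0; have [a2 b2 e2] := bp (inord 1); have [a3 b3 e3] := bp (inord 2).
rewrite RintegralD//; last exact: (integrableD mV a1 a2).
rewrite RintegralD// e1 e2 e3 -!opprD opprK.
rewrite -RintegralD// -RintegralD//; last exact: (integrableD mV b1 b2).
apply: eq_Rintegral => p; rewrite inE => Vp; rewrite /= mul0r -!mulrDr.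
rewrite (_ : c2 ord0 p * _ + _ + _ = 0) ?mulr0//.
rewrite -[RHS](Lu p Vp) /c2 /coefA /= !inordK//=.
by rewrite !mul1r -(expr2 (Num.sqrt _)) sqr_sqrtr.
Qed.

(** * Dominated series of functions *)

Definition tsum (R : realType) (u : nat -> R) : R := limn (series u).

Lemma tsum_cvg (R : realType) (u M : nat -> R) :
  (forall n, `|u n| <= M n) -> cvgn (series M) -> cvgn (series u).
Proof.
move=> uM cM; apply: normed_cvg; apply: (@series_le_cvg _ (fun n => `|u n|) M) => // n.
by rewrite (le_trans _ (uM n)).
Qed.

Lemma tsum_tail (R : realType) (u M : nat -> R) (N : nat) :
  (forall n, `|u n| <= M n) -> cvgn (series M) ->
  `|tsum u - series u N| <= tsum M - series M N.
Proof.
move=> uM cM; have cu := tsum_cvg uM cM.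
have M0 n : 0 <= M n by rewrite (le_trans _ (uM n)).
apply: (cvgr_to_le (cvg_norm (cvgB cu (cvg_cst (series u N))))).
exists N => // n Nn; change (`|series u n - series u N| <= tsum M - series M N);
  rewrite sub_series_geq//.
rewrite (le_trans (ler_norm_sum _ _ _))//.
apply: (@le_trans _ _ (series M n - series M N)); first by rewrite sub_series_geq// ler_sum.
rewrite lerB//; apply: nondecreasing_cvgn_le => //.
by apply: nondecreasing_series => k _ _.
Qed.

Lemma tsum_norm_le (R : realType) (u M : nat -> R) :
  (forall n, `|u n| <= M n) -> cvgn (series M) -> `|tsum u| <= tsum M.
Proof.
move=> uM cM; have := tsum_tail 0 uM cM.
by rewrite /series/= !big_geq// !subr0.
Qed.

Lemma tsum_lin (R : realType) (u v : nat -> R) (a b : R) :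
  cvgn (series u) -> cvgn (series v) ->
  tsum (fun n => a * u n + b * v n) = a * tsum u + b * tsum v.
Proof.
move=> cu cv; apply: cvg_lim => //.
rewrite (_ : series _ = fun n => a * series u n + b * series v n); last first.
  by apply/funext => n; rewrite /series/= big_split/= !mulr_sumr.
by apply: cvgD; apply: cvgM => //; exact: cvg_cst.
Qed.

Lemma tsumZ (R : realType) (u : nat -> R) (a : R) :
  cvgn (series u) -> tsum (fun n => a * u n) = a * tsum u.
Proof.
move=> cu; have := tsum_lin a 0 cu cu; rewrite mul0r addr0 => <-.
by congr tsum; apply/funext => n; rewrite mul0r addr0.
Qed.

Lemma tsumD (R : realType) (u v : nat -> R) :
  cvgn (series u) -> cvgn (series v) ->
  tsum (fun n => u n + v n) = tsum u + tsum v.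
Proof.
move=> cu cv; have := tsum_lin 1 1 cu cv; rewrite !mul1r => <-.
by congr tsum; apply/funext => n; rewrite !mul1r.
Qed.

Lemma tsum_ge_series (R : realType) (u : nat -> R) (n : nat) :
  (forall n, 0 <= u n) -> cvgn (series u) -> series u n <= tsum u.
Proof.
move=> u0 cu; apply: nondecreasing_cvgn_le => //.
by apply: nondecreasing_series => i _ _; exact: u0.
Qed.

Lemma tsum_ge_term (R : realType) (u : nat -> R) (n : nat) :
  (forall n, 0 <= u n) -> cvgn (series u) -> u n <= tsum u.
Proof.
move=> u0 cu; apply: le_trans (tsum_ge_series n.+1 u0 cu).
by rewrite seriesSr lerDr /series/= sumr_ge0.
Qed.

(** Dominated convergence for series: the tails are small uniformly on D through the tail of M, and
    finitely many terms converge one by one. *)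
Lemma tannery (R : realType) (T : Type) (F : set_system T) (FF : Filter F)
    (f : nat -> T -> R) (l M : nat -> R) (D : set T) :
  (forall n, f n x @[x --> F] --> l n) -> F D ->
  (forall n x, D x -> `|f n x| <= M n) -> (forall n, `|l n| <= M n) ->
  cvgn (series M) ->
  tsum (f ^~ x) @[x --> F] --> tsum l.
Proof.
move=> fl FD fM lM cM; apply/cvgrPdist_le => e e0.
have e30 : 0 < e / 3 by rewrite divr_gt0.
have [N _ NP] := (cvgrPdist_le _ _).1 cM _ e30.
have {}NP : tsum M - series M N <= e / 3.
  by apply: le_trans (NP N (leqnn N)); exact: ler_norm.
have cs : series (f ^~ x) N @[x --> F] --> series l N.
  rewrite /series/=; elim: N {NP} => [|N IH].
    by under eq_fun do rewrite big_geq//; rewrite big_geq//; exact: cvg_cst.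
  under eq_fun do rewrite big_nat_recr//=.
  by rewrite big_nat_recr//=; apply: cvgD.
near=> x.
have xD : D x by near: x.
have h1 := tsum_tail N lM cM.
have h2 := tsum_tail N (fun n => fM n x xD) cM.
have h3 : `|series l N - series (f ^~ x) N| <= e / 3.
  by near: x; exact: (cvgrPdist_le _ _).1 cs _ e30.
rewrite (_ : tsum l - _ = (tsum l - series l N) + (series l N - series (f^~ x) N)
  - (tsum (f^~ x) - series (f ^~x) N)); last by ring.
rewrite (le_trans (ler_normB _ _))// (le_trans (lerD (ler_normD _ _) (lexx _)))//.
lra.
Unshelve. all: end_near. Qed.

(** Tannery's theorem for the difference quotients. The mean value theorem bounds the n-th quotient
    by the same [M n] that bounds the n-th derivative. *)
Lemma is_derive_tsum (R : realType) (f f' : nat -> R -> R) (a b x : R) (M : nat -> R) :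
  a < x < b ->
  (forall n (y : R), a < y < b -> is_derive y 1 (f n) (f' n y)) ->
  (forall n y, a < y < b -> `|f n y| <= M n) ->
  (forall n y, a < y < b -> `|f' n y| <= M n) ->
  cvgn (series M) ->
  is_derive x 1 (fun y => tsum (f ^~ y)) (tsum (f' ^~ x)).
Proof.
move=> axb df fM f'M cM.
have xab := axb.
pose q n h := h^-1 * (f n (h + x) - f n x).
pose D : set R := [set h | h != 0 /\ a < h + x < b].
have FD : 0^' D.
  have H : \forall h \near (0 : R), a < h + x < b; last first.
    by rewrite /dnbhs /within /=; apply: filterS H => h hab h0.
  case/andP: axb => ax xb.
  have nc : \forall h \near (0 : R), `|h| < Num.min (x - a) (b - x).
    have : (fun h : R => `|h|) @ (0 : R) --> `|0 : R| by exact: norm_continuous.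
    by rewrite normr0 => /cvgr_lt; apply; rewrite lt_min !subr_gt0 ax.
  apply: filterS nc => h.
  by rewrite lt_min !ltr_norml => /andP[/andP[? ?] /andP[? ?]]; apply/andP; split; lra.
have ql n : q n h @[h --> 0^'] --> f' n x.
  have [dfx <-] := df n x xab; rewrite /derive.
  apply: cvg_trans dfx; apply: near_eq_cvg; near=> h.
  by rewrite /q /GRing.scale/= mulr1.
have qM n h : D h -> `|q n h| <= M n.
  move=> [h0 hab]; rewrite /q normrM normfV mulrC ler_pdivrMr ?normr_gt0//.
  pose lo := Num.min x (h + x); pose hi := Num.max x (h + x).
  have inab y : lo <= y <= hi -> a < y < b.
    rewrite ge_min le_max => /andP[/orP[?|?] /orP[?|?]]; lra.
  have := @bounded_derivative_lipschitz _ (f n) (f' n) lo hi (M n)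
    (fun y yI => df n y (inab y yI)) (fun y yI => f'M n y (inab y yI)) (h + x) x.
  by rewrite addrK; apply; rewrite ge_min le_max !lexx ?orbT.
have lM n : `|f' n x| <= M n by exact: f'M.
have H := tannery (dnbhs_filter _) ql FD qM lM cM.
have cf y : a < y < b -> cvgn (series (f ^~ y)).
  by move=> yab; apply: (tsum_cvg (M := M)) => // n; exact: fM.
have E : \forall h \near 0^', h^-1 *: (tsum (f ^~ (h *: 1 + x)) - tsum (f ^~ x)) = tsum (q ^~ h).
  near=> h; have [h0 hab] : D h by near: h.
  have := tsum_lin h^-1 (- h^-1) (cf _ hab) (cf _ xab).
  rewrite /GRing.scale/= mulr1 mulNr -mulrBr => <-.
  by congr tsum; apply/funext => n; rewrite /q mulNr mulrBr.
have H' : (fun h => h^-1 *: (tsum (f ^~ (h *: 1 + x)) - tsum (f ^~ x))) @ 0^' --> tsum (f' ^~ x).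
  by apply: cvg_trans H; apply: near_eq_cvg; apply: filterS E => h ->.
by split; [apply/cvg_ex; eexists; exact: H'|exact: cvg_lim H'].
Unshelve. all: end_near. Qed.

(** * The boundary value problem and the maximum principle *)

Lemma ge0_derive_le (R : realType) (f f' : R -> R) (a b : R) :
  a <= b -> (forall x : R, a <= x <= b -> is_derive x 1 f (f' x)) ->
  (forall x, a <= x <= b -> 0 <= f' x) -> f a <= f b.
Proof.
rewrite le_eqVlt => /orP[/eqP -> //|ab] df f'0.
have cf : {within `[a, b], continuous f}.
  apply: derivable_within_continuous => z; rewrite in_itv/= => zab.
  by have [] := df z zab.
have dxy z : z \in `]a, b[ -> is_derive z 1 f (f' z).
  by rewrite in_itv/= => /andP[az zb]; apply: df; lra.
have [c] := MVT ab dxy cf; rewrite in_itv/= => /andP[ac cb] fE.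
by rewrite -subr_ge0 fE mulr_ge0 ?subr_ge0 ?(ltW ab)//; apply: f'0; lra.
Qed.

(** The first derivative vanishes at c. If its derivative l were positive, it would be positive just
    to the right of c, and f would exceed f c there. *)
Lemma second_derivative_max (R : realType) (f f' : R -> R) (a b c l : R) :
  a < c < b -> (forall x : R, a < x < b -> is_derive x 1 f (f' x)) ->
  is_derive c 1 f' l -> (forall x, a < x < b -> f x <= f c) -> l <= 0.
Proof.
move=> acb df df' fmax; rewrite leNgt; apply/negP => l0.
have f'c : f' c = 0.
  have [_ <-] := df c acb.
  have ab : a <= b by lra.
  suff : is_derive c 1 f 0 by move=> [_ ->].
  have dab t : t \in `]a, b[ -> derivable f t 1 by rewrite in_itv/= => /df[].
  have cab : c \in `]a, b[ by rewrite in_itv.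
  have mab t : t \in `]a, b[ -> f t <= f c by rewrite in_itv/=; exact: fmax.
  exact: derive1_at_max ab dab cab mab.
have [d d0 f'pos] : exists2 d, 0 < d & forall h, 0 < h < d -> 0 < f' (h + c).
  have [df'c dl] := df'; rewrite /derivable in df'c.
  have : h^-1 *: (f' (h *: 1 + c) - f' c) @[h --> 0^'] --> l by rewrite -dl.
  move=> /cvgr_gt /(_ _ l0) /nbhs_ballP[d /= d0 dP].
  exists d => // h /andP[h0 hd].
  have : 0 < h^-1 *: (f' (h *: 1 + c) - f' c).
    apply: dP; last by rewrite gt_eqF.
    by rewrite -ball_normE /= sub0r normrN gtr0_norm.
  rewrite f'c subr0 /GRing.scale/= mulr1 => H.
  by move: H; rewrite pmulr_rgt0 ?invr_gt0.
pose y := Num.min ((c + b) / 2) (c + d / 2).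
have cy : c < y by rewrite lt_min; apply/andP; split; lra.
have yb : y < b by rewrite gt_min; apply/orP; left; lra.
have yd : y < c + d by rewrite gt_min; apply/orP; right; lra.
have cf : {within `[c, y], continuous f}.
  apply: derivable_within_continuous => z; rewrite in_itv/= => /andP[? ?].
  have zab : a < z < b by lra.
  by have [] := df z zab.
have dxy z : z \in `]c, y[ -> is_derive z 1 f (f' z).
  by rewrite in_itv/= => /andP[? ?]; apply: df; lra.
have [z] := MVT cy dxy cf; rewrite in_itv/= => /andP[cz zy] fE.
have yle : f y <= f c by apply: fmax; lra.
have : 0 < f y - f c.
  rewrite fE mulr_gt0 ?subr_gt0//; have := f'pos (z - c); rewrite subrK; apply; lra.
by rewrite subr_gt0 ltNge yle.
Qed.

Lemma second_derivative_min (R : realType) (f f' : R -> R) (a b c l : R) :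
  a < c < b -> (forall x : R, a < x < b -> is_derive x 1 f (f' x)) ->
  is_derive c 1 f' l -> (forall x, a < x < b -> f c <= f x) -> 0 <= l.
Proof.
move=> acb df df' fmin; rewrite -oppr_le0.
apply: (@second_derivative_max _ (- f) (- f') a b c) => //.
- by move=> x /df dx; apply: is_deriveN.
- by move=> x /fmin; rewrite lerN2.
Qed.

(** * Linear second order equations on [-1, 1] *)

Definition clamp (R : realType) (a b x : R) : R := Num.max a (Num.min b x).

Lemma clamp_continuous (R : realType) (a b : R) : continuous (clamp a b).
Proof.
move=> x; apply: continuous_max; first exact: cvg_cst.
by apply: continuous_min; [exact: cvg_cst|exact: cvg_id].
Qed.

Lemma clamp_id (R : realType) (a b x : R) : a <= x <= b -> clamp a b x = x.
Proof. by move=> /andP[ax xb]; rewrite /clamp min_r// max_r. Qed.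

Lemma clamp_in (R : realType) (a b x : R) : a <= b -> a <= clamp a b x <= b.
Proof. by move=> ab; rewrite /clamp le_max lexx ge_max ab ge_min lexx. Qed.

(** The integral of f from -1 to x. Starting at -3 puts a neighbourhood of [-1, 1] in the interior,
    where the fundamental theorem applies, and clamping x to [-2, 2] makes the result continuous on
    the whole line. *)
Definition primitive (R : realType) (f : R -> R) (x : R) : R :=
  \int[lebesgue_measure]_(t in `[-3, clamp (-2) 2 x]) f t -
  \int[lebesgue_measure]_(t in `[-3, -1]) f t.

Lemma primitiveN1 (R : realType) (f : R -> R) : primitive f (-1) = 0.
Proof. by rewrite /primitive clamp_id ?subrr//; lra. Qed.

Lemma primitive_derive (R : realType) (f : R -> R) (x : R) :
  continuous f -> -2 < x < 2 -> is_derive x 1 (primitive f) (f x).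
Proof.
move=> cf /andP[x1 x2].
have fi : (@lebesgue_measure R).-integrable `[-3, 3] (EFin \o f).
  apply: continuous_compact_integrable; first exact: segment_compact.
  by apply: continuous_subspaceT.
have x3 : x < 3 by lra.
have x3' : -3 < x by lra.
have [dF F'] := continuous_FTC1_closed x3 fi x3' (cf x).
apply: (@near_eq_is_derive _ _ _ (fun y => (fun y =>
  \int[lebesgue_measure]_(t in `[-3, y]) f t) y + (- \int[lebesgue_measure]_(t in `[-3, -1]) f t))).
  near=> y; rewrite /primitive clamp_id//; apply/andP; split; apply: ltW; near: y.
    exact: lt_nbhsr.
  exact: lt_nbhsl.
rewrite -[f x]addr0; apply: is_deriveD.
  by apply: (DeriveDef dF); rewrite -derive1E.
Unshelve. all: end_near. Qed.

Lemma primitive_continuous (R : realType) (f : R -> R) :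
  continuous f -> continuous (primitive f).
Proof.
move=> cf.
pose h y := \int[lebesgue_measure]_(t in `[-3, y]) f t - \int[lebesgue_measure]_(t in `[-3,
  -1]) f t.
have ch x : -3 < x < 3 -> {for x, continuous h}.
  move=> /andP[x1 x2].
  have fi : (@lebesgue_measure R).-integrable `[-3, 3] (EFin \o f).
    apply: continuous_compact_integrable; first exact: segment_compact.
    by apply: continuous_subspaceT.
  have [dF F'] := continuous_FTC1_closed x2 fi x1 (cf x).
  apply: cvgB; last exact: cvg_cst.
  exact/differentiable_continuous/derivable1_diffP.
move=> x; rewrite (_ : primitive f = h \o clamp (-2) 2)//.
apply: continuous_comp; first exact: clamp_continuous.
have := @clamp_in R (-2) 2 x; move=> /(_ _) H; apply: ch; move: H; lra.
Qed.

(** In the norm weighted by exp (k x) each integration gains a factor 1/k. The function B/k exp (k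
    x), plus or minus the primitive, is nondecreasing and starts nonnegative at -1. *)
Lemma primitive_bound (R : realType) (f : R -> R) (B k x : R) :
  continuous f -> 0 < k -> 0 <= B ->
  (forall y, -1 <= y <= 1 -> `|f y| <= B * expR (k * y)) ->
  -1 <= x <= 1 -> `|primitive f x| <= B / k * expR (k * x).
Proof.
move=> cf k0 B0 fB /andP[x1 x2].
pose E (y : R) := B / k * expR (k * y).
have dE (y : R) : is_derive y 1 E (B * expR (k * y)).
  apply: is_derive_eq.
  by rewrite /GRing.scale/=; field; rewrite gt_eqF.
have dF (y : R) : -1 <= y <= 1 -> is_derive y 1 (primitive f) (f y).
  by move=> /andP[? ?]; apply: primitive_derive => //; apply/andP; split; lra.
have E0 y : 0 <= E y by rewrite mulr_ge0 ?expR_ge0// divr_ge0// ltW.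
have xy y : -1 <= y <= x -> -1 <= y <= 1 by move=> /andP[-> /le_trans ->].
have key (s : R) : `|s| = 1 -> 0 <= E x + s * primitive f x.
  move=> s1; have D1 (y : R) : -1 <= y <= x ->
      is_derive y 1 (fun y => E y + s * primitive f y) (B * expR (k * y) + s * f y).
    move=> /xy yI; have := dF y yI => ?.
    by apply: is_deriveD; apply: is_derive_eq.
  have D2 y : -1 <= y <= x -> 0 <= B * expR (k * y) + s * f y.
    move=> /xy /fB fy; have : `|s * f y| <= B * expR (k * y) by rewrite normrM s1 mul1r.
    by rewrite ler_norml => /andP[? _]; lra.
  have := @ge0_derive_le R _ _ (-1) x x1 D1 D2.
  by rewrite primitiveN1 mulr0 addr0; apply: le_trans.
have := key 1 (normr1 _); have := key (-1); rewrite normrN1 => /(_ erefl).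
by rewrite mul1r mulN1r -/(E x) ler_norml => ? ?; apply/andP; split; lra.
Qed.

Lemma primitive_ge0 (R : realType) (f : R -> R) (x : R) :
  continuous f -> (forall y, -1 <= y <= 1 -> 0 <= f y) ->
  -1 <= x <= 1 -> 0 <= primitive f x.
Proof.
move=> cf f0 /andP[x1 x2]; rewrite -(primitiveN1 f).
apply: (@ge0_derive_le _ _ f) => // y /andP[y1 y2]; last by apply: f0; lra.
by apply: primitive_derive => //; apply/andP; split; lra.
Qed.

(** The terms, not the partial sums, of the Neumann series of y'' = p y + e: each term solves
    y_(n+1)'' = p y_n with zero data at -1. *)
Fixpoint picard (R : realType) (p y0 : R -> R) (n : nat) : R -> R :=
  if n is m.+1 then primitive (primitive (fun x => p x * picard p y0 m x)) else y0.

Definition picard1 (R : realType) (p y0 z0 : R -> R) (n : nat) : R -> R :=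
  if n is m.+1 then primitive (fun x => p x * picard p y0 m x) else z0.

Lemma cvg_geometric_half (R : realType) (K : R) : cvgn (series (geometric K (2^-1))).
Proof. by apply: is_cvg_geometric_series; rewrite ger0_norm ?invr_ge0// invf_lt1// ltr1n. Qed.

Lemma tsumS (R : realType) (u : nat -> R) :
  cvgn (series u) -> tsum u = u 0%N + tsum (fun n => u n.+1).
Proof.
move=> cu; rewrite addrC; apply/eqP; rewrite -subr_eq; apply/eqP/esym.
apply: cvg_lim => //.
rewrite (_ : series _ = fun n => series u n.+1 - u 0%N); last first.
  by apply/funext => n; rewrite /series/= big_nat_recl//= addrAC subrr add0r.
apply: cvgB; last exact: cvg_cst.
by rewrite (cvg_shiftS (series u)).
Qed.

(** The Neumann series starts from the solution [y0] of y'' = e with y (-1) = 0 and slope [al]. The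
    last clause keeps the boundary value at 1 away from 0, as shooting requires. *)
Lemma linear_ode (R : realType) (p : R -> R) (P al e : R) :
  continuous p -> (forall x, -1 <= x <= 1 -> 0 <= p x <= P) ->
  exists y z : R -> R,
  [/\ continuous y, y (-1) = 0,
     (forall x : R, -1 < x < 1 -> is_derive x 1 y (z x)),
     (forall x : R, -1 < x < 1 -> is_derive x 1 z (p x * y x + e)) &
     0 <= al -> 0 <= e -> 2 * al <= y 1].
Proof.
move=> cp pP.
have P0 : 0 <= P.
  have h0 : -1 <= (0 : R) <= 1 by lra.
  by have /andP[pa pb] := pP 0 h0; exact: le_trans pa pb.
pose y0 x := al * (x + 1) + e / 2 * (x + 1) ^+ 2.
pose z0 x := al + e * (x + 1).
have dy0 (x : R) : is_derive x 1 y0 (z0 x).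
  by apply: is_derive_eq; rewrite /z0 /GRing.scale/=; field.
have dz0 (x : R) : is_derive x 1 z0 e.
  by apply: is_derive_eq; rewrite /GRing.scale/=; field.
have dcont (f f' : R -> R) : (forall x : R, is_derive x 1 f (f' x)) -> continuous f.
  move=> df x; apply/differentiable_continuous/derivable1_diffP; by have [] := df x.
have cy0 := dcont _ _ dy0; have cz0 : continuous z0 by apply: (dcont _ (cst e)).
pose Y := picard p y0; pose Z := picard1 p y0 z0.
have cY n : continuous (Y n).
  elim: n => [//|n IH]; rewrite /Y /=; apply: primitive_continuous; apply: primitive_continuous.
  by move=> x; apply: cvgM; [exact: cp|exact: IH].
have cpY n : continuous (fun x => p x * Y n x).
  by move=> x; apply: cvgM; [exact: cp|exact: cY].
have cZ n : continuous (Z n) by case: n => [//|n]; exact: primitive_continuous.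
have [C0 C00 bC0] : exists2 C, 0 <= C & forall x, -1 <= x <= 1 -> `|y0 x| <= C /\ `|z0 x| <= C.
  have cpt := @segment_compact R (-1) 1.
  have [C1 C10 b1] := compact_continuous_bounded cpt (fun x _ => cy0 x).
  have [C2 C20 b2] := compact_continuous_bounded cpt (fun x _ => cz0 x).
  exists (C1 + C2) => [|x xI]; first exact: addr_ge0.
  have xI' : `[-1, 1]%classic x by rewrite /= in_itv.
  by have := b1 x xI'; have := b2 x xI'; lra.
(* This weight makes P/k and P/k^2 at most 1/2, so that every Picard step halves the weighted norm
   and a geometric series dominates. *)
pose k := 1 + 2 * P.
have k0 : 0 < k by rewrite /k; lra.
have Pk : P / k <= 2^-1 by rewrite ler_pdivrMr// /k; lra.
have Pkk : P / k / k <= 2^-1.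
  rewrite ler_pdivrMr//; apply: (le_trans Pk); rewrite /k; lra.
pose C := C0 * expR k.
have C_ge0 : 0 <= C by rewrite mulr_ge0// expR_ge0.
have bY n x : -1 <= x <= 1 -> `|Y n x| <= C * 2^-1 ^+ n * expR (k * x).
  elim: n x => [|n IH] x xI.
    apply: (le_trans (bC0 x xI).1).
    rewrite /C expr0 mulr1 -mulrA -expRD ler_peMr//.
    have kx : 0 <= k * (1 + x) by apply: mulr_ge0; [exact: ltW|lra].
    by rewrite -[X in X <= _](@expR0 R) ler_expR; lra.
  have h1 w : -1 <= w <= 1 -> `|p w * Y n w| <= (P * (C * 2^-1 ^+ n)) * expR (k * w).
    move=> wI; rewrite normrM -mulrA ler_pM//; last exact: IH.
    by have /andP[pw ?] := pP w wI; rewrite ger0_norm.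
  have B0 : 0 <= C * 2^-1 ^+ n by rewrite mulr_ge0// exprn_ge0// invr_ge0.
  have B1 : 0 <= P * (C * 2^-1 ^+ n) by rewrite mulr_ge0.
  have B2 : 0 <= P * (C * 2^-1 ^+ n) / k by rewrite divr_ge0// ltW.
  have h2 w : -1 <= w <= 1 -> _ := primitive_bound (cpY n) k0 B1 h1.
  have := primitive_bound (primitive_continuous (cpY n)) k0 B2 h2 xI.
  move=> /le_trans; apply; rewrite ler_pM2r ?expR_gt0//.
  rewrite (_ : P * _ / k / k = P / k / k * (C * 2^-1 ^+ n)); last by field; rewrite gt_eqF.
  by rewrite exprS (mulrCA C) ler_wpM2r.
have expk x : -1 <= x <= 1 -> expR (k * x) <= expR k.
  by move=> xI; rewrite ler_expR; have : k * x <= k * 1; [rewrite ler_pM2l//; lra|lra].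
have half_ge0 n : 0 <= C * 2^-1 ^+ n by rewrite mulr_ge0// exprn_ge0// invr_ge0.
have bY' n x : -1 <= x <= 1 -> `|Y n x| <= C * expR k * 2^-1 ^+ n.
  by move=> xI; rewrite (le_trans (bY n x xI))// [leRHS]mulrAC ler_wpM2l// expk.
have bpY n x : -1 <= x <= 1 -> `|p x * Y n x| <= P * (C * expR k) * 2^-1 ^+ n.
  move=> xI; rewrite normrM -mulrA ler_pM//; last exact: bY'.
  by have /andP[pw ?] := pP x xI; rewrite ger0_norm.
have bZ n x : -1 <= x <= 1 -> `|Z n x| <= C * expR k * 2^-1 ^+ n.
  case: n => [|n] xI.
    rewrite expr0 mulr1; apply: (le_trans (bC0 x xI).2).
    rewrite /C -mulrA ler_peMr// -expRD -[X in X <= _](@expR0 R) ler_expR; lra.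
  have h1 w : -1 <= w <= 1 -> `|p w * Y n w| <= (P * (C * 2^-1 ^+ n)) * expR (k * w).
    move=> wI; rewrite normrM -mulrA ler_pM//; last exact: bY.
    by have /andP[pw ?] := pP w wI; rewrite ger0_norm.
  have B1 : 0 <= P * (C * 2^-1 ^+ n) by rewrite mulr_ge0.
  have := primitive_bound (cpY n) k0 B1 h1 xI.
  move=> /le_trans; apply.
  rewrite exprS (_ : C * expR k * _ = 2^-1 * (C * 2^-1 ^+ n) * expR k); last by ring.
  apply: ler_pM; rewrite ?expR_ge0 ?expk//; first by rewrite divr_ge0// ltW.
  by rewrite mulrAC ler_wpM2r.
pose K := C * expR k * (1 + 2 * P) + `|e|.
have Ck0 : 0 <= C * expR k by rewrite mulr_ge0// expR_ge0.
have KC : C * expR k <= K.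
  have : 0 <= C * expR k * P by rewrite mulr_ge0.
  by have : 0 <= `|e| by []; rewrite /K; lra.
have Ke : `|e| <= K.
  have : 0 <= C * expR k * P by rewrite mulr_ge0.
  by rewrite /K; lra.
have half0 n : 0 <= (2^-1 : R) ^+ n by rewrite exprn_ge0// invr_ge0.
pose M := geometric K (2^-1 : R).
have cM : cvgn (series M) := @cvg_geometric_half R K.
have MY n x : -1 <= x <= 1 -> `|Y n x| <= M n.
  by move=> xI; apply: (le_trans (bY' n x xI)); rewrite ler_wpM2r.
have MZ n x : -1 <= x <= 1 -> `|Z n x| <= M n.
  by move=> xI; apply: (le_trans (bZ n x xI)); rewrite ler_wpM2r.
(* The second derivatives of the terms: the index is shifted by one and e stands at index 0, so that
   they sum to p y + e. *)
pose Z' n x := if n is m.+1 then p x * Y m x else e.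
have MZ' n x : -1 <= x <= 1 -> `|Z' n x| <= M n.
  case: n => [|n] xI; first by rewrite /M /geometric/= expr0 mulr1.
  apply: (le_trans (bpY n x xI)); rewrite /M /geometric /= exprS mulrA ler_wpM2r//.
  by rewrite /K; have : 0 <= `|e| by []; lra.
have dY n (x : R) : -1 < x < 1 -> is_derive x 1 (Y n) (Z n x).
  move=> xI; case: n => [|n]; first exact: dy0.
  by apply: primitive_derive; [apply: primitive_continuous|lra].
have dZ n (x : R) : -1 < x < 1 -> is_derive x 1 (Z n) (Z' n x).
  move=> xI; case: n => [|n]; first exact: dz0.
  by apply: primitive_derive => //; lra.
have oc (x : R) : -1 < x < 1 -> -1 <= x <= 1 by move=> ?; lra.
(* The series is dominated on [-1, 1] only; clamping the argument makes the sum continuous on the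
   whole line. *)
pose c1 := clamp (-1 : R) 1.
have c1I x : -1 <= c1 x <= 1 by apply: clamp_in; lra.
exists (fun x => tsum (Y ^~ (c1 x))), (fun x => tsum (Z ^~ x)); split.
- move=> x; apply: (tannery _ (D := setT) (M := M)) => //.
  + move=> n; apply: (@continuous_comp _ _ _ c1 (Y n)); first exact: clamp_continuous.
    exact: cY.
  + exact: filterT.
  + by move=> n w _; exact: MY.
  + by move=> n; exact: MY.
- rewrite /c1 clamp_id; last lra.
  rewrite (_ : Y ^~ (-1) = fun n => 0 * M n); first by rewrite tsumZ// mul0r.
  apply/funext => -[|n]; rewrite mul0r; last exact: primitiveN1.
  by rewrite /Y /= /y0 addNr expr0n/= !mulr0 addr0.
- move=> x xI; have /andP[xl xr] := xI.
  apply: (@near_eq_is_derive _ _ _ (fun y => tsum (Y ^~ y))).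
    near=> w; rewrite /c1 clamp_id//; apply/andP; split; apply: ltW; near: w.
      exact: lt_nbhsr.
    exact: lt_nbhsl.
  by apply: (is_derive_tsum xI dY _ _ cM) => n w /oc; [exact: MY|exact: MZ].
- move=> x xI; rewrite /c1 clamp_id; last exact: oc.
  have -> : p x * tsum (Y ^~ x) + e = tsum (Z' ^~ x).
    rewrite [RHS]tsumS; last by apply: (tsum_cvg _ cM) => n; apply: MZ'; exact: oc.
    rewrite addrC; congr (_ + _) => /=; rewrite -tsumZ//.
    by apply: (tsum_cvg _ cM) => n; apply: MY; exact: oc.
  by apply: (is_derive_tsum xI dZ _ _ cM) => n w /oc; [exact: MZ|exact: MZ'].
(* For nonnegative data all the terms are nonnegative, so y 1 is at least its first term y0 1 = 2 al
   + 2 e. *)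
- move=> al0 e0; rewrite /c1 clamp_id; last lra.
  have Y0 n x : -1 <= x <= 1 -> 0 <= Y n x.
    elim: n x => [|n IH] x xI.
      rewrite /Y /= /y0 addr_ge0// mulr_ge0//; first lra.
        by rewrite divr_ge0.
      by rewrite exprn_ge0//; lra.
    rewrite /Y /=; apply: primitive_ge0 => //; first exact: primitive_continuous.
    move=> w wI; apply: primitive_ge0 => // v vI; rewrite mulr_ge0 ?IH//.
    by have /andP[] := pP v vI.
  have I1 : -1 <= (1 : R) <= 1 by lra.
  have cY1 : cvgn (series (Y ^~ 1)) by apply: (tsum_cvg _ cM) => n; exact: MY.
  have := tsum_ge_term 0 (fun n => Y0 n 1 I1) cY1; apply: le_trans.
  rewrite /Y /= /y0 (_ : 1 + 1 = 2 :> R)//.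
  by rewrite mulrC lerDl mulr_ge0// divr_ge0.
Unshelve. all: end_near. Qed.

(** Shooting: a multiple of the homogeneous solution h, with h 1 > 0, is subtracted to reach the
    value 0 at 1. The bounds on s hold because s'' = p s - c would have the wrong sign at a negative
    minimum, and at a maximum above c/m. *)
Lemma boundary_value_problem (R : realType) (p : R -> R) (m P c : R) :
  continuous p -> 0 < m -> 0 <= c -> (forall x, -1 <= x <= 1 -> m <= p x <= P) ->
  exists s s1 : R -> R,
  [/\ continuous s /\ (s (-1) = 0 /\ s 1 = 0),
     (forall x : R, -1 < x < 1 -> is_derive x 1 s (s1 x)),
     (forall x : R, -1 < x < 1 -> is_derive x 1 s1 (p x * s x - c)),
     (forall x, -1 <= x <= 1 -> 0 <= s x <= c / m) &
     (forall x, -1 < x < 1 -> `|s1 x| <= 2 * (P / m + 1) * c)].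
Proof.
move=> cp m0 c0 pmP.
have pP x : -1 <= x <= 1 -> 0 <= p x <= P.
  by move=> /pmP /andP[mp ->]; rewrite (le_trans (ltW m0) mp).
have [h [h1 [ch h_1 dh dh1 h2]]] := linear_ode 1 0 cp pP.
have [q [q1 [cq q_1 dq dq1 _]]] := linear_ode 0 (- c) cp pP.
have h1gt0 : 0 < h 1 by have := h2 ler01 (lexx _); lra.
pose k := q 1 / h 1.
pose s x := q x - k * h x; pose s1 x := q1 x - k * h1 x.
have cs : continuous s.
  by move=> x; apply: cvgB; [exact: cq|apply: cvgM; [exact: cvg_cst|exact: ch]].
have s_1 : s (-1) = 0 by rewrite /s q_1 h_1 mulr0 subrr.
have s_p1 : s 1 = 0 by rewrite /s /k -mulrA mulVf ?gt_eqF// mulr1 subrr.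
have ds (x : R) : -1 < x < 1 -> is_derive x 1 s (s1 x).
  move=> xI; have := dq x xI; have := dh x xI => ? ?; apply: is_derive_eq.
  by rewrite /s1 /GRing.scale/=; ring.
have ds1 (x : R) : -1 < x < 1 -> is_derive x 1 s1 (p x * s x - c).
  move=> xI; have := dq1 x xI; have := dh1 x xI => ? ?; apply: is_derive_eq.
  by rewrite /s /GRing.scale/=; ring.
have cw : {within `[-1, 1], continuous s} by apply: continuous_subspaceT.
have n11 : -1 <= (1 : R) by lra.
have sb x : -1 <= x <= 1 -> 0 <= s x <= c / m.
  move=> xI; apply/andP; split.
    have [x0 x0I smin] := EVT_min n11 cw; rewrite in_itv/= in x0I.
    apply: (@le_trans _ _ (s x0)); last by apply: smin; rewrite in_itv.
    rewrite leNgt; apply/negP => sx0.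
    have x0I' : -1 < x0 < 1.
      have xn1 : x0 != -1 by apply: contraTneq sx0 => ->; rewrite s_1 ltxx.
      have xp1 : x0 != 1 by apply: contraTneq sx0 => ->; rewrite s_p1 ltxx.
      by rewrite !lt_neqAle xp1 (eq_sym (-1)) xn1.
    have oc y : -1 < y < 1 -> s x0 <= s y by move=> xI'; apply: smin; rewrite in_itv/=; lra.
    have := second_derivative_min x0I' ds (ds1 x0 x0I') oc.
    have : p x0 * s x0 < 0.
      by rewrite pmulr_rlt0//; have /andP[+ _] := pmP x0 x0I; apply: lt_le_trans.
    lra.
  have [x0 x0I smax] := EVT_max n11 cw; rewrite in_itv/= in x0I.
  apply: (@le_trans _ _ (s x0)); first by apply: smax; rewrite in_itv.
  rewrite leNgt; apply/negP => sx0.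
  have cm0 : 0 <= c / m by rewrite divr_ge0// ltW.
  have sx0' : 0 < s x0 by exact: le_lt_trans sx0.
  have x0I' : -1 < x0 < 1.
    have xn1 : x0 != -1 by apply: contraTneq sx0' => ->; rewrite s_1 ltxx.
    have xp1 : x0 != 1 by apply: contraTneq sx0' => ->; rewrite s_p1 ltxx.
    by rewrite !lt_neqAle xp1 (eq_sym (-1)) xn1.
  have oc y : -1 < y < 1 -> s y <= s x0 by move=> xI'; apply: smax; rewrite in_itv/=; lra.
  have := second_derivative_max x0I' ds (ds1 x0 x0I') oc.
  have : c < p x0 * s x0.
    move: sx0; rewrite ltr_pdivrMr// mulrC => /lt_le_trans; apply.
    by rewrite ler_wpM2r// ?(ltW sx0')//; have /andP[] := pmP x0 x0I.
  lra.
exists s, s1; split => // x xI.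
have ds' y : y \in `]-1, 1[ -> derivable s y 1 by rewrite in_itv/= => /ds[].
have lt11 : -1 < (1 : R) by lra.
have sab : s (-1) = s 1 by rewrite s_1 s_p1.
(* At [xi] the derivative vanishes; integrating the bound on s'' from there over a length of at most
   2 gives the factor 2 in the bound on [s1]. *)
have [xi] := Rolle lt11 ds' cw sab.
rewrite in_itv/= => xiI dxi.
have s1xi : s1 xi = 0 by have [_ <-] := ds xi xiI; have [_ ->] := dxi.
pose lo := Num.min x xi; pose hi := Num.max x xi.
have inI y : lo <= y <= hi -> -1 < y < 1.
  by rewrite ge_min le_max => /andP[/orP[?|?] /orP[?|?]]; lra.
have bs2 y : lo <= y <= hi -> `|p y * s y - c| <= (P / m + 1) * c.
  move=> /inI yI; have yI' : -1 <= y <= 1 by lra.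
  have /andP[p0 p1] := pP y yI'; have /andP[s0 sc] := sb y yI'.
  rewrite (le_trans (ler_normB _ _))// mulrDl mul1r lerD//; last by rewrite ger0_norm.
  rewrite normrM !ger0_norm// (le_trans (ler_pM _ _ p1 sc))//.
  by rewrite mulrA mulrAC.
have := @bounded_derivative_lipschitz _ s1 _ lo hi _ (fun y yI => ds1 y (inI y yI)) bs2 x xi.
rewrite s1xi subr0 !ge_min !le_max !lexx !orbT => /(_ erefl erefl) /le_trans; apply.
have h11 : -1 <= (1 : R) <= 1 by lra.
have /andP[p0 p1] := pP 1 h11; have P0 : 0 <= P by exact: le_trans p1.
rewrite (_ : 2 * (P / m + 1) * c = (P / m + 1) * c * 2); last by ring.
rewrite ler_wpM2l//.
  by rewrite mulr_ge0// addr_ge0// divr_ge0// ltW.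
by rewrite ler_norml; lra.
Qed.

(** The differential inequality is not strict, so a small multiple of (b - x)(x - a) is added. It is
    nonnegative on the rectangle and has x second derivative -2, which a negative interior minimum
    contradicts. *)
Lemma maximum_principle (R : realType) (Z Zx Zxx Zt Ztt : R -> R -> R) (a b c d : R) :
  continuous (fun q : R * R => Z q.1 q.2) ->
  (forall x t, a <= x <= b -> c <= t <= d ->
     ~~ ((a < x < b) && (c < t < d)) -> 0 <= Z x t) ->
  (forall x t : R, a < x < b -> c < t < d ->
    [/\ is_derive x 1 (Z ^~ t) (Zx x t), is_derive x 1 (Zx ^~ t) (Zxx x t),
       is_derive t 1 (Z x) (Zt x t) & is_derive t 1 (Zt x) (Ztt x t)]) ->
  (forall x t, a < x < b -> c < t < d -> Z x t < 0 -> Zxx x t + Ztt x t <= 0) ->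
  forall x t, a <= x <= b -> c <= t <= d -> 0 <= Z x t.
Proof.
move=> cZ bdZ dZ LZ x1 t1 x1I t1I; rewrite leNgt; apply/negP => Z1.
pose w x := (b - x) * (x - a).
have w0 x : a <= x <= b -> 0 <= w x.
  by move=> /andP[? ?]; rewrite mulr_ge0// subr_ge0.
have w1 := w0 _ x1I.
(* Small enough for the perturbed function to stay negative at (x1, t1). *)
pose e := - Z x1 t1 / (2 * (w x1 + 1)).
have e0 : 0 < e by rewrite divr_gt0 ?oppr_gt0// mulr_gt0// ltr_wpDl.
have ew : e * w x1 < - Z x1 t1.
  rewrite /e mulrAC ltr_pdivrMr ?mulr_gt0 ?ltr_wpDl//.
  by rewrite ltr_pM2l ?oppr_gt0//; lra.
pose Y (q : R * R) := Z q.1 q.2 + e * w q.1.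
have cY : continuous Y.
  move=> q; apply: cvgD; first exact: cZ.
  apply: cvgM; first exact: cvg_cst.
  by apply: cvgM; apply: cvgB; first [exact: cvg_cst|exact: cvg_fst].
have cpt : compact (`[a, b]%classic `*` `[c, d]%classic : set (R * R)).
  by apply: compact_setX; exact: segment_compact.
have ne : (`[a, b]%classic `*` `[c, d]%classic : set (R * R)) !=set0.
  by exists (x1, t1); split; rewrite /= in_itv.
have [[x0 t0]] := compact_EVT_min ne cpt (continuous_subspaceT cY).
rewrite inE /= !in_itv/= => -[x0I t0I] Ymin.
have Yin x t : a <= x <= b -> c <= t <= d -> Y (x0, t0) <= Y (x, t).
  by move=> xI tI; apply: Ymin; rewrite inE; split; rewrite /= in_itv.
have Y0 : Y (x0, t0) < 0.
  by apply: le_lt_trans (Yin _ _ x1I t1I) _; rewrite /Y /=; lra.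
have ew0 : 0 <= e * w x0 by rewrite mulr_ge0 ?w0// ltW.
have Z0 : Z x0 t0 < 0 by move: Y0; rewrite /Y /=; lra.
have [/andP[x0I' t0I']|/negP/bdZ] := pselect (is_true ((a < x0 < b) && (c < t0 < d))); last first.
  by move=> /(_ x0I t0I); rewrite leNgt Z0.
have [dx dxx dt dtt] := dZ _ _ x0I' t0I'.
have h1 : 0 <= Zxx x0 t0 - 2 * e.
  apply: (@second_derivative_min _ (fun x => Y (x, t0)) (fun x =>
    Zx x t0 + e * (a + b - 2 * x)) a b x0) => //.
  - move=> x xI; have [? _ _ _] := dZ _ _ xI t0I'; rewrite /Y /w /=.
    apply: is_derive_eq; rewrite /GRing.scale/=; ring.
  - apply: is_derive_eq; rewrite /GRing.scale/=; ring.
  - by move=> x xI; apply: Yin; [lra|].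
have h2 : 0 <= Ztt x0 t0.
  apply: (@second_derivative_min _ (fun t => Y (x0, t)) (Zt x0) c d t0) => //.
  - move=> t tI; have [_ _ ? _] := dZ _ _ x0I' tI; rewrite /Y /=.
    by apply: is_derive_eq; rewrite addr0.
  - by move=> t tI; apply: Yin; [|lra].
have := LZ _ _ x0I' t0I' Z0; lra.
Qed.

(** * Cosine series of a hat function *)

(** Odd frequencies: [cos (freq k * t)] are the even Dirichlet eigenfunctions on the interval
    ]-pi/2, pi/2[. *)
Definition freq (R : realType) (k : nat) : R := k.*2.+1%:R.

Lemma freqE (R : realType) (k : nat) : freq R k = 2 * k%:R + 1.
Proof. by rewrite /freq -addn1 -mul2n natrD natrM. Qed.

Lemma freq_gt0 (R : realType) (k : nat) : 0 < freq R k.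
Proof. by rewrite ltr0n. Qed.

Lemma freq_ge1 (R : realType) (k : nat) : 1 <= freq R k.
Proof. by rewrite ler1n. Qed.

Lemma freq_neq0 (R : realType) (k : nat) : freq R k != 0.
Proof. by rewrite gt_eqF ?freq_gt0. Qed.

Lemma cvg_series_freq (R : realType) (K : R) : 0 <= K -> cvgn (series (fun k => K / freq R k ^+ 2)).
Proof.
move=> K0.
have t0 k : 0 <= K / freq R k ^+ 2 by rewrite divr_ge0// exprn_ge0// ltW// freq_gt0.
apply: nondecreasing_is_cvgn; first by apply: nondecreasing_series => k _ _.
exists (2 * K) => _ [n _ <-].
(* A telescoping majorant: 1/(2n+1)^2 <= 2/((n+1)(n+2)). *)
suff : series (fun k => K / freq R k ^+ 2) n <= 2 * K - 2 * K / n.+1%:R.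
  by move=> /le_trans; apply; rewrite gerBl divr_ge0// mulr_ge0.
elim: n => [|n IH]; first by rewrite /series/= big_geq// divr1 subrr.
rewrite seriesSr (le_trans (lerD IH (lexx _)))//.
rewrite -!natr1; set x := n%:R; have x0 : 0 <= x by rewrite ler0n.
rewrite freqE -/x -lerBrDl (_ : _ - _ = K * (2 / ((x + 1) * (x + 2)))); last first.
  by field; rewrite !gt_eqF//; lra.
apply: ler_wpM2l => //; rewrite ler_pdivlMr; last by rewrite mulr_gt0; lra.
by rewrite mulrC ler_pdivrMr; [nra|rewrite exprn_gt0//; lra].
Qed.

(** The triangle wave, classically (pi/4)(pi/2 - |t|) on |t| <= pi. Only the positivity of its slope
    constant is established and used. *)
Definition tri (R : realType) (t : R) : R := tsum (fun k => cos (freq R k * t) / freq R k ^+ 2).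

Lemma tri_term_le (R : realType) (k : nat) (t : R) :
  `|cos (freq R k * t) / freq R k ^+ 2| <= 1 / freq R k ^+ 2.
Proof.
by rewrite normrM normfV (ger0_norm (exprn_ge0 _ (ltW
  (freq_gt0 R k)))) ler_wpM2r ?cos_max// invr_ge0 exprn_ge0// ltW// freq_gt0.
Qed.

Lemma tri_continuous (R : realType) : continuous (@tri R).
Proof.
move=> t; apply: (tannery _ (D := setT) (M := fun k => 1 / freq R k ^+ 2)) => //.
- move=> k; apply: cvgM; last exact: cvg_cst.
  apply: (@cvg_comp _ _ _ (fun x => freq R k * x) cos); last exact: continuous_cos.
  by apply: cvgM; [exact: cvg_cst|exact: cvg_id].
- exact: filterT.
- by move=> k x _; exact: tri_term_le.
- by move=> k; exact: tri_term_le.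
- exact: cvg_series_freq.
Qed.

Lemma tri_even (R : realType) (t : R) : tri (- t) = tri t.
Proof. by congr tsum; apply/funext => k; rewrite mulrN cosN. Qed.

Lemma cos_freq_pihalf (R : realType) (k : nat) : cos (freq R k * (pi / 2)) = 0.
Proof.
rewrite freqE mulrDl mul1r (_ : 2 * k%:R * (pi / 2) = 0 + pi *+ k);
  last by rewrite add0r -mulr_natr; field.
by rewrite cosDpihalf; elim: k => [|k];
  rewrite ?mulr0n ?addr0 ?sin0 ?oppr0// mulrSr addrA sinDpi opprK => /eqP; rewrite oppr_eq0 => /eqP.
Qed.

Lemma tri_pihalf (R : realType) : tri (pi / 2 : R) = 0.
Proof.
rewrite /tri (_ : (fun k => _) = (fun k => 0 * (1 / freq R k ^+ 2))).
  by rewrite tsumZ ?mul0r//; exact: cvg_series_freq.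
by apply/funext => k; rewrite cos_freq_pihalf !mul0r.
Qed.

Definition tri_part (R : realType) (N : nat) (t : R) : R := \sum_(0 <= k < N) cos
  (freq R k * t) / freq R k ^+ 2.
Definition sin_part (R : realType) (N : nat) (t : R) : R := \sum_(0 <= k < N) sin
  (freq R k * t) / freq R k.
Definition cos_part (R : realType) (N : nat) (t : R) : R := \sum_(0 <= k < N) cos (freq R k * t).

Lemma cos_partE (R : realType) (N : nat) (t : R) : 2 * sin t * cos_part N t = sin (2 * N%:R * t).
Proof.
elim: N => [|N IH]; first by rewrite /cos_part big_geq// !mulr0 mul0r sin0.
rewrite /cos_part big_nat_recr//= mulrDr IH freqE.
rewrite (_ : 2 * N%:R * t = (2 * N%:R + 1) * t - t); last by ring.
rewrite (_ : 2 * N.+1%:R * t = (2 * N%:R + 1) * t + t); last by rewrite -natr1; ring.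
by rewrite sinB sinD; ring.
Qed.

Lemma is_derive_sin_part (R : realType) (N : nat) (t : R) : is_derive t 1 (sin_part N)
  (cos_part N t).
Proof.
elim: N => [|N IH].
  rewrite /cos_part big_geq// (_ : sin_part 0 = cst 0); last by apply/funext => x;
    rewrite /sin_part big_geq.
  exact: is_derive_cst.
rewrite /cos_part big_nat_recr//= (_ : sin_part N.+1 = (fun x =>
  sin_part N x + sin (freq R N * x) / freq R N)).
  by apply: is_derive_eq; rewrite /cos_part /GRing.scale/=; field.
by apply/funext => x; rewrite /sin_part big_nat_recr.
Qed.

Lemma is_derive_tri_part (R : realType) (N : nat) (t : R) : is_derive t 1 (tri_part N)
  (- sin_part N t).
Proof.
elim: N => [|N IH].
  rewrite /sin_part big_geq// oppr0 (_ : tri_part 0 = cst 0); last by apply/funext => x;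
    rewrite /tri_part big_geq.
  exact: is_derive_cst.
rewrite /sin_part big_nat_recr//= (_ : tri_part N.+1 = (fun x =>
  tri_part N x + cos (freq R N * x) / freq R N ^+ 2)).
  by apply: is_derive_eq; rewrite /sin_part /GRing.scale/=; field.
by apply/funext => x; rewrite /tri_part big_nat_recr.
Qed.

(* Riemann-Lebesgue by hand: the derivative cos_part of sin_part oscillates with
   frequency 2N, so subtracting a term of size 1/N leaves a derivative of size 1/N. *)
Lemma sin_part_osc (R : realType) (c d : R) : 0 < c -> c <= d -> d < pi ->
  exists2 C, 0 <= C & forall N x y, c <= x <= d -> c <= y <= d ->
    `|sin_part N.+1 x - sin_part N.+1 y| <= C / N.+1%:R.
Proof.
move=> c0 cd dpi.
have cw : {within `[c, d], continuous (@sin R)} by apply: continuous_subspaceT;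
  exact: continuous_sin.
have [x0 x0I smin] := EVT_min cd cw; rewrite in_itv/= in x0I.
pose s := sin x0.
have s0 : 0 < s by apply: sin_gt0_pi; lra.
have ss x : c <= x <= d -> s <= sin x by move=> xI; apply: smin; rewrite in_itv.
have sx0 x : c <= x <= d -> 0 < sin x by move=> /ss; exact: lt_le_trans.
(* The first term bounds the derivative of [q] times an interval length below pi; the second bounds
   [r] at the two points. *)
exists (pi / (4 * s ^+ 2) + 1 / (2 * s)).
  by rewrite addr_ge0// divr_ge0// ?pi_ge0// mulr_ge0// ?exprn_ge0 ?ltW.
move=> M x y xI yI; set N := M.+1%:R : R.
have N0 : 0 < N by rewrite ltr0n.
(* Its derivative cancels cos_part = sin (2 N z) / (2 sin z) up to a term of size 1/N. *)
pose r z := cos (2 * N * z) / (4 * N * sin z).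
pose q z := sin_part M.+1 z + r z.
have dq (z : R) : c <= z <= d -> is_derive z 1 q (- (cos (2 * N * z) * cos z /
  (4 * N * sin z ^+ 2))).
  move=> zI; have dsp := is_derive_sin_part M.+1 z.
  have sz : sin z != 0 by rewrite gt_eqF ?sx0.
  have dsz : is_derive z 1 (fun z => 4 * N * sin z) (4 * N * cos z).
    by apply: is_derive_eq; rewrite /GRing.scale/=; ring.
  have Nsz : 4 * N * sin z != 0 by rewrite !mulf_neq0// gt_eqF.
  have dV : is_derive z 1 (fun z => (4 * N * sin z)^-1) (- (4 * N * sin z) ^- 2 *: (4 * N * cos z)).
    exact: is_deriveV.
  rewrite /q /r; apply: is_derive_eq.
  have := cos_partE M.+1 z; rewrite -/N => H.
  have -> : cos_part M.+1 z = sin (2 * N * z) / (2 * sin z).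
    by rewrite -H; field.
  by rewrite /GRing.scale/=; field; rewrite sz gt_eqF.
have frac (u U e E : R) : `|u| <= U -> 0 < e -> e <= E -> `|u / E| <= U / e.
  move=> uU e0 eE; have E0 : 0 < E by exact: lt_le_trans eE.
  rewrite normrM normfV (gtr0_norm E0); apply: ler_pM => //.
    by rewrite invr_ge0 ltW.
  by rewrite lef_pV2.
have bq z : c <= z <= d -> `|- (cos (2 * N * z) * cos z / (4 * N * sin z ^+ 2))| <= 1 /
  (4 * s ^+ 2) / N.
  move=> zI; rewrite normrN (_ : 1 / _ / _ = 1 / (4 * N * s ^+ 2)); last by field; rewrite !gt_eqF.
  apply: frac; first by rewrite normrM mulr_ile1// cos_max.
    by rewrite mulr_gt0 ?exprn_gt0// mulr_gt0.
  by apply: ler_wpM2l; [rewrite mulr_ge0// ltW|apply: lerXn2r;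
    rewrite ?nnegrE ?(ltW s0) ?(ltW (sx0 _ zI)) ?ss].
have br z : c <= z <= d -> `|r z| <= 1 / (4 * s) / N.
  move=> zI; rewrite /r (_ : 1 / (4 * s) / N = 1 / (4 * N * s)); last by field; rewrite !gt_eqF.
  apply: frac; first exact: cos_max.
    by rewrite mulr_gt0// mulr_gt0.
  by rewrite ler_wpM2l ?ss// mulr_ge0// ltW.
have H := bounded_derivative_lipschitz dq bq xI yI.
have -> : sin_part M.+1 x - sin_part M.+1 y = (q x - q y) - (r x - r y) by rewrite /q; ring.
rewrite (le_trans (ler_normB _ _))// mulrDl lerD//.
  apply: (le_trans H); rewrite (_ : pi / (4 * s ^+ 2) / N = 1 / (4 * s ^+ 2) / N * pi);
    last by field; rewrite !gt_eqF.
  apply: ler_wpM2l; first by rewrite !divr_ge0// ?mulr_ge0// ?exprn_ge0// ltW.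
  by rewrite ler_norml; apply/andP; split; lra.
rewrite (le_trans (ler_normB _ _))// (_ : 1 / (2 * s) / N = 1 / (4 * s) / N + 1 / (4 * s) / N);
  last by field; rewrite !gt_eqF.
by rewrite lerD// br.
Qed.

Lemma tri_part_cvg (R : realType) (t : R) : tri_part N t @[N --> \oo] --> tri t.
Proof. exact: (tsum_cvg (fun k => tri_term_le k t) (cvg_series_freq (@ler01 R))). Qed.

(** All chords over ]0, pi[ have the same slope. For a partial sum the slope of a chord is -
    [sin_part] at some point, by the mean value theorem, and two such values differ by at most
    C/N. *)
Lemma tri_slopes (R : realType) (a b u v : R) :
  0 < a -> a < b -> b < pi -> 0 < u -> u < v -> v < pi ->
  (tri b - tri a) * (v - u) = (tri v - tri u) * (b - a).
Proof.
move=> a0 ab bpi u0 uv vpi; apply/eqP; rewrite -subr_eq0 -normr_le0.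
pose c := Num.min a u; pose d := Num.max b v.
have c0 : 0 < c by rewrite lt_min a0.
have cd : c <= d by rewrite ge_min le_max (ltW ab).
have dpi : d < pi by rewrite gt_max bpi.
have [C C0 osc] := sin_part_osc c0 cd dpi.
pose e N := (tri_part N b - tri_part N a) * (v - u) - (tri_part N v - tri_part N u) * (b - a).
have ecvg : e N @[N --> \oo] --> (tri b - tri a) * (v - u) - (tri v - tri u) * (b - a).
  by apply: cvgB; apply: cvgM; try exact: cvg_cst; apply: cvgB; exact: tri_part_cvg.
have slope N (x y : R) : x < y ->
  exists2 xi, x < xi < y & tri_part N y - tri_part N x = - sin_part N xi * (y - x).
  move=> xy; have dT (z : R) : z \in `]x, y[ -> is_derive z 1 (tri_part N) (- sin_part N z).
    by move=> _; exact: is_derive_tri_part.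
  have cT : {within `[x, y], continuous (tri_part N)}.
    by apply: derivable_within_continuous => z _; have [] := is_derive_tri_part N z.
  by have [xi xiI E] := MVT xy dT cT; exists xi => //; move: xiI; rewrite in_itv.
have be N : `|e N.+1| <= C * (b - a) * (v - u) * harmonic N.
  have [xi xiI E1] := slope N.+1 a b ab; have [eta etaI E2] := slope N.+1 u v uv.
  rewrite /e E1 E2 (_ : _ - _ = (sin_part N.+1 eta - sin_part N.+1 xi) * ((b - a) * (v - u)));
    last by ring.
  rewrite normrM (ger0_norm (_ : 0 <= (b - a) * _)); last by rewrite mulr_ge0// subr_ge0 ltW.
  rewrite (_ : _ * harmonic N = C / N.+1%:R * ((b - a) * (v - u))); last by rewrite /harmonic /=;
    ring.
  apply: ler_wpM2r; first by rewrite mulr_ge0// subr_ge0 ltW.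
  have m1 : c <= a by rewrite ge_min lexx.
  have m2 : c <= u by rewrite ge_min lexx orbT.
  have m3 : b <= d by rewrite le_max lexx.
  have m4 : v <= d by rewrite le_max lexx orbT.
  by apply: osc; lra.
have h0 : C * (b - a) * (v - u) * harmonic N @[N --> \oo] --> (0 : R).
  rewrite -[X in _ --> X](mulr0 (C * (b - a) * (v - u))).
  by apply: cvgM; [exact: cvg_cst|exact: cvg_harmonic].
have eS : `|e N.+1| @[N --> \oo] --> `|(tri b - tri a) * (v - u) - (tri v - tri u) * (b - a)|.
  by apply: cvg_norm; rewrite (cvg_shiftS e).
rewrite -(cvg_lim (@Rhausdorff R) eS) -(cvg_lim (@Rhausdorff R) h0).
apply: ler_lim; [by apply/cvg_ex; eexists; exact: eS|by apply/cvg_ex; eexists; exact: h0|].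
by near=> N; exact: be.
Unshelve. all: end_near. Qed.

Lemma tri_affine (R : realType) : exists2 m : R, 0 < m &
  forall t, `|t| < pi -> tri t = m * (pi / 2 - `|t|).
Proof.
have pi0 := pi_gt0 R.
pose m := tri (pi / 4 : R) / (pi / 4).
have H t : 0 < t < pi -> tri t = m * (pi / 2 - t).
  move=> /andP[t0 tpi].
  have ne : pi / 4 != 0 :> R by rewrite gt_eqF// divr_gt0.
  have [tl|tg|->] := ltgtP t (pi / 2); last by rewrite subrr mulr0 tri_pihalf.
  - have := @tri_slopes R t (pi / 2) (pi / 4) (pi / 2) t0 tl.
    rewrite tri_pihalf !sub0r => /(_ _ _ _ _) E.
    have {}E : - tri t * (pi / 2 - pi / 4) = - tri (pi / 4) * (pi / 2 - t) by apply: E; lra.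
    apply: (mulIf ne); rewrite /m mulrAC divfK//.
    by apply: oppr_inj; rewrite -!mulNr -E; congr (_ * _); field.
  - have := @tri_slopes R (pi / 2) t (pi / 4) (pi / 2) _ tg tpi.
    rewrite tri_pihalf !subr0 !sub0r => /(_ _ _ _ _) E.
    have {}E : tri t * (pi / 2 - pi / 4) = - tri (pi / 4) * (t - pi / 2) by apply: E; lra.
    apply: (mulIf ne); rewrite /m mulrAC divfK//.
    rewrite (_ : pi / 4 = pi / 2 - pi / 4); last by field.
    by rewrite E (_ : pi / 2 - pi / 4 = pi / 4); [ring|field].
(* The slope argument excludes t = 0, where the sine in the denominator vanishes; the value there
   follows from continuity on the right. *)
have H0 : tri (0 : R) = m * (pi / 2 - 0).
  pose f (t : R) := tri t - m * (pi / 2 - t).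
  have cf : continuous f.
    move=> t; apply: cvgB; first exact: tri_continuous.
    apply: cvgM; first exact: cvg_cst.
    by apply: cvgB; [exact: cvg_cst|exact: cvg_id].
  have f0 : f t @[t --> 0^'+] --> f 0 by apply: cvg_at_right_filter; exact: cf.
  have f0' : f t @[t --> 0^'+] --> (0 : R).
    apply: cvg_near_cst.
    have n1 : \forall t \near (0 : R)^'+, 0 < t by exact: nbhs_right_gt.
    have n2 : \forall t \near (0 : R)^'+, t < pi by exact: nbhs_right_lt.
    by apply: filterS2 n1 n2 => t t0 tpi; rewrite /f H ?subrr// t0.
  by apply/eqP; rewrite -subr_eq0; apply/eqP; exact: (cvg_unique (@Rhausdorff R) f0 f0').
exists m.
  (* At 0 all terms are nonnegative and the first one is 1; this makes m positive. *)
  have : 1 <= tri (0 : R).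
    have c0 : cvgn (series (fun k => cos (freq R k * 0) / freq R k ^+ 2)).
      exact: (tsum_cvg (fun k => tri_term_le k 0) (cvg_series_freq (@ler01 R))).
    have := @tsum_ge_term _ _ 0 _ c0; rewrite mulr0 cos0 /freq /= expr1n divr1; apply.
    by move=> n; rewrite mulr0 cos0 divr_ge0// exprn_ge0.
  rewrite H0 subr0 => m1; rewrite -(pmulr_lgt0 m (_ : 0 < pi / 2)); last by rewrite divr_gt0.
  exact: lt_le_trans m1.
move=> t; have [t0|t0|->] := ltgtP t 0; last by rewrite normr0.
- by rewrite ltr0_norm// => tpi; rewrite -tri_even H// oppr_gt0 t0.
- by rewrite gtr0_norm// => tpi; rewrite H// t0.
Unshelve. all: end_near. Qed.

(** Cosine coefficients of 2 tri t - tri (t + a) - tri (t - a), a second difference of the triangle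
    wave and hence a hat near 0. The factor 1 - cos makes them nonnegative. *)
Definition hat_coef (R : realType) (a : R) (k : nat) : R := 2 * (1 - cos
  (freq R k * a)) / freq R k ^+ 2.

Lemma hat_coef_ge0 (R : realType) (a : R) (k : nat) : 0 <= hat_coef a k.
Proof.
rewrite /hat_coef divr_ge0 ?exprn_ge0 ?(ltW (freq_gt0 _ _))// mulr_ge0// subr_ge0 cos_le1//.
Qed.

Lemma hat_coef_le (R : realType) (a : R) (k : nat) : hat_coef a k <= 4 / freq R k ^+ 2.
Proof.
apply: ler_wpM2r; first by rewrite invr_ge0 exprn_ge0// ltW// freq_gt0.
have := cos_geN1 (freq R k * a); lra.
Qed.

Lemma hat_series (R : realType) (a t : R) :
  tsum (fun k => hat_coef a k * cos (freq R k * t)) = 2 * tri t - (tri (t + a) + tri (t - a)).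
Proof.
have c1 x : cvgn (series (fun k => cos (freq R k * x) / freq R k ^+ 2)).
  exact: (tsum_cvg (fun k => tri_term_le k x) (cvg_series_freq (@ler01 R))).
have c2 : cvgn (series (fun k => cos (freq R k * (t + a)) / freq R k ^+ 2 + cos (freq R k *
  (t - a)) / freq R k ^+ 2)).
  by apply: is_cvg_seriesD; exact: c1.
rewrite /tri -tsumD// -mulN1r -tsum_lin//; congr tsum; apply/funext => k.
rewrite /hat_coef (mulrDr (freq R k)) (mulrBr (freq R k)) cosD cosB; field; rewrite nat1r;
  exact: freq_neq0.
Qed.

Lemma hat_value (R : realType) (a : R) : 0 < a < pi / 2 ->
  exists2 m : R, 0 < m & forall t, `|t| <= pi / 2 ->
    tsum (fun k => hat_coef a k * cos (freq R k * t)) =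
    if `|t| <= a then 2 * m * (a - `|t|) else 0.
Proof.
move=> /andP[a0 api]; have [m m0 mE] := tri_affine R.
have pi0 := pi_gt0 R.
exists m => // t; rewrite ler_norml => /andP[t1 t2].
(* With |t| <= pi/2 and a < pi/2, the points t and t ± a stay in the range where [tri] is piecewise
   affine. *)
have E x : -pi < x < pi -> tri x = m * (pi / 2 - `|x|) by rewrite -ltr_norml; exact: mE.
rewrite hat_series !E; try by apply/andP; split; lra.
have [t0|t0] := ger0P t.
- rewrite (ger0_norm (_ : 0 <= t + a)) ?addr_ge0 ?(ltW a0)//.
  case: (leP t a) => ta; first by rewrite ler0_norm ?subr_le0//; ring.
  by rewrite ger0_norm ?subr_ge0 ?(ltW ta)//; ring.
- rewrite (ler0_norm (_ : t - a <= 0)); last lra.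
  case: (leP (- t) a) => ta; first by rewrite ger0_norm; [ring|lra].
  by rewrite ler0_norm; [ring|lra].
Qed.

(** * The Dirichlet problem with hat source *)

Lemma is_derive_continuous (R : realType) (f : R -> R) (x l : R) :
  is_derive x 1 f l -> {for x, continuous f}.
Proof. by move=> [df _]; exact/differentiable_continuous/derivable1_diffP. Qed.

Lemma tsum_mul_continuous (R : realType) (f h : nat -> R -> R) (M : nat -> R) (a b : R)
  (z : R * R) :
  a < z.1 < b ->
  (forall k x, a < x < b -> {for x, continuous (f k)}) ->
  (forall k, continuous (h k)) ->
  (forall k x t, a < x < b -> `|f k x * h k t| <= M k) ->
  cvgn (series M) ->
  {for z, continuous (fun w : R * R => tsum (fun k => f k w.1 * h k w.2))}.
Proof.
move=> zI cf ch fhM cM.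
apply: (tannery _ (D := [set w : R * R | a < w.1 < b]) (M := M)) => //.
- move=> k; apply: cvgM.
    by apply: (@cvg_comp _ _ _ fst (f k)); [exact: cvg_fst|exact: cf].
  by apply: (@cvg_comp _ _ _ snd (h k)); [exact: cvg_snd|exact: ch].
- have /= [za zb] := andP zI.
  have c1 : (fun w : R * R => w.1) @ z --> z.1 by exact: cvg_fst.
  have n1 : \forall w \near z, a < w.1 by move/cvgr_gt : (c1); apply.
  have n2 : \forall w \near z, w.1 < b by move/cvgr_lt : (c1); apply.
  by apply: filterS2 n1 n2 => w wa wb; rewrite /= wa.
- by move=> k w; exact: fhM.
- by move=> k; exact: fhM.
Qed.

(** Separation of variables: U is the sum of s_k (x) cos (f_k t) with s_k'' = (f_k^2 + q) s_k - c_k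
    and zero boundary values. The constant A is fixed before q, so the bounds grow only linearly in
    Q; later Q is of order lam^2. *)
Lemma dirichlet_solution (R : realType) (a : R) : exists2 A : R, 0 <= A &
  forall (q : R -> R) (Q : R), continuous q -> (forall x, -1 <= x <= 1 -> 0 <= q x <= Q) ->
  exists U Ux Uxx Ut Utt : R -> R -> R,
  [/\ continuous (fun z : R * R => U z.1 z.2) /\
     (forall x t, ~~ ((-1 < x < 1) && (- (pi / 2) < t < pi / 2)) -> - (pi / 2) <= t <= pi / 2 ->
       U x t = 0),
     (forall x t : R, -1 < x < 1 ->
      [/\ is_derive x 1 (U ^~ t) (Ux x t), is_derive x 1 (Ux ^~ t) (Uxx x t),
       is_derive t 1 (U x) (Ut x t) & is_derive t 1 (Ut x) (Utt x t)]),
     (forall z : R * R, -1 < z.1 < 1 ->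
      [/\ {for z, continuous (fun z : R * R => Ux z.1 z.2)},
          {for z, continuous (fun z : R * R => Uxx z.1 z.2)},
          {for z, continuous (fun z : R * R => Ut z.1 z.2)} &
          {for z, continuous (fun z : R * R => Utt z.1 z.2)}]),
     (forall x t, -1 < x < 1 ->
        Uxx x t + Utt x t = q x * U x t - tsum (fun k => hat_coef a k * cos (freq R k * t))) &
     (forall x t, -1 < x < 1 -> let B := A * (1 + Q) in
        [/\ `|U x t| <= B, `|Ux x t| <= B, `|Uxx x t| <= B, `|Ut x t| <= B & `|Utt x t| <= B])].
Proof.
pose c := hat_coef a.
exists (16 * tsum (fun k => 1 / freq R k ^+ 2)).
  rewrite mulr_ge0//; apply: le_trans (tsum_ge_term 0 _ (cvg_series_freq ler01)).
    by rewrite divr_ge0// exprn_ge0// ltW ?freq_gt0.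
  by move=> k; rewrite divr_ge0// exprn_ge0// ltW ?freq_gt0.
move=> q Q cq qQ.
have Q0 : 0 <= Q.
  have h0 : -1 <= (0 : R) <= 1 by lra.
  by have /andP[pa pb] := qQ 0 h0; exact: le_trans pa pb.
pose f k := freq R k.
have f0 k : 0 < f k by exact: freq_gt0.
have f20 k : 0 < f k ^+ 2 by rewrite exprn_gt0.
have f1 k : 1 <= f k by exact: freq_ge1.
have f21 k : 1 <= f k ^+ 2 by rewrite exprn_ege1.
have c0 k : 0 <= c k by exact: hat_coef_ge0.
have c4 k : c k <= 4 / f k ^+ 2 by exact: hat_coef_le.
have exs k : exists ss : (R -> R) * (R -> R),
  [/\ continuous ss.1 /\ (ss.1 (-1) = 0 /\ ss.1 1 = 0),
     (forall x : R, -1 < x < 1 -> is_derive x 1 ss.1 (ss.2 x)),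
     (forall x : R, -1 < x < 1 -> is_derive x 1 ss.2 ((f k ^+ 2 + q x) * ss.1 x - c k)),
     (forall x, -1 <= x <= 1 -> 0 <= ss.1 x <= c k / f k ^+ 2) &
     (forall x, -1 < x < 1 -> `|ss.2 x| <= 2 * ((f k ^+ 2 + Q) / f k ^+ 2 + 1) * c k)].
  have cp : continuous (fun x => f k ^+ 2 + q x).
    by move=> x; apply: cvgD; [exact: cvg_cst|exact: cq].
  have pP x : -1 <= x <= 1 -> f k ^+ 2 <= f k ^+ 2 + q x <= f k ^+ 2 + Q.
    by move=> /qQ /andP[? ?]; rewrite lerDl lerD2l; apply/andP.
  by have [s [s1 H]] := boundary_value_problem cp (f20 k) (c0 k) pP; exists (s, s1).
have [ss ssP] := choice exs.
pose s k := (ss k).1; pose s1 k := (ss k).2; pose s2 k x := (f k ^+ 2 + q x) * s k x - c k.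
have cs k : continuous (s k) by have [[]] := ssP k.
have sn1 k : s k (-1) = 0 by have [[_ []]] := ssP k.
have sp1 k : s k 1 = 0 by have [[_ []]] := ssP k.
have ds k (x : R) : -1 < x < 1 -> is_derive x 1 (s k) (s1 k x) by have [_ + _ _ _] := ssP k; apply.
have ds1 k (x : R) : -1 < x < 1 -> is_derive x 1 (s1 k) (s2 k x) by have [_ _ + _ _] := ssP k;
  apply.
have sb k x : -1 <= x <= 1 -> 0 <= s k x <= c k / f k ^+ 2 by have [_ _ _ + _] := ssP k; apply.
(* Dictated by the bound on [s1]: 2 ((f^2 + Q)/f^2 + 1) c_k with c_k <= 4/f^2. The same M dominates
   the other derivatives, because f^2 s_k <= c_k. *)
pose K := 8 * (2 + Q); pose M k := K / f k ^+ 2.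
have K8 : 8 <= K by rewrite /K; lra.
have M4 k : 4 / f k ^+ 2 <= M k by rewrite ler_wpM2r ?invr_ge0 ?(ltW (f20 k))//; lra.
have M0 k : 0 <= M k by rewrite divr_ge0 ?(ltW (f20 k))//; lra.
have cM : cvgn (series M) by apply: cvg_series_freq; lra.
have cf k : c k / f k ^+ 2 <= 4 / f k ^+ 2.
  by rewrite (le_trans _ (c4 k))// ler_pdivrMr// ler_peMr.
have bs k x : -1 <= x <= 1 -> `|s k x| <= M k.
  by move=> xI; have /andP[s0 sc] := sb k x xI;
    rewrite ger0_norm// (le_trans sc)// (le_trans (cf k)).
have bs1 k x : -1 < x < 1 -> `|s1 k x| <= M k.
  move=> xI; have [_ _ _ _ /(_ x xI) /le_trans] := ssP k; apply.
  apply: (@le_trans _ _ (2 * (2 + Q) * c k)).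
    rewrite ler_wpM2r// ler_wpM2l// mulrDl divff ?gt_eqF//.
    have : Q / f k ^+ 2 <= Q by rewrite ler_pdivrMr// ler_peMr.
    by set e := Q / _; lra.
  rewrite (le_trans (ler_wpM2l _ (c4 k)))//; first by lra.
  by rewrite /M /K mulrA ler_wpM2r ?invr_ge0 ?(ltW (f20 k))//; lra.
have f2s k x : -1 <= x <= 1 -> 0 <= f k ^+ 2 * s k x <= c k.
  by move=> /(sb k) /andP[s0 sc]; rewrite mulr_ge0 ?(ltW (f20 k))//= mulrC -ler_pdivlMr.
have bs2 k x : -1 < x < 1 -> `|s2 k x| <= M k.
  move=> xI; have xI' : -1 <= x <= 1 by lra.
  have /andP[a1 a2] := f2s k x xI'; have /andP[s0 sc] := sb k x xI'; have /andP[q0 qb] := qQ x xI'.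
  have qs : 0 <= q x * s k x <= Q * (4 / f k ^+ 2).
    by rewrite mulr_ge0//= ler_pM// (le_trans sc).
  have c4' := c4 k; have c0' := c0 k; rewrite /s2 mulrDl ler_norml.
  rewrite (_ : M k = 2 * (4 / f k ^+ 2) + 2 * (4 / f k ^+ 2) + Q * (4 / f k ^+ 2) + Q *
    (4 / f k ^+ 2)); last by rewrite /M /K; field; rewrite gt_eqF.
  move: c4' qs; set e := 4 / f k ^+ 2 => c4' /andP[qs0 qs1].
  by apply/andP; split; lra.
have icos (b w : R) : `|b * cos w| <= `|b| by rewrite normrM ler_piMr// cos_max.
have isin (b w : R) : `|b * sin w| <= `|b| by rewrite normrM ler_piMr// sin_max.
have fs k x : -1 <= x <= 1 -> `|f k * s k x| <= M k.
  move=> xI; have /andP[s0 sc] := sb k x xI; have /andP[a1 a2] := f2s k x xI.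
  rewrite ger0_norm ?mulr_ge0 ?(ltW (f0 k))// (le_trans _ (M4 k))// (le_trans _ (c4 k))//
    (le_trans _ a2)//.
  by rewrite ler_wpM2r// expr2 ler_peMr// ltW.
have ffs k x : -1 <= x <= 1 -> `|f k ^+ 2 * s k x| <= M k.
  move=> xI; have /andP[a1 a2] := f2s k x xI.
  by rewrite ger0_norm// (le_trans _ (M4 k))// (le_trans _ (c4 k)).
(* Since s_k vanishes at -1 and 1, clamping extends it by zero, so that U is continuous on the plane
   and zero for |x| >= 1. *)
pose c1 := clamp (-1 : R) 1.
have c1I x : -1 <= c1 x <= 1 by apply: clamp_in; lra.
have oc (x : R) : -1 < x < 1 -> -1 <= x <= 1 by move=> ?; lra.
pose U x t := tsum (fun k => s k (c1 x) * cos (f k * t)).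
pose Ux x t := tsum (fun k => s1 k x * cos (f k * t)).
pose Uxx x t := tsum (fun k => s2 k x * cos (f k * t)).
pose Ut x t := tsum (fun k => - (f k * s k (c1 x)) * sin (f k * t)).
pose Utt x t := tsum (fun k => - (f k ^+ 2 * s k (c1 x)) * cos (f k * t)).
have cc1 : continuous c1 by exact: clamp_continuous.
have csc k : continuous (fun x => s k (c1 x)).
  by move=> x; apply: (@cvg_comp _ _ _ c1 (s k)); [exact: cc1|exact: cs].
have cmul (b : R) : continuous (fun t : R => b * t).
  by move=> t; apply: cvgM; [exact: cvg_cst|exact: cvg_id].
have ccos k : continuous (fun t => cos (f k * t)).
  by move=> t; apply: (@cvg_comp _ _ _ (fun t => f k * t) cos); [exact: cmul|exact: continuous_cos].
have csin k : continuous (fun t => sin (f k * t)).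
  by move=> t; apply: (@cvg_comp _ _ _ (fun t => f k * t) sin); [exact: cmul|exact: continuous_sin].
have zero (u : nat -> R) : (forall k, u k = 0) -> tsum u = 0.
  move=> u0; rewrite (_ : u = fun k => 0 * M k); first by rewrite tsumZ// mul0r.
  by apply/funext => k; rewrite u0 mul0r.
have out x : ~~ (-1 < x < 1) -> forall k, s k (c1 x) = 0.
  move=> xI k; have [x1|x1] := leP 1 x.
    by rewrite /c1 /clamp min_l// max_r ?sp1//; lra.
  by rewrite /c1 /clamp (min_r (ltW x1)) max_l ?sn1//; lra.
have mcos k x t : `|s k (c1 x) * cos (f k * t)| <= M k by rewrite (le_trans (icos _ _))// bs.
have mcos1 k x t : -1 < x < 1 -> `|s1 k x * cos (f k * t)| <= M k.
  by move=> xI; rewrite (le_trans (icos _ _))// bs1.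
have mcos2 k x t : -1 < x < 1 -> `|s2 k x * cos (f k * t)| <= M k.
  by move=> xI; rewrite (le_trans (icos _ _))// bs2.
have msin k x t : `|- (f k * s k (c1 x)) * sin (f k * t)| <= M k.
  by rewrite (le_trans (isin _ _))// normrN fs.
have mcostt k x t : `|- (f k ^+ 2 * s k (c1 x)) * cos (f k * t)| <= M k.
  by rewrite (le_trans (icos _ _))// normrN ffs.
exists U, Ux, Uxx, Ut, Utt; split.
- split => [z|x t xt tI].
    apply: (@tsum_mul_continuous _ (fun k x => s k (c1 x)) (fun k t =>
      cos (f k * t)) M (z.1 - 1) (z.1 + 1)) => //; first by lra.
    by move=> k x _; exact: csc.
  apply: zero => k; have [xI|/out ->] := boolP (-1 < x < 1); last by rewrite mul0r.
  move: xt; rewrite xI /= => tI'.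
  have -> : cos (f k * t) = 0; last by rewrite mulr0.
  have [tp|tp] := leP 0 t.
    have -> : t = pi / 2 by apply/eqP; rewrite eq_le; apply/andP; split; lra.
    exact: cos_freq_pihalf.
  have -> : t = - (pi / 2) by apply/eqP; rewrite eq_le; apply/andP; split; lra.
  by rewrite mulrN cosN cos_freq_pihalf.
- move=> x t xI; have /andP[xl xr] := xI; split.
  + apply: (@near_eq_is_derive _ _ _ (fun y => tsum (fun k => s k y * cos (f k * t)))).
      near=> y; congr tsum; apply/funext => k; rewrite /c1 clamp_id//.
      by apply/andP; split; apply: ltW; near: y; [exact: lt_nbhsr|exact: lt_nbhsl].
    have d k (y : R) : -1 < y < 1 -> is_derive y 1 (fun y =>
      s k y * cos (f k * t)) (s1 k y * cos (f k * t)).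
      move=> yI; have := ds k y yI => ?; apply: is_derive_eq.
      by rewrite /GRing.scale/= mulr0 add0r mulrC.
    have b k y : -1 < y < 1 -> `|s k y * cos (f k * t)| <= M k.
      by move=> /oc yI; have := mcos k y t; rewrite /c1 clamp_id.
    exact: (is_derive_tsum xI d b (fun k y yI => mcos1 k y t yI) cM).
  + have d k (y : R) : -1 < y < 1 -> is_derive y 1 (fun y =>
      s1 k y * cos (f k * t)) (s2 k y * cos (f k * t)).
      move=> yI; have := ds1 k y yI => ?; apply: is_derive_eq.
      by rewrite /GRing.scale/= mulr0 add0r mulrC.
    exact: (is_derive_tsum xI d (fun k y yI => mcos1 k y t yI) (fun k y yI => mcos2 k y t yI) cM).
  + have tI : t - 1 < t < t + 1 by lra.
    have d k (y : R) : t - 1 < y < t + 1 ->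
        is_derive y 1 (fun y => s k (c1 x) * cos (f k * y)) (- (f k * s k (c1 x)) * sin (f k * y)).
      by move=> yI; apply: is_derive_eq; rewrite /GRing.scale/=; ring.
    exact: (is_derive_tsum tI d (fun k y _ => mcos k x y) (fun k y _ => msin k x y) cM).
  + have tI : t - 1 < t < t + 1 by lra.
    have d k (y : R) : t - 1 < y < t + 1 ->
        is_derive y 1 (fun y => - (f k * s k (c1 x)) * sin (f k * y)) (- (f k ^+ 2 * s k
          (c1 x)) * cos (f k * y)).
      by move=> yI; apply: is_derive_eq; rewrite /GRing.scale/=; ring.
    exact: (is_derive_tsum tI d (fun k y _ => msin k x y) (fun k y _ => mcostt k x y) cM).
- move=> z zI; split.
  + apply: (@tsum_mul_continuous _ s1 (fun k t => cos (f k * t)) M (-1) 1) => // k x /(ds1 k);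
      exact: is_derive_continuous.
  + apply: (@tsum_mul_continuous _ s2 (fun k t => cos (f k * t)) M (-1) 1) => // k x xI.
    apply: cvgB; last exact: cvg_cst.
    apply: cvgM; last exact: cs.
    by apply: cvgD; [exact: cvg_cst|exact: cq].
  + apply: (@tsum_mul_continuous _ (fun k x => - (f k * s k (c1 x))) (fun k t =>
      sin (f k * t)) M (-1) 1) => // k x xI.
    by apply: cvgN; apply: cvgM; [exact: cvg_cst|exact: csc].
  + apply: (@tsum_mul_continuous _ (fun k x => - (f k ^+ 2 * s k (c1 x))) (fun k t =>
      cos (f k * t)) M (-1) 1) => // k x xI.
    by apply: cvgN; apply: cvgM; [exact: cvg_cst|exact: csc].
- move=> x t xI; rewrite /Uxx /Utt /U.
  have b2 k := mcos2 k x t xI; have btt k := mcostt k x t; have b0 k := mcos k x t.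
  have bG k : `|c k * cos (f k * t)| <= M k.
    by rewrite (le_trans (icos _ _))// ger0_norm// (le_trans (c4 k)).
  rewrite -tsumD; [|exact: tsum_cvg b2 cM|exact: tsum_cvg btt cM].
  rewrite -[X in _ - X]mul1r -mulNr -tsum_lin; [|exact: tsum_cvg b0 cM|exact: tsum_cvg bG cM].
  congr tsum; apply/funext => k; rewrite /s2 /c1 clamp_id; last exact: oc.
  by rewrite /c /f; ring.
- move=> x t xI /=.
  have tM : tsum M <= 16 * tsum (fun k => 1 / freq R k ^+ 2) * (1 + Q).
    rewrite (_ : M = fun k => K * (1 / freq R k ^+ 2)); last first.
      by apply/funext => k; rewrite /M mul1r.
    rewrite tsumZ; last exact: cvg_series_freq.
    rewrite [leRHS]mulrAC ler_wpM2r//; last by rewrite /K; lra.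
    apply: le_trans (tsum_ge_term 0 _ (cvg_series_freq ler01)).
      by rewrite divr_ge0// exprn_ge0// ltW ?freq_gt0.
    by move=> k; rewrite divr_ge0// exprn_ge0// ltW ?freq_gt0.
  split; apply: (le_trans _ tM); apply: tsum_norm_le => // k.
  + exact: mcos1.
  + exact: mcos2.
Unshelve. all: end_near. Qed.

(** Two comparisons on |x| <= r, where the potential is at most 1: a bump under the hat gives a
    lower bound at t = 0, and a decaying exponential carries it to t0. The constant [del] is
    independent of q and r; the whole dependence on r is in the exponent. *)
Lemma dirichlet_lower_bound (R : realType) (a t0 : R) : 0 < a < pi / 2 -> 0 < t0 < pi / 2 ->
  exists2 del : R, 0 < del &
  forall (q : R -> R) (r : R) (U Ux Uxx Ut Utt : R -> R -> R),
  (forall x, -1 <= x <= 1 -> 0 <= q x) -> 0 < r < 1 -> (forall x, - r <= x <= r -> q x <= 1) ->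
  continuous (fun z : R * R => U z.1 z.2) ->
  (forall x t, ~~ ((-1 < x < 1) && (- (pi / 2) < t < pi / 2)) -> - (pi / 2) <= t <= pi / 2 ->
    U x t = 0) ->
  (forall x t : R, -1 < x < 1 ->
      [/\ is_derive x 1 (U ^~ t) (Ux x t), is_derive x 1 (Ux ^~ t) (Uxx x t),
       is_derive t 1 (U x) (Ut x t) & is_derive t 1 (Ut x) (Utt x t)]) ->
  (forall x t, -1 < x < 1 ->
        Uxx x t + Utt x t = q x * U x t - tsum (fun k => hat_coef a k * cos (freq R k * t))) ->
  (forall x t, -1 <= x <= 1 -> - (pi / 2) <= t <= pi / 2 -> 0 <= U x t) /\
  del * expR (- ((t0 + 2) * (pi / (2 * r)))) <= U 0 t0.
Proof.
move=> aI t0I; have [m m0 hatE] := hat_value aI.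
have pi0 := pi_gt0 R; have pi2 : 0 < pi / 2 :> R by rewrite divr_gt0.
move: aI t0I => /andP[a0 api] /andP[t00 t0pi].
pose B := (pi / a) ^+ 2.
have B0 : 0 <= B by rewrite exprn_even_ge0.
pose sg : R := pi / 2 - t0.
have sg0 : 0 < sg by rewrite /sg; lra.
pose d1 := 1 - expR (- sg).
have d10 : 0 < d1 by rewrite subr_gt0 -[X in _ < X](@expR0 R) ltr_expR; lra.
(* The first factor comes from the size [eta] of the bump, the second from the 1 in the decay rate k
   = 1 + kr, and d1 from the vanishing of the exponential subsolution at pi/2. *)
exists (m * a / (1 + B) * expR (- t0) * d1).
  apply: mulr_gt0 => //; apply: mulr_gt0; last exact: expR_gt0.
  by apply: divr_gt0; [exact: mulr_gt0|lra].
move=> q r U Ux Uxx Ut Utt q0 /andP[r0 r1] q1 cU U0 dU LU.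
have G0 t : - (pi / 2) <= t <= pi / 2 -> 0 <= tsum (fun k => hat_coef a k * cos (freq R k * t)).
  move=> tI; rewrite hatE; last by rewrite ler_norml.
  case: ifPn => // ta.
  by rewrite mulr_ge0 ?subr_ge0// mulr_ge0// ltW.
have Uge0 x t : -1 <= x <= 1 -> - (pi / 2) <= t <= pi / 2 -> 0 <= U x t.
  apply: (maximum_principle cU (Zx := Ux) (Zxx := Uxx) (Zt := Ut) (Ztt := Utt)) => {x t}.
  - by move=> x t xI tI nI; rewrite U0.
  - by move=> x t xI _; exact: dU.
  - move=> x t xI tI Ux0; rewrite LU// subr_le0.
    apply: (@le_trans _ _ 0); last by apply: G0; lra.
    by rewrite mulr_ge0_le0 ?(ltW Ux0)// q0//; lra.
split => //.
(* Chosen so that cos (kr x) vanishes at x = r and x = - r. *)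
pose kr := pi / (2 * r).
have kr0 : 0 < kr by rewrite divr_gt0// mulr_gt0.
have krr : kr * r = pi / 2 by rewrite /kr; field; rewrite gt_eqF.
pose eta := m * a / (1 + kr ^+ 2 + B).
have kr20 : 0 <= kr ^+ 2 by rewrite exprn_ge0// ltW.
have eta0 : 0 < eta by rewrite divr_gt0 ?mulr_gt0//; lra.
have etaM : eta * (1 + kr ^+ 2 + B) = m * a by rewrite /eta divfK// gt_eqF//; lra.
have krE : kr = pi / (2 * r) by [].
have etaE : eta = m * a / (1 + kr ^+ 2 + B) by [].
have BE : B = (pi / a) ^+ 2 by [].
clearbody eta kr B.
have rI x : - r <= x <= r -> -1 <= x <= 1 by move=> ?; lra.
have rI' x : - r < x < r -> -1 < x < 1 by move=> ?; lra.
have cosr x : - r <= x <= r -> 0 <= cos (kr * x).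
  move=> /andP[x1 x2]; apply: cos_ge0_pihalf; rewrite -krr -mulrN !ler_pM2l//.
  by rewrite x1.
have cosr0 x : - r <= x <= r -> ~~ (- r < x < r) -> cos (kr * x) = 0.
  move=> /andP[x1 x2] xn; have [xr|xr] := eqVneq x r; first by rewrite xr krr cos_pihalf.
  have -> : x = - r.
    apply/eqP; rewrite eq_le x1 andbT leNgt; apply/negP => xr'.
    by move/negP: xn; apply; rewrite xr' lt_neqAle xr.
  by rewrite mulrN cosN krr cos_pihalf.
have box1 x t : - r <= x <= r -> - (a / 2) <= t <= a / 2 ->
    0 <= U x t - eta * cos (kr * x) * cos (pi / a * t).
  (* On |t| <= a/2 the source is at least m a, which eta is tuned to. *)
  pose Z x t := U x t - eta * cos (kr * x) * cos (pi / a * t).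
  pose Zx x t := Ux x t + eta * kr * sin (kr * x) * cos (pi / a * t).
  pose Zxx x t := Uxx x t + eta * kr ^+ 2 * cos (kr * x) * cos (pi / a * t).
  pose Zt x t := Ut x t + eta * (pi / a) * cos (kr * x) * sin (pi / a * t).
  pose Ztt x t := Utt x t + eta * B * cos (kr * x) * cos (pi / a * t).
  have aa : pi / a * (a / 2) = pi / 2 by field; rewrite gt_eqF.
  have cost s : - (a / 2) <= s <= a / 2 -> 0 <= cos (pi / a * s).
    move=> /andP[s1 s2]; apply: cos_ge0_pihalf; rewrite -aa -mulrN !ler_pM2l ?divr_gt0//.
    by rewrite s1.
  have cost0 s : - (a / 2) <= s <= a / 2 -> ~~ (- (a / 2) < s < a / 2) -> cos (pi / a * s) = 0.
    move=> /andP[x1 x2] xn; have [xr|xr] := eqVneq s (a / 2); first by rewrite xr aa cos_pihalf.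
    have -> : s = - (a / 2).
      apply/eqP; rewrite eq_le x1 andbT leNgt; apply/negP => xr'.
      by move/negP: xn; apply; rewrite xr' lt_neqAle xr.
    by rewrite mulrN cosN aa cos_pihalf.
  apply: (@maximum_principle _ Z Zx Zxx Zt Ztt (- r) r (- (a / 2)) (a / 2)) => {x t}.
  - move=> z; apply: cvgB; first exact: cU.
    apply: cvgM; first apply: cvgM; first exact: cvg_cst.
      apply: (@cvg_comp _ _ _ (fun w : R * R => kr * w.1) cos); last exact: continuous_cos.
      by apply: cvgM; [exact: cvg_cst|exact: cvg_fst].
    apply: (@cvg_comp _ _ _ (fun w : R * R => pi / a * w.2) cos); last exact: continuous_cos.
    by apply: cvgM; [exact: cvg_cst|exact: cvg_snd].
  - move=> x t xI tI; rewrite negb_and => nI; rewrite /Z.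
    have -> : eta * cos (kr * x) * cos (pi / a * t) = 0.
      by case/orP: nI => nI; [rewrite cosr0|rewrite cost0]; rewrite ?mulr0 ?mul0r.
    by rewrite subr0 Uge0//; [exact: rI|clear - tI api; lra].
  - move=> x t xI tI; have [d11 d12 d13 d14] := dU x t (rI' x xI); split.
    + by apply: is_derive_eq; rewrite /Zx /GRing.scale/=; ring.
    + by apply: is_derive_eq; rewrite /Zxx /GRing.scale/=; ring.
    + by apply: is_derive_eq; rewrite /Zt /GRing.scale/=; ring.
    + by apply: is_derive_eq; rewrite /Ztt BE /GRing.scale/=; ring.
  - move=> x t xI tI; rewrite /Z /Zxx /Ztt.
    have xI' : - r <= x <= r by clear - xI; lra.
    have tI' : - (a / 2) <= t <= a / 2 by clear - tI; lra.
    have tI2 : - (pi / 2) <= t <= pi / 2 by clear - tI api; lra.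
    have := Uge0 x t (rI x xI') tI2; have := q1 x xI'; have := q0 x (rI x xI').
    have ta : `|t| <= a / 2 by rewrite ler_norml.
    have := LU x t (rI' x xI); rewrite hatE; last by rewrite ler_norml.
    rewrite ifT; last by clear - ta a0; lra.
    have cc1 : cos (kr * x) * cos (pi / a * t) <= 1.
      by rewrite mulr_ile1 ?cosr ?cost ?cos_le1.
    have cc0 : 0 <= cos (kr * x) * cos (pi / a * t) by rewrite mulr_ge0 ?cosr ?cost.
    set cx := cos (kr * x) in cc1 cc0 *; set ct := cos (pi / a * t) in cc1 cc0 *.
    move=> E qx0 qx1 Ux0 Z0.
    have qU : q x * U x t <= U x t by rewrite ler_piMl.
    have Gm : m * a <= 2 * (m * (a - `|t|)).
      by have : 0 <= m * (a / 2 - `|t|); [rewrite mulr_ge0 ?subr_ge0// ltW|lra].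
    have : eta * (cx * ct) * (1 + kr ^+ 2 + B) <= m * a.
      by rewrite mulrAC etaM ler_piMr// mulr_ge0// ltW.
    move: E; rewrite -mulrA; move: qU Gm Z0; set A1 := q x * U x t; set A2 := m * (a - _).
    by set A3 := m * a; lra.
(* The subsolution cos (kr x) W t needs k^2 >= 1 + kr^2. *)
pose k := 1 + kr.
have k1 : 1 <= k by rewrite /k; lra.
have k2 : 1 + kr ^+ 2 <= k ^+ 2 by rewrite /k sqrrD expr1n mul1r mulr2n; lra.
have kE : k = 1 + kr by [].
clearbody k.
(* W vanishes at pi/2, as U does, and is at most 1 at t = 0, where the first comparison gives the
   boundary inequality. *)
pose W t := expR (- (k * t)) - expR (- (k * (pi / 2))).
have W0 t : t <= pi / 2 -> 0 <= W t.
  by move=> tp; rewrite subr_ge0 ler_expR lerN2 ler_pM2l//; lra.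
have box2 x t : - r <= x <= r -> 0 <= t <= pi / 2 ->
    0 <= U x t - eta * cos (kr * x) * W t.
  pose Z x t := U x t - eta * cos (kr * x) * W t.
  pose Zx x t := Ux x t + eta * kr * sin (kr * x) * W t.
  pose Zxx x t := Uxx x t + eta * kr ^+ 2 * cos (kr * x) * W t.
  pose Zt x t := Ut x t + eta * k * cos (kr * x) * expR (- (k * t)).
  pose Ztt x t := Utt x t - eta * k ^+ 2 * cos (kr * x) * expR (- (k * t)).
  apply: (@maximum_principle _ Z Zx Zxx Zt Ztt (- r) r 0 (pi / 2)) => {x t}.
  - move=> z; apply: cvgB; first exact: cU.
    apply: cvgM; first apply: cvgM; first exact: cvg_cst.
      apply: (@cvg_comp _ _ _ (fun w : R * R => kr * w.1) cos); last exact: continuous_cos.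
      by apply: cvgM; [exact: cvg_cst|exact: cvg_fst].
    apply: cvgB; last exact: cvg_cst.
    apply: (@cvg_comp _ _ _ (fun w : R * R => - (k * w.2)) expR); last exact: continuous_expR.
    by apply: cvgN; apply: cvgM; [exact: cvg_cst|exact: cvg_snd].
  - move=> x t xI tI; rewrite negb_and => nI; rewrite /Z.
    have xI1 := rI x xI.
    have tI1 : - (pi / 2) <= t <= pi / 2 by clear - tI; lra.
    have [xr|xr] := boolP (- r < x < r); last by rewrite cosr0// mulr0 mul0r subr0 Uge0.
    move: nI; rewrite xr /= => nI.
    have [t_0|t_0] := eqVneq t 0.
      have ta : - (a / 2) <= t <= a / 2 by rewrite t_0; clear - a0; lra.
      have := box1 x t xI ta; rewrite t_0 mulr0 cos0 mulr1 => H; apply: (le_trans H).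
      rewrite lerD2l lerN2 ler_piMr//; first by rewrite mulr_ge0 ?cosr// ltW.
      by rewrite /W mulr0 oppr0 expR0 gerBl expR_ge0.
    have -> : t = pi / 2.
      apply/eqP; rewrite eq_le; case/andP: tI => t1 ->; rewrite leNgt; apply/negP => tp.
      by move/negP: nI; apply; rewrite tp lt_neqAle eq_sym t_0 t1.
    rewrite /W subrr mulr0 subr0 Uge0//; clear - pi2; lra.
  - move=> x t xI tI; have [d11 d12 d13 d14] := dU x t (rI' x xI); split.
    + by apply: is_derive_eq; rewrite /Zx /GRing.scale/=; ring.
    + by apply: is_derive_eq; rewrite /Zxx /GRing.scale/=; ring.
    + by apply: is_derive_eq; rewrite /Zt /GRing.scale/=; ring.
    + by apply: is_derive_eq; rewrite /Ztt /GRing.scale/=; ring.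
  - move=> x t xI tI; rewrite /Z /Zxx /Ztt.
    have xI' : - r <= x <= r by clear - xI; lra.
    have tI2 : - (pi / 2) <= t <= pi / 2 by clear - tI; lra.
    have Ux0 := Uge0 x t (rI x xI') tI2; have qx1 := q1 x xI'; have qx0 := q0 x (rI x xI').
    have E := LU x t (rI' x xI); have G := G0 t tI2.
    have qU : q x * U x t <= U x t by rewrite ler_piMl.
    have WE : W t <= expR (- (k * t)) by rewrite /W gerBl expR_ge0.
    have Wt : 0 <= W t by apply: W0; clear - tI; lra.
    have ec : 0 <= eta * cos (kr * x) by rewrite mulr_ge0 ?cosr// ltW.
    have : eta * cos (kr * x) * ((1 + kr ^+ 2) * W t) <= eta * cos (kr * x) * (k ^+ 2 * expR (-
      (k * t))).
      by apply: ler_wpM2l => //; apply: ler_pM => //; lra.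
    move: qU E G; set A1 := q x * U x t; set A2 := tsum _; lra.
have rr : - r <= (0 : R) <= r by clear - r0; lra.
have tt : 0 <= t0 <= pi / 2 by clear - t00 t0pi; lra.
have := box2 0 t0 rr tt; rewrite mulr0 cos0 mulr1 subr_ge0; apply: le_trans.
rewrite -krE /W.
have -> : expR (- (k * (pi / 2))) = expR (- (k * t0)) * expR (- (k * sg)).
  by rewrite -expRD /sg; congr expR; ring.
(* The polynomial loss in [eta] is absorbed into an exponential; this is the 2 in the exponent (t0 +
   2) kr. *)
have e2 : 1 + kr ^+ 2 + B <= (1 + B) * expR (2 * kr).
  have e1 : 1 + kr <= expR kr by exact: expR_ge1Dx.
  have e3 : (1 + kr) ^+ 2 <= expR (2 * kr).
    by rewrite mulr_natl mulr2n expRD -expr2 lerXn2r ?nnegrE ?expR_ge0//; lra.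
  have e4 : 1 <= expR (2 * kr) by apply: le_trans e3; nra.
  by nra.
have eta_ge : m * a / (1 + B) * expR (- (2 * kr)) <= eta.
  have p1 : 0 < 1 + kr ^+ 2 + B by clear - kr20 B0; lra.
  have p2 : 0 < (1 + B) * expR (2 * kr) by apply: mulr_gt0; [clear - B0; lra|exact: expR_gt0].
  by rewrite etaE expRN -mulrA -invfM ler_pM2l ?mulr_gt0// lef_pV2 ?posrE.
have d1_le : d1 <= 1 - expR (- (k * sg)).
  by rewrite lerD2l lerN2 ler_expR lerN2 ler_peMl// ltW.
rewrite (_ : _ * expR (- ((t0 + 2) * kr)) =
  (m * a / (1 + B) * expR (- (2 * kr))) * (expR (- (k * t0)) * d1)); last first.
  have -> : expR (- (k * t0)) = expR (- t0) * expR (- (t0 * kr)).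
    by rewrite -expRD kE; congr expR; ring.
  have -> : expR (- ((t0 + 2) * kr)) = expR (- (2 * kr)) * expR (- (t0 * kr)).
    by rewrite -expRD; congr expR; ring.
  ring.
rewrite -[X in _ <= _ * (X - _)]mulr1 -mulrBr.
apply: ler_pM => //.
- by rewrite mulr_ge0 ?expR_ge0// divr_ge0 ?mulr_ge0 ?(ltW m0) ?(ltW a0)//; lra.
- by rewrite mulr_ge0 ?expR_ge0// ltW.
- by rewrite ler_wpM2l ?expR_ge0.
Qed.

(** A lower limit of absolute values that is not 0 is positive, so |x| |ln (1 / g x)| stays above
    some c > 0 near 0; once g < 1 the logarithm has a known sign and can be inverted. Where g
    vanishes the bound is trivial. *)
Lemma decay_bound (R : realType) (g : R -> R) :
  continuous g -> (forall x, 0 <= g x) -> g 0 = 0 -> decay_liminf g <> 0%E ->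
  exists c r : R, [/\ 0 < c, 0 < r & forall x, 0 < `|x| < r -> g x <= expR (- (c / `|x|))].
Proof.
move=> cg g0 g00 dn0.
set f := (fun x : R => `| x%:E * lne ((g x)%:E)^-1 |%E).
have dpos : (0 < decay_liminf g)%E.
  by rewrite lt_neqAle eq_sym; apply/andP; split; [exact/eqP|apply: lime_inf_ge0].
move: dpos; rewrite /decay_liminf lime_infE => /ereal_sup_gt[z [r /=]].
rewrite in_itv/= andbT => r0 zE zpos.
(* The lower bound z may be infinite, in which case c = 1 serves. *)
have [c c0 cz] : exists2 c : R, 0 < c & (c%:E <= z)%E.
  clear zE; case: z zpos => [s|_|//]; last by exists 1; rewrite ?leey.
  by rewrite lte_fin => s0; exists s.
have fx (x : R) : 0 < `|x| < r -> (c%:E <= f x)%E.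
  move=> /andP[x0 xr]; apply: (le_trans cz); rewrite -zE leeNl.
  apply: ereal_sup_ubound; exists x => //; split.
    by rewrite -ball_normE /= sub0r normrN.
  by move=> /= x00; move: x0; rewrite x00 normr0 ltxx.
have [r' r'0 g1] : exists2 r' : R, 0 < r' & forall x, `|x| < r' -> g x < 1.
  have := cg 0 => /cvgr_lt; rewrite g00 => /(_ _ ltr01) /nbhs_ballP[e /= e0 eP].
  by exists e => // x xe; apply: eP; rewrite -ball_normE /= sub0r normrN.
exists c, (Num.min r r'); split => //; first by rewrite lt_min r0.
move=> x /andP[x0]; rewrite lt_min => /andP[xr xr'].
have := g0 x; rewrite le_eqVlt => /orP[/eqP <-|gx0]; first exact: expR_ge0.
have := fx x; rewrite x0 xr => /(_ erefl); rewrite /f.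
rewrite inver gt_eqF// lne_EFin ?invr_gt0// lnV ?posrE// -EFinM abse_EFin lee_fin normrM normrN.
have lng : ln (g x) < 0 by apply: ln_lt0; rewrite gx0 g1.
rewrite (ltr0_norm lng) => cx.
rewrite -[X in X <= _](@lnK R) ?posrE// ler_expR lerNr.
by rewrite ler_pdivrMr// mulrC.
Qed.

(** * Superposition of the Dirichlet solutions *)

Lemma is_derive_tsum_slab (R : realType) (eps : R) (i : 'I_3) (f f' : nat -> R * R * R -> R)
    (M : nat -> R) (p : R * R * R) :
  slab eps p ->
  (forall n p, slab eps p -> is_derive p (basis3 R i) (f n) (f' n p)) ->
  (forall n p, slab eps p -> `|f n p| <= M n) ->
  (forall n p, slab eps p -> `|f' n p| <= M n) ->
  cvgn (series M) ->
  is_derive p (basis3 R i) (fun p => tsum (f ^~ p)) (tsum (f' ^~ p)).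
Proof.
move=> pV df fM f'M cM.
have [s sE] := set_coord_id i p.
have [a [b [sab abV]]] : exists a b : R, a < s < b /\ forall r, a < r < b ->
  slab eps (set_coord i p r).
  case: p pV sE => [[x y] t] [/= xI tI]; have [->|->|->] := ord3P i;
    rewrite /set_coord /slab /= ?inordK//=; case=> ->.
  - by exists (-1), 1.
  - by exists (y - 1), (y + 1); split=> //; lra.
  - by exists (- eps), eps.
rewrite -sE; apply/is_derive_set_coord.
have d n (r : R) : a < r < b -> is_derive r 1 (fun r =>
  f n (set_coord i p r)) (f' n (set_coord i p r)).
  by move=> rab; apply/is_derive_set_coord; apply: df; exact: abV.
have bf n r : a < r < b -> `|f n (set_coord i p r)| <= M n by move=> /abV; exact: fM.
have bf' n r : a < r < b -> `|f' n (set_coord i p r)| <= M n by move=> /abV; exact: f'M.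
exact: (is_derive_tsum sab d bf bf' cM).
Qed.

Lemma tsum_continuous_slab (R : realType) (eps : R) (f : nat -> R * R * R -> R)
    (M : nat -> R) (p : R * R * R) :
  slab eps p ->
  (forall n, {for p, continuous (f n)}) ->
  (forall n p, slab eps p -> `|f n p| <= M n) ->
  cvgn (series M) ->
  {for p, continuous (fun p => tsum (f ^~ p))}.
Proof.
move=> pV cf fM cM.
apply: (tannery _ (D := slab eps) (M := M)) => //.
- rewrite -[_ (slab eps)]/(nbhs p (slab eps)); apply: open_nbhs_nbhs.
  by split=> //; exact: open_slab.
- by move=> n; exact: fM.
Qed.

(* The series sum_j w_j U_j(x, t0 + t) cos (lam_j y); M bounds it together with
   its first and second derivatives along the axes. *)
Section superposition.
Variables (R : realType) (g : R -> R) (t0 eps : R) (lam w B M : nat -> R).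
Variables (U Ux Uxx Ut Utt : nat -> R -> R -> R).
Hypotheses (cg : continuous g) (g0 : forall x, 0 <= g x).
Hypotheses (w0 : forall j, 0 <= w j) (lam1 : forall j, 1 <= lam j).
Hypotheses (wM : forall j, w j * lam j ^+ 2 * B j <= M j) (cM : cvgn (series M)).
Hypothesis cU : forall j, continuous (fun z : R * R => U j z.1 z.2).
Hypothesis dU : forall j (x t : R), -1 < x < 1 ->
      [/\ is_derive x 1 ((U j) ^~ t) (Ux j x t), is_derive x 1 ((Ux j) ^~ t) (Uxx j x t),
       is_derive t 1 (U j x) (Ut j x t) & is_derive t 1 (Ut j x) (Utt j x t)].
Hypothesis cU' : forall j (z : R * R), -1 < z.1 < 1 ->
      [/\ {for z, continuous (fun z : R * R => Ux j z.1 z.2)},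
          {for z, continuous (fun z : R * R => Uxx j z.1 z.2)},
          {for z, continuous (fun z : R * R => Ut j z.1 z.2)} &
          {for z, continuous (fun z : R * R => Utt j z.1 z.2)}].
Hypothesis LU : forall j x t, -1 < x < 1 -> t0 - eps < t < t0 + eps ->
  Uxx j x t + Utt j x t = lam j ^+ 2 * g x * U j x t.
Hypothesis bU : forall j x t, -1 < x < 1 ->
  [/\ `|U j x t| <= B j, `|Ux j x t| <= B j, `|Uxx j x t| <= B j,
    `|Ut j x t| <= B j & `|Utt j x t| <= B j].

(** One shape for the j-th summand and all its derivatives: W records those in x and t, h those in
    y, and c collects the resulting powers of lam. *)
Let term (c : nat -> R) (W : nat -> R -> R -> R) (h : R -> R) (j : nat) (p : R * R * R) : R :=
  c j * W j p.1.1 (t0 + p.2) * h (lam j * p.1.2).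

Let term_continuous (c : nat -> R) (W : nat -> R -> R -> R) (h : R -> R) (j : nat)
  (p : R * R * R) : continuous h ->
  {for (p.1.1, t0 + p.2), continuous (fun z : R * R => W j z.1 z.2)} ->
  {for p, continuous (term c W h j)}.
Proof.
move=> ch cW; have c1 : {for p, continuous (fun p : R * R * R => p.1.1)}.
  by apply: (@cvg_comp _ _ _ fst fst); exact: cvg_fst.
have c2 : {for p, continuous (fun p : R * R * R => p.1.2)}.
  by apply: (@cvg_comp _ _ _ fst snd); [exact: cvg_fst|exact: cvg_snd].
have c3 : {for p, continuous (fun p : R * R * R => t0 + p.2)}.
  by apply: cvgD; [exact: cvg_cst|exact: cvg_snd].
apply: cvgM; last first.
  apply: (@cvg_comp _ _ _ (fun p : R * R * R => lam j * p.1.2) h); last exact: ch.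
  by apply: cvgM; [exact: cvg_cst|exact: c2].
apply: cvgM; first exact: cvg_cst.
apply: (@cvg_comp _ _ _ (fun p : R * R * R => (p.1.1, t0 + p.2)) (fun z : R * R => W j z.1 z.2));
  last exact: cW.
exact: (cvg_pair c1 c3).
Qed.

Let term_bound (c : nat -> R) (W : nat -> R -> R -> R) (h : R -> R) : (forall x, `|h x| <= 1) ->
  (forall j, `|c j| <= w j * lam j ^+ 2) ->
  (forall j x t, -1 < x < 1 -> `|W j x t| <= B j) ->
  forall j p, slab eps p -> `|term c W h j p| <= M j.
Proof.
move=> h1 cw WB j p [pI _]; apply: le_trans (wM j); rewrite !normrM -[leRHS]mulr1.
by apply: ler_pM => //; rewrite ?mulr_ge0//; apply: ler_pM => //; exact: WB.
Qed.

Let term_derive0 (c : nat -> R) (W W' : nat -> R -> R -> R) (h : R -> R) (j : nat)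
  (p : R * R * R) : is_derive p.1.1 1 ((W j) ^~ (t0 + p.2)) (W' j p.1.1 (t0 + p.2)) ->
  is_derive p (basis3 R ord0) (term c W h j) (term c W' h j p).
Proof.
case: p => [[x y] t] d; apply/(@is_derive_set_coord _ ord0 _ (x, y, t) x).
have d1 := @is_deriveZ _ _ _ _ (c j * h (lam j * y)) _ _ _ d.
rewrite (_ : (fun _ => _) = (c j * h (lam j * y)) \*: ((W j) ^~ (t0 + t))).
  by apply: is_derive_eq d1 _; rewrite /term/set_coord /GRing.scale/= mulrAC.
by apply/funext => s; rewrite /term /set_coord /GRing.scale/= mulrAC.
Qed.

Let term_derive2 (c : nat -> R) (W W' : nat -> R -> R -> R) (h : R -> R) (j : nat)
  (p : R * R * R) : is_derive (t0 + p.2) 1 (W j p.1.1) (W' j p.1.1 (t0 + p.2)) ->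
  is_derive p (basis3 R (inord 2)) (term c W h j) (term c W' h j p).
Proof.
case: p => [[x y] t] d.
have -> : (x, y, t) = set_coord (inord 2) (x, y, t) t by rewrite /set_coord inordK.
apply/is_derive_set_coord.
have s1 : is_derive t 1 (fun s : R => t0 + s) 1.
  rewrite -[X in is_derive _ _ _ X]add0r;
    exact: (is_deriveD (is_derive_cst t0 t 1) (is_derive_id t 1)).
have d0 := is_derive1_comp d s1.
have d1 := @is_deriveZ _ _ _ _ (c j * h (lam j * y)) _ _ _ d0.
rewrite (_ : (fun _ => _) = (c j * h (lam j * y)) \*: (fun s => W j x (t0 + s))).
  by apply: is_derive_eq d1 _; rewrite /term /set_coord inordK// /GRing.scale/= mulr1 mulrAC.
by apply/funext => s; rewrite /term /set_coord inordK// /GRing.scale/= mulrAC.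
Qed.

Let term_derive1 (c c' : nat -> R) (W : nat -> R -> R -> R) (h h' : R -> R) (j : nat)
  (p : R * R * R) :
  (forall y : R, is_derive y 1 h (h' y)) -> c j * lam j = c' j ->
  is_derive p (basis3 R (inord 1)) (term c W h j) (term c' W h' j p).
Proof.
case: p => [[x y] t] dh cc'.
have -> : (x, y, t) = set_coord (inord 1) (x, y, t) y by rewrite /set_coord inordK.
apply/is_derive_set_coord.
have s1 : is_derive y 1 (fun s => lam j * s) (lam j) by apply: is_derive_eq;
  rewrite /GRing.scale/= mulr1.
have d0 := is_derive1_comp (dh (lam j * y)) s1.
have d1 := @is_deriveZ _ _ _ _ (c j * W j x (t0 + t)) _ _ _ d0.
rewrite (_ : (fun _ => _) = (c j * W j x (t0 + t)) \*: (fun s => h (lam j * s))).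
  apply: is_derive_eq d1 _; rewrite /term /set_coord inordK// /GRing.scale/= -cc'.
  by ring.
by apply/funext => s; rewrite /term /set_coord inordK// /GRing.scale/=.
Qed.

Let sin1 (x : R) : `|sin x| <= 1. Proof. by rewrite ler_norml sin_geN1 sin_le1. Qed.
Let cos1 (x : R) : `|cos x| <= 1. Proof. by rewrite ler_norml cos_geN1 cos_le1. Qed.

Let nsin := fun x : R => - sin x.
Let ncos := fun x : R => - cos x.
Let dnsin (y : R) : is_derive y 1 nsin (ncos y). Proof. exact: is_deriveN. Qed.
Let cnsin : continuous nsin. Proof. by move=> x; apply: cvgN; exact: continuous_sin. Qed.
Let cncos : continuous ncos. Proof. by move=> x; apply: cvgN; exact: continuous_cos. Qed.
Let lam2 j : w j * lam j <= w j * lam j ^+ 2.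
Proof. by rewrite ler_wpM2l// expr2 ler_peMl// (le_trans ler01). Qed.
Let wl1 j : `|w j| <= w j * lam j ^+ 2.
Proof. by rewrite ger0_norm//; apply: le_trans (lam2 j); rewrite ler_peMr. Qed.
Let wl2 j : `|w j * lam j| <= w j * lam j ^+ 2.
Proof. by rewrite ger0_norm// mulr_ge0// (le_trans ler01). Qed.
Let wl3 j : `|w j * lam j ^+ 2| <= w j * lam j ^+ 2.
Proof. by rewrite ger0_norm// mulr_ge0// exprn_ge0// (le_trans ler01). Qed.

Let s1 (i : 'I_3) : nat -> R * R * R -> R :=
  if i == 0%N :> nat then term w Ux cos
  else if i == 1%N :> nat then term (fun j => w j * lam j) U nsin else term w Ut cos.
Let s2 (i : 'I_3) : nat -> R * R * R -> R :=
  if i == 0%N :> nat then term w Uxx cos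
  else if i == 1%N :> nat then term (fun j => w j * lam j ^+ 2) U ncos else term w Utt cos.

Let b0 j p : slab eps p -> `|term w U cos j p| <= M j.
Proof. by apply: term_bound => // k x t /(bU k)-/(_ t)[]. Qed.

Let b1 (i : 'I_3) j p : slab eps p -> `|s1 i j p| <= M j.
Proof.
rewrite /s1; case: ifP => _; [|case: ifP => _].
- by apply: term_bound => // k x t /(bU k)-/(_ t)[].
- by apply: term_bound => // [x|k x t /(bU k)-/(_ t)[]//]; rewrite normrN.
- by apply: term_bound => // k x t /(bU k)-/(_ t)[].
Qed.

Let b2 (i : 'I_3) j p : slab eps p -> `|s2 i j p| <= M j.
Proof.
rewrite /s2; case: ifP => _; [|case: ifP => _].
- by apply: term_bound => // k x t /(bU k)-/(_ t)[].
- by apply: term_bound => // [x|k x t /(bU k)-/(_ t)[]//]; rewrite normrN.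
- by apply: term_bound => // k x t /(bU k)-/(_ t)[].
Qed.

Let c0 j p : {for p, continuous (term w U cos j)}.
Proof. by apply: term_continuous; [exact: continuous_cos|exact: cU]. Qed.

Let c1 (i : 'I_3) j p : slab eps p -> {for p, continuous (s1 i j)}.
Proof.
move=> [pI _]; have [d1 d2 d3 d4] := @cU' j (p.1.1, t0 + p.2) pI.
rewrite /s1; case: ifP => _; [|case: ifP => _]; apply: term_continuous => //;
  by [exact: continuous_cos|exact: cU].
Qed.

Let c2 (i : 'I_3) j p : slab eps p -> {for p, continuous (s2 i j)}.
Proof.
move=> [pI _]; have [d1 d2 d3 d4] := @cU' j (p.1.1, t0 + p.2) pI.
rewrite /s2; case: ifP => _; [|case: ifP => _]; apply: term_continuous => //;
  by [exact: continuous_cos|exact: cU].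
Qed.

Let i1 : (inord 1 : 'I_3) = 1%N :> nat. Proof. by rewrite inordK. Qed.
Let i2 : (inord 2 : 'I_3) = 2%N :> nat. Proof. by rewrite inordK. Qed.

Let e1 (i : 'I_3) j p : slab eps p -> is_derive p (basis3 R i) (term w U cos j) (s1 i j p).
Proof.
move=> [pI _]; have [d1 d2 d3 d4] := @dU j _ (t0 + p.2) pI.
have [->|->|->] := ord3P i; rewrite /s1 ?i1 ?i2.
- exact: term_derive0.
- by apply: term_derive1 => // y; exact: is_derive_cos.
- exact: term_derive2.
Qed.

Let e2 (i : 'I_3) j p : slab eps p -> is_derive p (basis3 R i) (s1 i j) (s2 i j p).
Proof.
move=> [pI _]; have [d1 d2 d3 d4] := @dU j _ (t0 + p.2) pI.
have [->|->|->] := ord3P i; rewrite /s1 /s2 ?i1 ?i2.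
- exact: term_derive0.
- by apply: term_derive1 => //; rewrite expr2 mulrA.
- exact: term_derive2.
Qed.

Lemma superposition :
  (forall p, slab eps p -> {for p, continuous (fun p : R * R * R => tsum (fun j =>
    w j * U j p.1.1 (t0 + p.2) * cos (lam j * p.1.2)))}) /\
  weak_solution g (slab eps) (cst 0)
   (fun p : R * R * R => tsum (fun j => w j * U j p.1.1 (t0 + p.2) * cos (lam j * p.1.2))).
Proof.
have cu p : slab eps p -> {for p, continuous (fun p => tsum ((term w U cos) ^~ p))}.
  by move=> pV; apply: (tsum_continuous_slab pV _ b0 cM) => j; exact: c0.
split; first exact: cu.
apply: (@classical_weak_solution _ _ _ _ (fun i p => tsum ((s1 i) ^~ p)) (fun i p =>
  tsum ((s2 i) ^~ p)) cg g0 cu).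
- by move=> i p pV; exact: (is_derive_tsum_slab pV (e1 i) b0 (b1 i) cM).
- by move=> i p pV; apply: (tsum_continuous_slab pV _ (b1 i) cM) => j; exact: c1.
- by move=> i p pV; exact: (is_derive_tsum_slab pV (e2 i) (b1 i) (b2 i) cM).
- by move=> i p pV; apply: (tsum_continuous_slab pV _ (b2 i) cM) => j; exact: c2.
move=> p pV; have [pI tI] := pV.
have cv i := tsum_cvg (fun j => b2 i j pV) cM.
(* The equation holds summand by summand: the x and t derivatives produce lam^2 g U, and two y
   derivatives of cos (lam y) produce - lam^2. *)
have E : tsum (fun j => s2 ord0 j p + s2 (inord 2) j p) = tsum (fun j =>
  - g p.1.1 * s2 (inord 1) j p).
  congr tsum; apply/funext => j; rewrite /s2 i1 i2 /term -!mulrDl -!mulrDr LU//; last by lra.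
  by rewrite /ncos/=; ring.
move: E; rewrite tsumD; [|exact: cv|exact: cv]; rewrite tsumZ; last exact: cv.
by rewrite mulNr => E; rewrite addrAC E addNr.
Qed.

End superposition.

(** * Lacunary cosine series are not smooth *)

(** The sign is opposite to the usual one, so that cos (l y) is multiplied by 2 (1 - cos (l h)) >= 0
    and nonnegative coefficients stay nonnegative under iteration. *)
Definition second_diff (R : realType) (h : R) (f : R -> R) (y : R) : R :=
  2 * f y - f (y + h) - f (y - h).

Lemma is_derive_shift (R : realType) (F : R -> R) (e x l : R) :
  is_derive (x + e) 1 F l -> is_derive x 1 (fun s => F (s + e)) l.
Proof.
move=> dF; have d1 : is_derive x 1 (fun s : R => s + e) 1.
  rewrite -[X in is_derive _ _ _ X]addr0;
    exact: (is_deriveD (is_derive_id x 1) (is_derive_cst e x 1)).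
have d := @is_derive1_comp _ F (fun s => s + e) x _ _ dF d1; rewrite mulr1 in d; exact: d.
Qed.

Lemma second_diff_le (R : realType) (f f1 f2 : R -> R) (h S y : R) : 0 < h ->
  (forall x : R, is_derive x 1 f (f1 x)) -> (forall x : R, is_derive x 1 f1 (f2 x)) ->
  (forall x, `|x - y| <= h -> `|f2 x| <= S) ->
  `|second_diff h f y| <= h ^+ 2 * S.
Proof.
move=> h0 df df1 f2S.
have dchi (x : R) : is_derive x 1 (fun s => f (s + h) - f s) (f1 (x + h) - f1 x).
  by apply: is_deriveB; exact: is_derive_shift.
have [||xi xiI E1] := MVT (a := y - h) (b := y) _ (fun x _ => dchi x).
- by rewrite ltrBlDr ltrDl.
- apply: continuous_subspaceT => x; exact: is_derive_continuous (dchi x).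
have [||et etI E2] := MVT (a := xi) (b := xi + h) _ (fun x _ => df1 x).
- by rewrite ltrDl.
- apply: continuous_subspaceT => x; exact: is_derive_continuous (df1 x).
have -> : second_diff h f y = - (h ^+ 2 * f2 et).
  rewrite subrK in E1; rewrite /second_diff.
  have -> : 2 * f y - f (y + h) - f (y - h) = - (f (y + h) - f y - (f y - f (y - h))) by ring.
  by rewrite E1 E2; ring.
move: xiI etI; rewrite !in_itv/= => /andP[x1 x2] /andP[e1 e2].
have h2 : 0 <= h ^+ 2 by rewrite exprn_ge0// ltW.
rewrite normrN normrM (ger0_norm h2); apply: ler_wpM2l => //.
apply: f2S; rewrite ler_norml; apply/andP; split; lra.
Qed.

(** Induction over whole chains of derivatives: [second_diff h] of a chain is again one, its second
    derivatives are bounded on a window shorter by h, and one application costs h^2. *)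
Lemma iter_second_diff_le (R : realType) (h : R) (k : nat) (F : nat -> R -> R) (X S y : R) :
  0 < h -> (forall n (x : R), is_derive x 1 (F n) (F n.+1 x)) ->
  `|y| + k%:R * h <= X -> (forall x, `|x| <= X -> `|F k.*2 x| <= S) ->
  `|iter k (second_diff h) (F 0%N) y| <= h ^+ k.*2 * S.
Proof.
move=> h0; elim: k F X S => [|k IH] F X S dF yX FS.
  by rewrite /= expr0 mul1r; apply: FS; move: yX; rewrite mul0r addr0.
rewrite iterSr doubleS (_ : h ^+ k.*2.+2 * S = h ^+ k.*2 * (h ^+ 2 * S));
  last by rewrite mulrA -exprD addn2.
apply: (IH (fun n => second_diff h (F n)) (X - h)).
- move=> n x; have d (e : R) := is_derive_shift (dF n (x + e)).
  have d2 := is_deriveB (is_deriveB (is_deriveZ 2 (dF n x)) (d h)) (d (- h)).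
  exact: d2.
- by move: yX; rewrite -natr1 mulrDl mul1r => yX; lra.
- move=> x xX; apply: (second_diff_le h0 (dF k.*2) (dF k.*2.+1)) => z zx.
  by apply: FS; rewrite -[z](subrK x) (le_trans (ler_normD _ _))//; lra.
Qed.

Lemma is_cvg_series_lin (R : realType) (u v : nat -> R) (a b : R) :
  cvgn (series u) -> cvgn (series v) -> cvgn (series (fun n => a * u n + b * v n)).
Proof.
move=> cu cv; rewrite (_ : series _ = fun n => a * series u n + b * series v n); last first.
  by apply/funext => n; rewrite /series/= big_split/= !mulr_sumr.
by apply: is_cvgD; apply: is_cvgM => //; exact: is_cvg_cst.
Qed.

Lemma is_cvg_seriesZl (R : realType) (u : nat -> R) (a : R) :
  cvgn (series u) -> cvgn (series (fun n => a * u n)).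
Proof.
move=> cu; have := @is_cvg_series_lin R u u a 0 cu cu.
by under [X in series X]eq_fun do rewrite mul0r addr0.
Qed.

Lemma iter_second_diff_cos (R : realType) (h : R) (k : nat) (A l : nat -> R) :
  (forall j, 0 <= A j) -> cvgn (series A) ->
  iter k (second_diff h) (fun y => tsum (fun j => A j * cos (l j * y))) =
  (fun y => tsum (fun j => A j * (2 * (1 - cos (l j * h))) ^+ k * cos (l j * y))).
Proof.
move=> A0 cA; elim: k => [|k IH].
  by apply/funext => y /=; congr tsum; apply/funext => j; rewrite expr0 mulr1.
rewrite iterS IH; apply/funext => y; rewrite /second_diff.
have b z j : `|A j * (2 * (1 - cos (l j * h))) ^+ k * cos (l j * z)| <= 4 ^+ k * A j.
  rewrite !normrM normrX (ger0_norm (A0 j)) mulrAC mulrC.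
  apply: ler_pM => //; first by rewrite mulr_ge0.
    by rewrite lerXn2r ?nnegrE// ler_norml; have := cos_le1 (l j * h);
      have := cos_geN1 (l j * h); move=> *; apply/andP; split; lra.
  by rewrite ler_piMr// ler_norml cos_geN1 cos_le1.
have cv z : cvgn (series (fun j => A j * (2 * (1 - cos (l j * h))) ^+ k * cos (l j * z))).
  by apply: tsum_cvg (b z) _; exact: (@is_cvg_seriesZl R _ (4 ^+ k) cA).
have E1 := tsum_lin 1 1 (cv (y + h)) (cv (y - h)).
have cE1 := @is_cvg_series_lin R _ _ 1 1 (cv (y + h)) (cv (y - h)).
have := tsum_lin 2 (-1) (cv y) cE1; rewrite E1 !mul1r mulN1r opprD addrA => <-.
congr tsum; apply/funext => j; rewrite (mulrDr (l j) y h) (mulrBr (l j) y h) cosD cosB exprS.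
by ring.
Qed.

(* With step h = pi / 2^J, the k-th iterated second difference at 0 is a sum of
   nonnegative terms, the J-th one being 4^k A_J; smoothness bounds it by
   C h^(2k), which is o((2^-J)^K) for k > K / 2. *)
Lemma lacunary_not_smooth (R : realType) (A : nat -> R) (F : nat -> R -> R) (del : R) (K J : nat) :
  (forall j, 0 <= A j) -> cvgn (series A) -> 0 < del ->
  (forall j, (J <= j)%N -> del * (2^-1 ^+ j) ^+ K <= A j) ->
  (forall n (x : R), is_derive x 1 (F n) (F n.+1 x)) ->
  F 0%N = (fun y => tsum (fun j => A j * cos (2 ^+ j * y))) -> False.
Proof.
move=> A0 cA del0 AJ dF F0.
(* With p = 2^-j, p^(2k) = p^K p p^(K+1): the first factor cancels the lower bound on A_j, and the
   second remains to give the contradiction. *)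
pose k := K.+1.
(* As h <= pi <= 4, k steps from 0 stay in |x| <= 4 k for every j, so a single bound S on the
   derivative of order 2k serves. *)
have pi0 := pi_gt0 R; have pi4 : pi <= 4 :> R by have /andP[_] := pihalf_02 R; lra.
have [S S0 FS] : exists2 S : R, 0 <= S & forall x, `|x| <= 4 * k%:R -> `|F k.*2 x| <= S.
  have cF (x : R) : {for x, continuous (F k.*2)} by exact: is_derive_continuous (dF _ x).
  have [C C0 CP] := compact_continuous_bounded (@segment_compact R (- (4 * k%:R)) (4 * k%:R))
    (fun x _ => cF x).
  by exists C => // x; rewrite ler_norml => xI; apply: CP; rewrite /= in_itv.
have key j : (J <= j)%N -> del * 2 ^+ j <= pi ^+ k.*2 * S.
  move=> Jj; pose h : R := pi * 2^-1 ^+ j.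
  have l0 : 0 < 2 ^+ j :> R by rewrite exprn_gt0.
  have h0 : 0 < h by rewrite mulr_gt0// exprn_gt0// invr_gt0.
  have lh : 2 ^+ j * h = pi by rewrite /h exprVn mulrCA mulfV ?mulr1// gt_eqF.
  have hpi : h <= 4 by apply: le_trans pi4; rewrite -lh; apply: ler_peMl;
    [exact: ltW|apply: exprn_ege1; exact: ler1n].
  have := @iter_second_diff_le _ h k F (4 * k%:R) S 0 h0 dF.
  rewrite normr0 add0r mulrC ler_wpM2r// => /(_ isT FS).
  rewrite F0 iter_second_diff_cos//.
  rewrite (_ : (fun i => _) = fun i => A i * (2 * (1 - cos (2 ^+ i * h))) ^+ k); last first.
    by apply/funext => i; rewrite mulr0 cos0 mulr1.
  have c2 i : 0 <= 2 * (1 - cos (2 ^+ i * h)) <= 4.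
    by have := cos_le1 (2 ^+ i * h); have := cos_geN1 (2 ^+ i * h); move=> *; apply/andP; split;
      lra.
  have a0 i : 0 <= A i * (2 * (1 - cos (2 ^+ i * h))) ^+ k.
    by rewrite mulr_ge0// exprn_ge0//; have /andP[] := c2 i.
  have ca : cvgn (series (fun i => A i * (2 * (1 - cos (2 ^+ i * h))) ^+ k)).
    apply: tsum_cvg (@is_cvg_seriesZl R _ (4 ^+ k) cA) => i /=.
    have /andP[c20 c24] := c2 i.
    by rewrite ger0_norm// mulrC ler_wpM2r// lerXn2r ?nnegrE.
  rewrite ger0_norm; last exact: le_trans (a0 0%N) (tsum_ge_term 0 a0 ca).
  move=> TS; have := le_trans (tsum_ge_term j a0 ca) TS.
  rewrite lh cospi opprK (_ : 2 * (1 + 1) = 4); last by ring.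
  have Ak := AJ j Jj; pose p : R := 2^-1 ^+ j; rewrite -/p in Ak.
  have p0 : 0 < p by rewrite exprn_gt0// invr_gt0.
  rewrite (_ : h = pi * p)// => AS.
  have : del * p ^+ K <= pi ^+ k.*2 * p ^+ k.*2 * S.
    rewrite -exprMn; apply: le_trans AS; apply: le_trans Ak _.
    by apply: ler_peMr => //; apply: exprn_ege1; rewrite ler1n.
  have -> : p ^+ k.*2 = p ^+ K * p * p ^+ K.+1 by rewrite -exprSr -exprD addnn.
  have pk1 : p ^+ K.+1 <= 1.
    apply: exprn_ile1; first exact: ltW.
    by apply: exprn_ile1; rewrite ?invr_ge0// invf_le1// ler1n.
  have pK : 0 < p ^+ K by rewrite exprn_gt0.
  have -> : pi ^+ k.*2 * (p ^+ K * p * p ^+ K.+1) * S =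
    pi ^+ k.*2 * p * p ^+ K.+1 * S * p ^+ K by ring.
  rewrite ler_pM2r// => dp.
  have -> : 2 ^+ j = p^-1 by rewrite /p exprVn invrK.
  rewrite ler_pdivrMr//; apply: (le_trans dp).
  have -> : pi ^+ k.*2 * p * p ^+ K.+1 * S = pi ^+ k.*2 * S * p * p ^+ K.+1 by ring.
  by apply: ler_piMr => //; apply: mulr_ge0; [apply: mulr_ge0 => //; apply: exprn_ge0;
    exact: ltW|exact: ltW].
pose X := pi ^+ k.*2 * S / del.
have X0 : 0 <= X by apply: divr_ge0; [apply: mulr_ge0 => //; apply: exprn_ge0;
  exact: ltW|exact: ltW].
pose j := maxn J (Num.bound X).
have := key j (leq_maxl _ _); rewrite mulrC -ler_pdivlMr// -/X leNgt => /negP; apply.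
apply: (lt_le_trans (archi_boundP X0)).
rewrite -natrX ler_nat (leq_trans (leq_maxr J _))//.
by apply: ltnW; exact: ltn_expl.
Qed.

(** * The singular solution *)

(** For |x| <= r, c/|x| is at least 2 (j+1) ln 2, so g x <= 4^-j. Taking j + 1 in place of j leaves
    a positive radius also for j = 0. *)
Lemma decay_scale (R : realType) (g : R -> R) (c r0 r : R) (j : nat) :
  (forall x, 0 <= g x) -> g 0 = 0 -> 0 < c -> (forall x, 0 < `|x| < r0 ->
    g x <= expR (- (c / `|x|))) ->
  0 < r < r0 -> r <= c / (2 * (j.+1%:R * ln 2)) ->
  forall x, - r <= x <= r -> (2 ^+ j) ^+ 2 * g x <= 1.
Proof.
move=> g0 g00 c0 gc /andP[rp rr0] rj x xr.
have [->|x0] := eqVneq x 0; first by rewrite g00 mulr0.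
have ax : 0 < `|x| by rewrite normr_gt0.
have xr' : `|x| <= r by rewrite ler_norml.
have l2 : 0 < ln 2 :> R by rewrite ln_gt0// ltr1n.
have D0 : 0 < 2 * (j.+1%:R * ln 2) :> R by rewrite !mulr_gt0.
have h1 : 2 * (j.+1%:R * ln 2) <= c / `|x|.
  by rewrite ler_pdivlMr// mulrC -ler_pdivlMr// (le_trans xr').
have gx : g x <= expR (- (2 * (j%:R * ln 2))).
  apply: le_trans (gc x _) _; first by rewrite ax (le_lt_trans xr').
  rewrite ler_expR lerN2; apply: le_trans h1.
  by rewrite ler_pM2l// ler_pM2r// ler_nat.
have -> : (2 ^+ j) ^+ 2 = expR (2 * (j%:R * ln 2)) :> R.
  by rewrite !expRM_natl lnK// posrE.
apply: le_trans (ler_wpM2l (expR_ge0 _) gx) _.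
by rewrite -expRD addrN expR0.
Qed.

Lemma singular_solution (R : realType) (g : R -> R) (c r0 : R) :
  continuous g -> (forall x, 0 <= g x) -> g 0 = 0 -> 0 < c -> 0 < r0 ->
  (forall x, 0 < `|x| < r0 -> g x <= expR (- (c / `|x|))) ->
  exists (eps : R) (u : R * R * R -> R) (A : nat -> R) (del : R) (K J : nat),
  [/\ 0 < eps, (forall p, slab eps p ->
    {for p, continuous u}), weak_solution g (slab eps) (cst 0) u,
    (forall y, u (0, y, 0) = tsum (fun j => A j * cos (2 ^+ j * y))) &
   [/\ forall j, 0 <= A j, cvgn (series A), 0 < del &
       forall j, (J <= j)%N -> del * (2^-1 ^+ j) ^+ K <= A j]].
Proof.
move=> cg g0 g00 c0 r00 gc.
have pi0 := pi_gt0 R.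
(* The window of radius pi/6 about pi/3 is ]pi/6, pi/2[, which lies above the support |t| <= a of
   the hat and below the upper boundary. *)
pose a : R := pi / 6; pose t0 : R := pi / 3; pose eps : R := pi / 6.
have aI : 0 < a < pi / 2 by rewrite /a; lra.
have tI : 0 < t0 < pi / 2 by rewrite /t0; lra.
have t0I : - (pi / 2) <= t0 <= pi / 2 by rewrite /t0; lra.
have t02 : 0 <= t0 + 2 by rewrite /t0; lra.
have eps0 : 0 < eps by rewrite /eps; lra.
have tfar t : t0 - eps < t < t0 + eps -> `|t| <= pi / 2 /\ ~~ (`|t| <= a).
  rewrite /t0 /eps /a => tI'; have t_ge0 : 0 <= t by lra.
  by rewrite ger0_norm// -ltNge; split; lra.
have [A0 A00 sol] := dirichlet_solution a.
have [del del0 low] := dirichlet_lower_bound aI tI.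
have [m m0 hatE] := hat_value aI.
have [Q0 Q00 gQ] := compact_continuous_bounded (@segment_compact R (-1) 1) (fun x _ => cg x).
pose l (j : nat) : R := 2 ^+ j; pose p (j : nat) : R := 2^-1 ^+ j.
have l1 j : 1 <= l j by rewrite exprn_ege1// ler1n.
have l0 j : 0 < l j by rewrite exprn_gt0.
have p0 j : 0 < p j by rewrite exprn_gt0// invr_gt0.
have pl j : p j * l j = 1 by rewrite /p /l -exprMn mulVf ?expr1n.
pose q j x := l j ^+ 2 * g x.
have cq j : continuous (q j) by move=> x; apply: cvgM; [exact: cvg_cst|exact: cg].
have q0 j x : 0 <= q j x by rewrite mulr_ge0// exprn_ge0// ltW.
have qQ j x : -1 <= x <= 1 -> 0 <= q j x <= l j ^+ 2 * Q0.
  move=> xI; rewrite q0/= ler_wpM2l ?exprn_ge0 ?(ltW (l0 j))//.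
  by apply: le_trans (ler_norm _) (gQ x _); rewrite /= in_itv.
pose P j (F : (R -> R -> R) * (R -> R -> R) * (R -> R -> R) * (R -> R -> R) * (R -> R -> R)) :=
  let U := F.1.1.1.1 in let Ux := F.1.1.1.2 in let Uxx := F.1.1.2 in let Ut := F.1.2 in let Utt
    := F.2 in
  [/\ continuous (fun z : R * R => U z.1 z.2) /\
     (forall x t, ~~ ((-1 < x < 1) && (- (pi / 2) < t < pi / 2)) -> - (pi / 2) <= t <= pi / 2 ->
       U x t = 0),
     (forall x t : R, -1 < x < 1 ->
      [/\ is_derive x 1 (U ^~ t) (Ux x t), is_derive x 1 (Ux ^~ t) (Uxx x t),
       is_derive t 1 (U x) (Ut x t) & is_derive t 1 (Ut x) (Utt x t)]),
     (forall z : R * R, -1 < z.1 < 1 ->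
      [/\ {for z, continuous (fun z : R * R => Ux z.1 z.2)},
          {for z, continuous (fun z : R * R => Uxx z.1 z.2)},
          {for z, continuous (fun z : R * R => Ut z.1 z.2)} &
          {for z, continuous (fun z : R * R => Utt z.1 z.2)}]),
     (forall x t, -1 < x < 1 ->
        Uxx x t + Utt x t = q j x * U x t - tsum (fun k => hat_coef a k * cos (freq R k * t))) &
     (forall x t, -1 < x < 1 -> let B := A0 * (1 + l j ^+ 2 * Q0) in
        [/\ `|U x t| <= B, `|Ux x t| <= B, `|Uxx x t| <= B, `|Ut x t| <= B & `|Utt x t| <= B])].
have /choice[F FP] : forall j, exists F, P j F.
  move=> j; have [U [Ux [Uxx [Ut [Utt H]]]]] := sol (q j) (l j ^+ 2 * Q0) (cq j) (qQ j).
  by exists (U, Ux, Uxx, Ut, Utt).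
pose U j := (F j).1.1.1.1; pose Ux j := (F j).1.1.1.2; pose Uxx j := (F j).1.1.2.
pose Ut j := (F j).1.2; pose Utt j := (F j).2.
(* Two of the five powers pay for lam^2 from the y derivatives and two for lam^2 in [B j]; the last
   one gives the ratio 1/2 of the majorant. *)
pose w j := p j ^+ 5; pose B j := A0 * (1 + l j ^+ 2 * Q0);
  pose M := geometric (A0 * (1 + Q0)) (2^-1 : R).
have w0 j : 0 <= w j by rewrite exprn_ge0// ltW.
have l21 j : 1 <= l j ^+ 2 by rewrite exprn_ege1.
have B0 j : 0 <= B j by rewrite mulr_ge0// addr_ge0// mulr_ge0// (le_trans _ (l21 j)).
have wM j : w j * l j ^+ 2 * B j <= M j.
  have -> : M j = w j * l j ^+ 2 * (A0 * (l j ^+ 2 * (1 + Q0))).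
    rewrite /M /geometric /= -/(p j) /w.
    have -> : p j ^+ 5 * l j ^+ 2 * (A0 * (l j ^+ 2 * (1 + Q0))) =
      p j * (p j * l j) ^+ 4 * (A0 * (1 + Q0)) by ring.
    by rewrite pl expr1n mulr1 mulrC.
  rewrite ler_wpM2l ?mulr_ge0 ?exprn_ge0 ?(ltW (l0 j))// ler_wpM2l// mulrDr mulr1.
  by rewrite lerD2r.
have cM : cvgn (series M) := @cvg_geometric_half R _.
have LU j x t : -1 < x < 1 -> t0 - eps < t < t0 + eps ->
    Uxx j x t + Utt j x t = l j ^+ 2 * g x * U j x t.
  move=> xI /tfar[tpi ta]; have [_ _ _ E _] := FP j.
  by rewrite [LHS]E// hatE// (negbTE ta) subr0.
pose rr j : R := c / (2 * (j.+1%:R * ln 2)).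
have l2 : 0 < ln 2 :> R by rewrite ln_gt0// ltr1n.
have rr0 j : 0 < rr j by rewrite divr_gt0// !mulr_gt0.
have lowj j r : 0 < r < r0 -> r < 1 -> r <= rr j ->
    0 <= U j 0 t0 /\ del * expR (- ((t0 + 2) * (pi / (2 * r)))) <= U j 0 t0.
  move=> /andP[rp rr1] r1 rj; have [[f1 f2] f3 _ f4 _] := FP j.
  have r01 : 0 < r < 1 by rewrite rp.
  have r00' : 0 < r < r0 by rewrite rp.
  have [pos lo] := low (q j) r (U j) (Ux j) (Uxx j) (Ut j) (Utt j) (fun x _ => q0 j x) r01
    (decay_scale g0 g00 c0 gc r00' rj) f1 f2 f3 f4.
  by split=> //; apply: pos => //; rewrite lerN10 ler01.
(* Nonnegativity is required for every j, including small j for which [rr j] may be too large; there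
   a smaller radius serves. *)
have U0 j : 0 <= U j 0 t0.
  pose r := Num.min (rr j) (Num.min (2^-1) (r0 / 2)).
  have [|||//] := lowj j r.
  - by rewrite !lt_min rr0 invr_gt0 ltr0n divr_gt0//= !gt_min; apply/orP; right; apply/orP;
      right; lra.
  - by rewrite !gt_min; apply/orP; right; apply/orP; left; rewrite invf_lt1// ltr1n.
  - by rewrite ge_min lexx.
have [cu wu] := @superposition R g t0 eps l w B M U Ux Uxx Ut Utt cg g0 w0 l1 wM cM
  (fun j => (let: And5 h _ _ _ _ := FP j in h.1)) (fun j => let: And5 _ h _ _ _ := FP j in h)
  (fun j => let: And5 _ _ h _ _ := FP j in h) LU (fun j => let: And5 _ _ _ _ h := FP j in h).
(* For r = rr j the exponent (t0 + 2) pi / (2 r) is (t0 + 2)(pi/c)(j+1) ln 2, so the exponential is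
   at least 2^(-N (j+1)). *)
pose N := Num.bound ((t0 + 2) * (pi / c)).
have N0 : (t0 + 2) * (pi / c) <= N%:R.
  apply: ltW; apply: archi_boundP; apply: mulr_ge0 => //.
  by apply: divr_ge0; exact: ltW.
(* From J on, [rr j] is below both 1 and r0, so it can be used itself as the half-width of the
   strip. *)
pose J := Num.bound (c / (2 * ln 2) * (1 + r0^-1)).
have rJ j : (J <= j)%N -> rr j < 1 /\ rr j < r0.
  move=> Jj; have D0 : 0 < c / (2 * ln 2) by rewrite divr_gt0// mulr_gt0.
  have r0i : 0 < r0^-1 by rewrite invr_gt0.
  have : c / (2 * ln 2) * (1 + r0^-1) < j.+1%:R.
    apply: (lt_le_trans (archi_boundP _)); last by rewrite ler_nat (leq_trans Jj).
    by rewrite mulr_ge0 ?(ltW D0)// addr_ge0// ltW.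
  have -> : rr j = c / (2 * ln 2) / j.+1%:R.
    by rewrite /rr mulrCA invfM mulrCA mulrC.
  rewrite mulrDr mulr1; move: (c / (2 * ln 2)) D0 => D D0 jD.
  have Dr : 0 < D / r0 by rewrite divr_gt0.
  have j0 : 0 < j.+1%:R :> R by [].
  split; rewrite ltr_pdivrMr//; first by clear - jD Dr; lra.
  by rewrite mulrC -ltr_pdivrMr//; clear - jD D0; lra.
(* The exponent is 5 from the weight plus N from the lower bound; the factor 2^-N accounts for j + 1
   instead of j. *)
eexists eps, _, (fun j => w j * U j 0 t0), (del * 2^-1 ^+ N), (5 + N)%N, J.
split; [exact: eps0|exact: cu|exact: wu| |].
  by move=> y; congr tsum; apply/funext => j; rewrite addr0.
split.
- by move=> j; rewrite mulr_ge0.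
- apply: tsum_cvg cM => j; have [_ _ _ _ b] := FP j.
  have [|b0 _ _ _ _] := b 0 t0; first by rewrite ltrN10 ltr01.
  apply: le_trans (wM j); rewrite normrM ger0_norm// -mulrA ler_wpM2l//.
  by apply: le_trans b0 _; exact: ler_peMl (B0 j) (l21 j).
- by rewrite mulr_gt0// exprn_gt0// invr_gt0.
move=> j /rJ[j1 j2]; have [_ lo] := lowj j (rr j) (introT andP (conj (rr0 j) j2)) j1 (lexx _).
rewrite exprD mulrCA; apply: (ler_wpM2l (w0 j)); apply: le_trans lo.
rewrite -mulrA; apply: (ler_wpM2l (ltW del0)).
rewrite -exprM -exprD.
have -> : (2^-1 : R) ^+ (N + j * N) = expR (- (N%:R * (j.+1%:R * ln 2))).
  by rewrite expRN expRM_natl expRM_natl lnK ?posrE// exprVn -exprM mulSn.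
rewrite ler_expR lerN2.
have -> : (t0 + 2) * (pi / (2 * rr j)) = (t0 + 2) * (pi / c) * (j.+1%:R * ln 2).
  rewrite /rr; field.
  by rewrite !gt_eqF// mulr_gt0.
by rewrite ler_wpM2r// ltW// mulr_gt0.
Qed.

(** The set where u and v differ is open in V, so if nonempty it would contain a box, which has
    positive measure. *)
Lemma ae_eq_continuous (R : realType) (V : set (R * R * R)) (u v : R * R * R -> R) :
  open V -> (forall p, V p -> {for p, continuous u}) -> (forall p, V p -> {for p, continuous v}) ->
  {ae mu3 R, forall p, V p -> u p = v p} -> forall p, V p -> u p = v p.
Proof.
move=> oV cu cv [N [mN N0 uvN]] p Vp; apply/eqP/negPn/negP => uvp.
have : \forall q \near p, V q /\ u q - v q != 0.
  apply: filterI; first exact: open_nbhs_nbhs.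
  have c : {for p, continuous (fun q => u q - v q)} by apply: cvgB; [exact: cu|exact: cv].
  have uv0 : u p - v p != 0 by rewrite subr_eq0.
  exact: (cvgr_neq0 _ c uv0).
move=> /nbhs_ballP[e /= e0 eP].
pose d := e / 2; have d0 : 0 < d by rewrite divr_gt0.
have boxN : box (fun i => coord i p - d) (fun i => coord i p + d) `<=` N.
  move=> q qB; have near (i : 'I_3) : ball (coord i p) e (coord i q).
    have /andP[q1 q2] := qB i; rewrite -ball_normE /= distrC (@le_lt_trans _ _ d)//.
      by rewrite ler_norml; apply/andP; split; lra.
    by rewrite /d; lra.
  apply: uvN => /= uvq; have [|Vq] := eP q; last by rewrite uvq// subrr eqxx.
  by have := near (inord 1); have := near (inord 2); rewrite /coord !inordK// => ? ?; split;
    [split|]; first exact: (near ord0).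
have := @mu3_box_gt0 R (fun i => coord i p - d) (fun i => coord i p + d).
move=> /(_ _)/wrap[i|]; first by lra.
rewrite lt_neqAle eq_sym => /andP[/eqP + _]; apply; apply: (subset_measure0 _ mN boxN N0).
exact: measurable_box.
Qed.

Lemma smooth_on_cst (R : realType) (V : set (R * R * R)) (k : R) : smooth_on V (cst k).
Proof.
move=> s p _; have -> : iter_partial s (cst k) = cst (if s is [::] then k else 0).
  elim: s => //= i s ->; apply/funext => q.
  exact: derive_cst.
by split=> [|i]; [exact: cvg_cst|exact: derivable_cst].
Qed.

Lemma is_derive_iter_partial (R : realType) (V : set (R * R * R)) (v : R * R * R -> R)
  (s : seq 'I_3) (i : 'I_3)
  (p : R * R * R) : smooth_on V v -> V p ->
  is_derive p (basis3 R i) (iter_partial s v) (iter_partial (i :: s) v p).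
Proof. by move=> sv Vp; have [_ d] := sv s p Vp; split; [exact: d|]. Qed.

Unset Implicit Arguments.

Theorem theorem114 (R : realType) (g : R -> R)
  (g_smooth : smooth1 g)
  (g_ge0 : forall x : R, 0 <= g x)
  (g_0 : g 0 = 0)
  (g_decay : decay_liminf g <> 0%E) :
  exists2 eps : R, 0 < eps & ~ W12A_hypoelliptic g (slab eps).
Proof.
have cg : continuous g.
  by move=> x; exact/differentiable_continuous/derivable1_diffP/(g_smooth 0%N).
have [c [r0 [c0 r00 gc]]] := decay_bound cg g_ge0 g_0 g_decay.
have [eps [u [A [del [K [J [eps0 cu wu uA [A0 cA del0 AJ]]]]]]]] :=
  singular_solution cg g_ge0 g_0 c0 r00 gc.
exists eps => // hyp; have [v sv uv] := hyp _ (@smooth_on_cst _ _ 0) _ wu.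
have {}uv p : slab eps p -> u p = v p.
  by apply: ae_eq_continuous uv p; [exact: open_slab|exact: cu|move=> p /(sv [::])[]].
have line (y : R) : slab eps (0, y, 0).
  by split=> /=; lra.
(* The iterated y derivatives of the smooth representative along the y axis, which lies entirely in
   the slab; [F 0] is the lacunary series. *)
pose F n y := iter_partial (nseq n (inord 1)) v (0, y, 0).
have F0 : F 0%N = (fun y => tsum (fun j => A j * cos (2 ^+ j * y))).
  by apply/funext => y; rewrite -uA uv.
have dF n (y : R) : is_derive y 1 (F n) (F n.+1 y).
  have := is_derive_iter_partial (nseq n (inord 1)) (inord 1) sv (line y).
  have E (s : R) : (0, s, 0) = set_coord (inord 1) (0, y, 0) s by rewrite /set_coord inordK.
  rewrite (E y) => /is_derive_set_coord; rewrite -E.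
  by under [X in is_derive _ _ X _]eq_fun do rewrite -E.
exact: (lacunary_not_smooth A0 cA del0 AJ dF F0).
Qed.
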